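(* For all admissible Kerr-adS parameters $(M,a,k)$ which satisfy the Hawking-Reall bound $a<kr_+^2$, there exists $m_0\in\mathbb{N}$, depending on $(M,a,k)$, such that for all $m\in\mathbb{Z}$ with $|m|\geq m_0$ there does not exist any non-trivial pair (i.e. not both identically zero) of stationary modes $$\widetilde\alpha^{[+2]}(t,r,\vartheta,\varphi)=e^{-im\omega_+t}R^{[+2]}(r)S^{[+2]}(\vartheta)e^{+im\varphi},\qquad \widetilde\alpha^{[-2]}(t,r,\vartheta,\varphi)=e^{+im\omega_+t}R^{[-2]}(r)S^{[-2]}(\vartheta)e^{-im\varphi},$$ which are spin-$\pm2$-weighted complex-valued functions regular up to infinity, are solutions to the Teukolsky equations, are regular at the future event horizon, and satisfy the conformal boundary conditions at infinity.
   Context: **Parameters.** For real $(M,a,k)$ put $\Delta(r):=(r^2+a^2)(1+k^2r^2)-2Mr$, $\Xi:=1-a^2k^2$, $\Delta_\vartheta:=1-a^2k^2\cos^2\vartheta$, $\Sigma:=r^2+a^2\cos^2\vartheta$. The parameters are admissible (subextremal) Kerr-adS parameters if $M,k>0$, $a\geq0$, $ak<1$ and the polynomial $\Delta$ has two distinct non-negative roots; $r_+$ denotes the largest root of $\Delta$, and $\omega_+:=\frac{a}{r_+^2+a^2}$. The spacetime manifold is $\mathbb{R}_t\times(r_+,+\infty)_r\times\mathbb{S}^2_{\vartheta,\varphi}$. The tortoise coordinate $r^\star=r^\star(r)\in(-\infty,0)$ is defined by $\frac{dr^\star}{dr}=\frac{r^2+a^2}{\Delta}$ and $r^\star(r)\to0$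 as $r\to+\infty$; $r^\star=0$ is called infinity, and $r^\star\to-\infty$ corresponds to $r\to r_+$. **Spin-weighted functions.** $\mathcal{S}^{[\pm2]}$ is the space of smooth spin-$\pm2$-weighted complex functions on $\mathbb{S}^2$: with $s=\pm2$, these are functions of $(\vartheta,\varphi)\in(0,\pi)\times\mathbb{R}/2\pi\mathbb{Z}$, smooth away from the poles, such that $e^{is\varphi}\alpha$ extends smoothly to the pole $\vartheta=0$ and $e^{-is\varphi}\alpha$ extends smoothly to the pole $\vartheta=\pi$. **Teukolsky equations.** For spin-$\pm2$-weighted functions $\alpha^{[\pm2]}$ these are $$\begin{aligned}0={}&\Box\alpha^{[\pm2]}\pm2\frac{\partial_r\Delta}{\Sigma}\partial_r\alpha^{[\pm2]}\pm2\Xi\frac{\partial_r\Delta}{\Sigma\Delta}\left(a\partial_\varphi+(r^2+a^2)\partial_t\right)\alpha^{[\pm2]}\mp8\frac{\Xi r}{\Sigma}\partial_t\alpha^{[\pm2]}+\frac{6k^2r^2+(1\pm1)\partial_r^2\Delta}{\Sigma}\alpha^{[\pm2]}\\&\pm4i\frac{\Xi\cot\vartheta}{\Sigma\Delta_\vartheta}(1-a^2k^2\cos(2\vartheta))\left(a\sin\vartheta\,\partial_t+\frac{\partial_\varphi}{\sin\vartheta}\right)\alpha^{[\pm2]}\mp8i\frac{\Xi}{\Sigma}a\cos\vartheta\,\partial_t\alpha^{[\pm2]}\\&-\frac1\Sigma\left(2\Delta_\vartheta+2a^2k^2+4\frac{\Xi^2\cot^2\vartheta}{\Delta_\vartheta}\right)\alpha^{[\pm2]},\end{aligned}$$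 where $$\Box\alpha=\frac1\Sigma\partial_r(\Delta\partial_r\alpha)-\frac{\Xi^2}{\Sigma\Delta}\left(a\partial_\varphi+(r^2+a^2)\partial_t\right)^2\alpha+\frac{1}{\Sigma\sin\vartheta}\partial_\vartheta(\Delta_\vartheta\sin\vartheta\,\partial_\vartheta\alpha)+\frac{\Xi^2}{\Sigma\Delta_\vartheta}\left(a\sin\vartheta\,\partial_t+\frac{\partial_\varphi}{\sin\vartheta}\right)^2\alpha .$$ The renormalised quantities are $\widetilde\alpha^{[+2]}:=\Delta(r^2+a^2)^{1/2}\alpha^{[+2]}$ and $\widetilde\alpha^{[-2]}:=\Delta^{-1}(r^2+a^2)^{1/2}\alpha^{[-2]}$; saying that $\widetilde\alpha^{[\pm2]}$ solve the Teukolsky equations means that the corresponding $\alpha^{[\pm2]}$, i.e. $\alpha^{[+2]}=\Delta^{-1}(r^2+a^2)^{-1/2}\widetilde\alpha^{[+2]}$ and $\alpha^{[-2]}=\Delta(r^2+a^2)^{-1/2}\widetilde\alpha^{[-2]}$, satisfy the Teukolsky equations for spin-$\pm2$-weighted functions $\alpha^{[\pm2]}$. **Regularity up to infinity.** $\widetilde\alpha^{[\pm2]}$ are regular up to infinity if they extend to $r^\star=0$ as elements of $\mathcal{C}^\infty(\mathbb{R}_t\times(-\infty,0]_{r^\star},\mathcal{S}^{[\pm2]})$. **Regularity at the future event horizon.** Let $t^\star:=t+r^\star-\frac1k\arctan(kr)$, $L:=\Xi\partial_t+\frac{a\Xi}{r^2+a^2}\partial_\varphi+\partial_{r^\star}$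 and $\underline{L}:=\Xi\partial_t+\frac{a\Xi}{r^2+a^2}\partial_\varphi-\partial_{r^\star}$. Then $\widetilde\alpha^{[\pm2]}$ are regular at the future event horizon if for all $p,q\in\mathbb{N}$ and all $t_0^\star\in\mathbb{R}$, $L^p(\Delta^{-1}\underline{L})^q(\Delta^{\pm1}\widetilde\alpha^{[\pm2]})\big|_{t^\star=t^\star_0}=O(1)$ as $r\to r_+$. **Conformal boundary conditions at infinity.** These are $$\left(\widetilde\alpha^{[+2]}-\overline{\widetilde\alpha^{[-2]}}\right)\Big|_{r^\star=0}=0,\qquad\left(\partial_{r^\star}\widetilde\alpha^{[+2]}+\partial_{r^\star}\overline{\widetilde\alpha^{[-2]}}\right)\Big|_{r^\star=0}=0 .$$ *)

(* Defs.v *)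
From Stdlib Require Export Reals ZArith List.
From Coquelicot Require Export Coquelicot.

Open Scope R_scope.

(** * Kerr-adS parameters *)

Definition Delta (M a k r : R) : R :=
  (r ^ 2 + a ^ 2) * (1 + k ^ 2 * r ^ 2) - 2 * M * r.

Definition Xi (a k : R) : R := 1 - a ^ 2 * k ^ 2.
Definition Delta_th (a k th : R) : R := 1 - a ^ 2 * k ^ 2 * cos th ^ 2.
Definition Sigma (a r th : R) : R := r ^ 2 + a ^ 2 * cos th ^ 2.

Definition admissible (M a k : R) : Prop :=
  0 < M /\ 0 < k /\ 0 <= a /\ a * k < 1 /\
  exists r1 r2 : R,
    0 <= r1 /\ r1 < r2 /\ Delta M a k r1 = 0 /\ Delta M a k r2 = 0.

Definition is_r_plus (M a k rp : R) : Prop :=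
  Delta M a k rp = 0 /\ forall x : R, Delta M a k x = 0 -> x <= rp.

Definition omega_plus (a rp : R) : R := a / (rp ^ 2 + a ^ 2).

(** The two clauses determine [rstar] uniquely on [(rp, +oo)]; its values
    elsewhere are never used. *)
Definition is_tortoise (M a k rp : R) (rstar : R -> R) : Prop :=
  (forall r : R, rp < r ->
     is_derive rstar r ((r ^ 2 + a ^ 2) / Delta M a k r)) /\
  is_lim rstar p_infty 0.

(** * Fields

    A field is a total function of [(t, r, th, ph)] (or of [(t, rstar, th, ph)]
    where indicated); only its values on the relevant coordinate domain matter.
    Periodicity in [ph] is enforced by [smooth_spin_weighted] below. *)

Definition field : Type := R -> R -> R -> R -> C.

Definition exterior (rp r th : R) : Prop := rp < r /\ 0 < th < PI.

(** [cis x] is exp(i x). *)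
Definition cis (x : R) : C := (cos x, sin x).

(** The spins s = +2 and s = -2; [sgn s] is s/2. *)
Inductive spin : Type := plus2 | minus2.

Definition sgn (s : spin) : Z := match s with plus2 => 1%Z | minus2 => (-1)%Z end.
Definition weight (s : spin) : R := 2 * IZR (sgn s).

(** * Smoothness up to the boundary *)

(** One-sided at those points of [U] where only one sign of [h] stays in [U].
    Only used with [U] convex with nonempty interior and, at boundary points,
    [x + h e] staying in [U] for all small [h] of some sign. *)
Definition is_derive_within {V : NormedModule R_AbsRing}
    (U : V -> Prop) (f : V -> C) (e x : V) (l : C) : Prop :=
  filterlim
    (fun h : R => (RtoC (/ h) * (f (plus x (scal h e)) - f x))%C)
    (within (fun h : R => U (plus x (scal h e))) (locally' 0))
    (locally l).

(** [g (e1 :: ... :: en :: nil)] is the iterated directional derivative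
    of [f] on [U] along [en], ..., [e1]; all of them are continuous on [U]. *)
Definition smooth_on {V : NormedModule R_AbsRing}
    (U : V -> Prop) (f : V -> C) : Prop :=
  exists g : list V -> V -> C,
    (forall x : V, U x -> g nil x = f x) /\
    (forall (w : list V) (x : V), U x ->
       filterlim (g w) (within U (locally x)) (locally (g w x))) /\
    (forall (w : list V) (e x : V), U x ->
       is_derive_within U (g w) e x (g (e :: w) x)).

Definition up_to_infinity (p : R * R * R * R) : Prop :=
  let '(_, rs, _, _) := p in rs <= 0.

(** Smooth functions of [(t, rstar)] in R x (-oo,0] with values in the smooth
    spin-weighted functions on the sphere, as jointly smooth functions of all
    the variables. The sphere is covered by the two stereographic charts, with
    centres th = 0 and th = PI, each of which omits only the opposite pole;
    so smoothness away from the poles is included. *)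
Definition smooth_spin_weighted (s : spin) (A : field) : Prop :=
  (exists F : R * R * R * R -> C,
     smooth_on up_to_infinity F /\
     forall t rs th ph : R, rs <= 0 -> 0 < th < PI ->
       (cis (weight s * ph) * A t rs th ph)%C =
       F (t, rs, tan (th / 2) * cos ph, tan (th / 2) * sin ph)) /\
  (exists F : R * R * R * R -> C,
     smooth_on up_to_infinity F /\
     forall t rs th ph : R, rs <= 0 -> 0 < th < PI ->
       (cis (- weight s * ph) * A t rs th ph)%C =
       F (t, rs, / tan (th / 2) * cos ph, / tan (th / 2) * sin ph)).

(** [A], a function of [(t, rstar, th, ph)], is the smooth extension of
    [alpha] to [rstar = 0]. *)
Definition is_extension_to_infinity (rp : R) (rstar : R -> R) (s : spin)
    (alpha A : field) : Prop :=
  smooth_spin_weighted s A /\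
  forall t r th ph : R, exterior rp r th ->
    A t (rstar r) th ph = alpha t r th ph.

Definition regular_up_to_infinity (rp : R) (rstar : R -> R) (s : spin)
    (alpha : field) : Prop :=
  exists A : field, is_extension_to_infinity rp rstar s alpha A.

(** The extensions are unique on the relevant domain, by continuity. *)
Definition conformal_bc (rp : R) (rstar : R -> R) (alphap alpham : field)
    : Prop :=
  exists Ap Am : field,
    is_extension_to_infinity rp rstar plus2 alphap Ap /\
    is_extension_to_infinity rp rstar minus2 alpham Am /\
    forall t th ph : R, 0 < th < PI ->
      (Ap t 0 th ph - Cconj (Am t 0 th ph))%C = 0%C /\
      exists dp dm : C,
        is_derive_within (V := R_NormedModule) (fun rs => rs <= 0)
          (fun rs => Ap t rs th ph) 1 0 dp /\
        is_derive_within (V := R_NormedModule) (fun rs => rs <= 0)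
          (fun rs => Cconj (Am t rs th ph)) 1 0 dm /\
        (dp + dm)%C = 0%C.

(** * Teukolsky equations *)

(** Derivative of a C-valued function of one real variable, meaningful where
    the function is differentiable. *)
Definition DeriveC (f : R -> C) (x : R) : C :=
  (Derive (fun y => Re (f y)) x, Derive (fun y => Im (f y)) x).

Definition d_t (f : field) : field :=
  fun t r th ph => DeriveC (fun x => f x r th ph) t.
Definition d_r (f : field) : field :=
  fun t r th ph => DeriveC (fun x => f t x th ph) r.
Definition d_th (f : field) : field :=
  fun t r th ph => DeriveC (fun x => f t r x ph) th.
Definition d_ph (f : field) : field :=
  fun t r th ph => DeriveC (fun x => f t r th x) ph.

(** a d_ph + (r^2 + a^2) d_t *)
Definition op_K (a : R) (f : field) : field := fun t r th ph =>
  (RtoC a * d_ph f t r th ph + RtoC (r ^ 2 + a ^ 2) * d_t f t r th ph)%C.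

(** a sin th d_t + d_ph / sin th *)
Definition op_H (a : R) (f : field) : field := fun t r th ph =>
  (RtoC (a * sin th) * d_t f t r th ph
   + RtoC (/ sin th) * d_ph f t r th ph)%C.

Definition Box (M a k : R) (f : field) : field := fun t r th ph =>
  (RtoC (/ Sigma a r th)
     * d_r (fun t r th ph => RtoC (Delta M a k r) * d_r f t r th ph) t r th ph
   - RtoC (Xi a k ^ 2 / (Sigma a r th * Delta M a k r))
     * op_K a (op_K a f) t r th ph
   + RtoC (/ (Sigma a r th * sin th))
     * d_th (fun t r th ph =>
               RtoC (Delta_th a k th * sin th) * d_th f t r th ph) t r th ph
   + RtoC (Xi a k ^ 2 / (Sigma a r th * Delta_th a k th))
     * op_H a (op_H a f) t r th ph)%C.

Definition cot (x : R) : R := cos x / sin x.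

Definition teukolsky_op (M a k : R) (s : spin) (f : field) : field :=
  fun t r th ph =>
  let sg := IZR (sgn s) in
  let D := Delta M a k r in
  let D' := Derive (Delta M a k) r in
  let D'' := Derive_n (Delta M a k) 2 r in
  let S := Sigma a r th in
  let X := Xi a k in
  let Dth := Delta_th a k th in
  (Box M a k f t r th ph
   + RtoC (sg * 2 * (D' / S)) * d_r f t r th ph
   + RtoC (sg * 2 * X * (D' / (S * D))) * op_K a f t r th ph
   - RtoC (sg * 8 * (X * r / S)) * d_t f t r th ph
   + RtoC ((6 * k ^ 2 * r ^ 2 + (1 + sg) * D'') / S) * f t r th ph
   + Ci * RtoC (sg * 4 * (X * cot th / (S * Dth))
                * (1 - a ^ 2 * k ^ 2 * cos (2 * th))) * op_H a f t r th ph
   - Ci * RtoC (sg * 8 * (X / S) * a * cos th) * d_t f t r th ph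
   - RtoC (/ S * (2 * Dth + 2 * a ^ 2 * k ^ 2
                  + 4 * (X ^ 2 * cot th ^ 2 / Dth))) * f t r th ph)%C.

(** The quantity alpha^[s] with renormalisation [alphat]:
    alpha = Delta^(-sgn s) (r^2 + a^2)^(-1/2) alphat. *)
Definition unrenormalised (M a k : R) (s : spin) (alphat : field) : field :=
  fun t r th ph =>
  (RtoC (powerRZ (Delta M a k r) (- sgn s) * / sqrt (r ^ 2 + a ^ 2))
   * alphat t r th ph)%C.

Definition solves_teukolsky (M a k rp : R) (s : spin) (alphat : field) : Prop :=
  forall t r th ph : R, exterior rp r th ->
    teukolsky_op M a k s (unrenormalised M a k s alphat) t r th ph = 0%C.

(** * Regularity at the future event horizon *)

Definition t_star (k : R) (rstar : R -> R) (t r : R) : R :=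
  t + rstar r - / k * atan (k * r).

(** The vector field d_rstar of the coordinates (t, rstar, th, ph), expressed
    in the coordinates (t, r, th, ph) through drstar/dr = (r^2 + a^2)/Delta. *)
Definition d_rstar (M a k : R) (f : field) : field := fun t r th ph =>
  (RtoC (Delta M a k r / (r ^ 2 + a ^ 2)) * d_r f t r th ph)%C.

Definition op_T (a k : R) (f : field) : field := fun t r th ph =>
  (RtoC (Xi a k) * d_t f t r th ph
   + RtoC (a * Xi a k / (r ^ 2 + a ^ 2)) * d_ph f t r th ph)%C.

Definition op_L (M a k : R) (f : field) : field := fun t r th ph =>
  (op_T a k f t r th ph + d_rstar M a k f t r th ph)%C.
Definition op_Lbar (M a k : R) (f : field) : field := fun t r th ph =>
  (op_T a k f t r th ph - d_rstar M a k f t r th ph)%C.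

(** The bound O(1) as r -> r_+ is uniform on the sphere. *)
Definition regular_at_horizon (M a k rp : R) (rstar : R -> R) (s : spin)
    (alphat : field) : Prop :=
  forall (p q : nat) (t0 : R),
  exists B eps : R, 0 < eps /\
    forall t r th ph : R,
      exterior rp r th -> r < rp + eps -> t_star k rstar t r = t0 ->
      Cmod
        (Nat.iter p (op_L M a k)
          (Nat.iter q
            (fun f t r th ph =>
               RtoC (/ Delta M a k r) * op_Lbar M a k f t r th ph)%C
            (fun t r th ph =>
               RtoC (powerRZ (Delta M a k r) (sgn s))
               * alphat t r th ph)%C)
          t r th ph) <= B.

(** * Stationary modes *)

(** exp(-/+ i m omega t) R(r) S(th) exp(+/- i m ph), upper signs for s = +2. *)
Definition stationary_mode (s : spin) (m : Z) (omega : R) (Rf Sf : R -> C)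
    : field := fun t r th ph =>
  (cis (- IZR (sgn s) * IZR m * omega * t) * Rf r * Sf th
   * cis (IZR (sgn s) * IZR m * ph))%C.

Definition identically_zero (rp : R) (alpha : field) : Prop :=
  forall t r th ph : R, exterior rp r th -> alpha t r th ph = 0%C.

(* Main.v *)
(** Both spins lead to the same radial equation in [r*], with a real potential
    [lam - Xi^2 K^2 / Delta + O(1)] up to an imaginary part, where [lam] is the
    separation constant. The angular equation has a real potential, which is at
    least [mu m^2 - 16 |m|] for large [|m|], and the maximum principle on the
    sphere forces [Re lam] above this bound. At the stationary frequency [K]
    vanishes at the horizon, and under the Hawking-Reall bound
    [Xi^2 K^2 / Delta <= eta mu m^2] with [eta < 1]. So for large [|m|] the
    functions [|alphat+|^2] and [|alphat-|^2] are convex in [r*] at every point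
    of the sphere. The boundary conditions make the derivative of their sum
    vanish at infinity, and horizon regularity makes them vanish at [r_+]; hence
    they are zero. For spin +2 the latter requires excluding the singular
    Frobenius solution, whose logarithmic coefficient is a quadratic polynomial
    in [lam] which does not vanish for large [|m|]. *)

Require Import Defs.
From Stdlib Require Import Lra FunctionalExtensionality Classical.

(** * Complex-valued functions of a real variable *)

(** The boundary conditions couple the two spins only pointwise, and nothing relates their
    separation constants, which may be non-real. Hence convexity is proved for each product [R * S]
    at a fixed point of the sphere: pairing the radial equation with the conjugate solution and
    taking real parts discards the imaginary parts of the potential and of [lam], so a lower bound
    for [Re lam], for each spin separately, is enough.

    The delicate end is the horizon for spin +2, where regularity controls [Delta * R] while [R]
    itself must tend to zero. No Frobenius series is built. With [Y q] the profile of
    [(Delta^-1 Lbar)^q (Delta R)], the radial equation and its derivative give two linear relations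
    between [Y 0] and [Y 1] up to O(r - r_+). Their determinant is [J] up to sign, and [J <> 0]
    forces [Y 0] and [Y 1] to be O(r - r_+). This only bounds [R]; the missing half power comes from
    integrating the derivative of [|Y 0|^2]. Some terms of [J] grow linearly in [m], and [Re lam]
    beats them because it grows quadratically. *)

Lemma is_derive_eq (f : R -> R) (x l l' : R) :
  is_derive f x l -> l = l' -> is_derive f x l'.
Proof. now intros H <-. Qed.

Definition is_deriveC (f : R -> C) (x : R) (l : C) : Prop :=
  is_derive (fun y => Re (f y)) x (Re l) /\
  is_derive (fun y => Im (f y)) x (Im l).

Lemma C_ext (z w : C) : Re z = Re w -> Im z = Im w -> z = w.
Proof. destruct z, w; simpl; intros; subst; reflexivity. Qed.

Lemma DeriveC_unique f x l : is_deriveC f x l -> DeriveC f x = l.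
Proof.
intros [H1 H2]; apply C_ext; simpl; now apply is_derive_unique.
Qed.

Lemma is_deriveC_unique f x l l' :
  is_deriveC f x l -> is_deriveC f x l' -> l = l'.
Proof.
intros H H'; rewrite <- (DeriveC_unique _ _ _ H); now apply DeriveC_unique.
Qed.

Lemma is_deriveC_ext_loc f g x l :
  locally x (fun y => f y = g y) -> is_deriveC f x l -> is_deriveC g x l.
Proof.
intros E [H1 H2]; split.
- apply (is_derive_ext_loc (fun y => Re (f y))); [|exact H1].
  revert E; apply filter_imp; now intros y ->.
- apply (is_derive_ext_loc (fun y => Im (f y))); [|exact H2].
  revert E; apply filter_imp; now intros y ->.
Qed.

Lemma DeriveC_ext_loc f g x :
  locally x (fun y => f y = g y) -> DeriveC f x = DeriveC g x.
Proof.
intros E; apply C_ext; simpl; apply Derive_ext_loc;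
  revert E; apply filter_imp; now intros y ->.
Qed.

Lemma is_deriveC_const (c : C) x : is_deriveC (fun _ => c) x 0%C.
Proof. split; simpl; auto_derive; auto. Qed.

Lemma is_deriveC_RtoC f x l :
  is_derive f x l -> is_deriveC (fun y => RtoC (f y)) x (RtoC l).
Proof. intros H; split; simpl; [exact H|auto_derive; auto]. Qed.

Lemma is_deriveC_plus f g x l l' :
  is_deriveC f x l -> is_deriveC g x l' ->
  is_deriveC (fun y => f y + g y)%C x (l + l')%C.
Proof.
intros [H1 H2] [H3 H4]; split; simpl.
- exact (is_derive_plus _ _ _ _ _ H1 H3).
- exact (is_derive_plus _ _ _ _ _ H2 H4).
Qed.

Lemma is_deriveC_mult f g x l l' :
  is_deriveC f x l -> is_deriveC g x l' ->
  is_deriveC (fun y => f y * g y)%C x (l * g x + f x * l')%C.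
Proof.
intros [H1 H2] [H3 H4]; split.
- apply (is_derive_eq _ _ _ _ (is_derive_minus _ _ _ _ _
    (Derive.is_derive_mult _ _ _ _ _ H1 H3)
    (Derive.is_derive_mult _ _ _ _ _ H2 H4))).
  unfold minus, plus, opp; simpl; unfold Re, Im; ring.
- apply (is_derive_eq _ _ _ _ (is_derive_plus _ _ _ _ _
    (Derive.is_derive_mult _ _ _ _ _ H1 H4)
    (Derive.is_derive_mult _ _ _ _ _ H2 H3))).
  unfold plus; simpl; unfold Re, Im; ring.
Qed.

Lemma is_deriveC_scal (c : C) f x l :
  is_deriveC f x l -> is_deriveC (fun y => c * f y)%C x (c * l)%C.
Proof.
intros H; replace (c * l)%C with (0 * f x + c * l)%C by ring.
exact (is_deriveC_mult _ _ _ _ _ (is_deriveC_const c x) H).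
Qed.

Lemma is_deriveC_comp f g x l dg :
  is_deriveC f (g x) l -> is_derive g x dg ->
  is_deriveC (fun y => f (g y)) x (RtoC dg * l)%C.
Proof.
intros [H1 H2] Hg; split.
- rewrite re_scal_l.
  exact (is_derive_comp _ _ _ _ _ H1 Hg).
- rewrite im_scal_l.
  exact (is_derive_comp _ _ _ _ _ H2 Hg).
Qed.

(** The square of [Cmod] as a polynomial, hence differentiable also at zeros; [dotC z w] is the real
    part of [Cconj z * w]. *)
Definition normsq (z : C) : R := Re z ^ 2 + Im z ^ 2.
Definition dotC (z w : C) : R := Re z * Re w + Im z * Im w.

Lemma normsq_ge_0 z : 0 <= normsq z.
Proof. unfold normsq; nra. Qed.

Lemma normsq_eq_0 z : normsq z = 0 -> z = 0%C.
Proof. unfold normsq; intros H; apply C_ext; simpl; nra. Qed.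

Lemma normsq_mult z w : normsq (z * w) = normsq z * normsq w.
Proof. unfold normsq, Re, Im; simpl; ring. Qed.

Lemma normsq_Cmod z : normsq z = Cmod z ^ 2.
Proof.
unfold normsq, Cmod; rewrite pow2_sqrt; [reflexivity|].
fold (normsq z); apply normsq_ge_0.
Qed.

Lemma dotC_le z w : Rabs (dotC z w) <= Cmod z * Cmod w.
Proof.
rewrite <- (Rabs_pos_eq (Cmod z * Cmod w)) by
  (apply Rmult_le_pos; apply Cmod_ge_0).
apply Rsqr_le_abs_0; unfold Rsqr.
replace (Cmod z * Cmod w * (Cmod z * Cmod w)) with (normsq z * normsq w)
  by (rewrite !normsq_Cmod; ring).
unfold dotC, normsq.
assert (0 <= (Re z * Im w - Im z * Re w) ^ 2) by apply pow2_ge_0; nra.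
Qed.

Lemma is_derive_dotC f g x l l' :
  is_deriveC f x l -> is_deriveC g x l' ->
  is_derive (fun y => dotC (f y) (g y)) x (dotC l (g x) + dotC (f x) l').
Proof.
intros [H1 H2] [H3 H4].
apply (is_derive_eq _ _ _ _ (is_derive_plus _ _ _ _ _
    (Derive.is_derive_mult _ _ _ _ _ H1 H3)
    (Derive.is_derive_mult _ _ _ _ _ H2 H4))).
unfold plus, dotC, Re, Im; simpl; ring.
Qed.

Lemma is_derive_normsq f x l :
  is_deriveC f x l -> is_derive (fun y => normsq (f y)) x (2 * dotC (f x) l).
Proof.
intros H; apply (is_derive_ext (fun y => dotC (f y) (f y))).
- intros t; unfold dotC, normsq, Re, Im; simpl; ring.
- apply (is_derive_eq _ _ _ _ (is_derive_dotC _ _ _ _ _ H H)).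
  unfold dotC; ring.
Qed.

(** * Smooth functions on an open set *)

(** Since [DeriveC] is total, it names the successive derivatives without carrying witnesses; the
    first clause asserts that it is meaningful on [U]. *)
Fixpoint diffn (U : R -> Prop) (n : nat) (f : R -> C) : Prop :=
  match n with
  | O => True
  | S n => (forall x, U x -> is_deriveC f x (DeriveC f x)) /\
           diffn U n (DeriveC f)
  end.

Definition smoothC (U : R -> Prop) (f : R -> C) : Prop :=
  forall n, diffn U n f.

Section Smooth.

Variable U : R -> Prop.
Hypothesis U_open : forall x, U x -> locally x U.

Lemma diffn_ext n : forall f g,
  (forall x, U x -> f x = g x) -> diffn U n f -> diffn U n g.
Proof.
induction n as [|n IH]; intros f g E; [easy|intros [H1 H2]].
assert (E' : forall x, U x -> DeriveC f x = DeriveC g x).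
{ intros x Hx; apply DeriveC_ext_loc.
  generalize (U_open x Hx); apply filter_imp; intros y Hy; now apply E. }
split; [|now apply (IH (DeriveC f))].
intros x Hx; rewrite <- E' by easy.
apply (is_deriveC_ext_loc f); [|now apply H1].
generalize (U_open x Hx); apply filter_imp; intros y Hy; now apply E.
Qed.

Lemma diffn_intro n f f' :
  (forall x, U x -> is_deriveC f x (f' x)) -> diffn U n f' ->
  diffn U (S n) f.
Proof.
intros H1 H2.
assert (E : forall x, U x -> f' x = DeriveC f x).
{ intros x Hx; symmetry; apply DeriveC_unique; now apply H1. }
split; [|now apply (diffn_ext n f')].
intros x Hx; rewrite <- E by easy; now apply H1.
Qed.

Lemma diffn_pred n : forall f, diffn U (S n) f -> diffn U n f.
Proof.
induction n as [|n IH]; intros f [H1 H2]; [easy|].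
split; [exact H1|now apply IH].
Qed.

Lemma diffn_const c n : diffn U n (fun _ => c).
Proof.
revert c; induction n as [|n IH]; intros c; [easy|].
apply (diffn_intro n _ (fun _ => 0%C)); [|apply IH].
intros x _; apply is_deriveC_const.
Qed.

Lemma diffn_plus n : forall f g,
  diffn U n f -> diffn U n g -> diffn U n (fun x => f x + g x)%C.
Proof.
induction n as [|n IH]; intros f g Hf Hg; [easy|].
apply (diffn_intro n _ (fun x => DeriveC f x + DeriveC g x)%C).
- intros x Hx; apply is_deriveC_plus; [now apply Hf|now apply Hg].
- apply IH; [apply Hf|apply Hg].
Qed.

Lemma diffn_mult n : forall f g,
  diffn U n f -> diffn U n g -> diffn U n (fun x => f x * g x)%C.
Proof.
induction n as [|n IH]; intros f g Hf Hg; [easy|].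
apply (diffn_intro n _ (fun x => DeriveC f x * g x + f x * DeriveC g x)%C).
- intros x Hx; apply is_deriveC_mult; [now apply Hf|now apply Hg].
- apply diffn_plus; apply IH; try apply Hf; try apply Hg; now apply diffn_pred.
Qed.

Lemma smoothC_ext f g :
  (forall x, U x -> f x = g x) -> smoothC U f -> smoothC U g.
Proof. intros E H n; now apply (diffn_ext n f). Qed.

Lemma smoothC_const c : smoothC U (fun _ => c).
Proof. intros n; apply diffn_const. Qed.

Lemma smoothC_plus f g :
  smoothC U f -> smoothC U g -> smoothC U (fun x => f x + g x)%C.
Proof. intros Hf Hg n; now apply diffn_plus. Qed.

Lemma smoothC_mult f g :
  smoothC U f -> smoothC U g -> smoothC U (fun x => f x * g x)%C.
Proof. intros Hf Hg n; now apply diffn_mult. Qed.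

Lemma smoothC_DeriveC f : smoothC U f -> smoothC U (DeriveC f).
Proof. intros H n; apply (H (S n)). Qed.

Lemma smoothC_intro f f' :
  (forall x, U x -> is_deriveC f x (f' x)) -> smoothC U f' -> smoothC U f.
Proof.
intros H H' [|n]; [easy|]; apply (diffn_intro n f f'); [exact H|apply H'].
Qed.

Lemma smoothC_RtoC_id : smoothC U (fun x => RtoC x).
Proof.
apply (smoothC_intro _ (fun _ => RtoC 1)); [|apply smoothC_const].
intros x _; apply is_deriveC_RtoC; auto_derive; auto.
Qed.

(** Bootstrap: [(1/f)' = - f' (1/f)^2], so each order of differentiability of [1/f] yields the next
    one. *)
Lemma smoothC_Rinv f f' :
  (forall x, U x -> f x <> 0) -> (forall x, U x -> is_derive f x (f' x)) ->
  smoothC U (fun x => RtoC (f' x)) -> smoothC U (fun x => RtoC (/ f x)).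
Proof.
intros H0 Hd Hs n; induction n as [|n IH]; [easy|].
apply (diffn_intro n _
  (fun x => RtoC (-1) * RtoC (f' x) * (RtoC (/ f x) * RtoC (/ f x)))%C).
- intros x Hx; rewrite <- !RtoC_mult; apply is_deriveC_RtoC.
  replace (-1 * f' x * (/ f x * / f x)) with (- f' x / f x ^ 2)
    by (field; now apply H0).
  apply is_derive_inv; [now apply Hd|now apply H0].
- repeat apply diffn_mult; try exact IH; [apply diffn_const|apply Hs].
Qed.

(** The outer function comes as a tower of derivatives, needed only on the image of [phi]. The
    induction runs over all members at once because the derivative of [u j] after [phi] involves
    [u (S j)] after [phi]. *)
Lemma smoothC_comp (u : nat -> R -> C) (phi phi' : R -> R) :
  (forall x, U x -> is_derive phi x (phi' x)) ->
  smoothC U (fun x => RtoC (phi' x)) ->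
  (forall n x, U x -> is_deriveC (u n) (phi x) (u (S n) (phi x))) ->
  smoothC U (fun x => u 0%nat (phi x)).
Proof.
intros Hp Hs Hu n; generalize 0%nat as j.
induction n as [|n IH]; intros j; [easy|].
apply (diffn_intro n _ (fun x => RtoC (phi' x) * u (S j) (phi x))%C).
- intros x Hx; apply is_deriveC_comp; [now apply Hu|now apply Hp].
- apply diffn_mult; [apply Hs|apply IH].
Qed.

End Smooth.

(** * Derivatives within a set, restricted to coordinate lines *)

Lemma filterlim_Re {T} (F : (T -> Prop) -> Prop) (f : T -> C) (l : C) :
  filterlim f F (locally l) -> filterlim (fun x => Re (f x)) F (locally (Re l)).
Proof.
intros H; apply (filterlim_comp _ _ _ f Re F (locally l)); [exact H|].
destruct l as [lr li]; apply (continuous_fst lr li).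
Qed.

Lemma filterlim_Im {T} (F : (T -> Prop) -> Prop) (f : T -> C) (l : C) :
  filterlim f F (locally l) -> filterlim (fun x => Im (f x)) F (locally (Im l)).
Proof.
intros H; apply (filterlim_comp _ _ _ f Im F (locally l)); [exact H|].
destruct l as [lr li]; apply (continuous_snd lr li).
Qed.

Lemma filterlim_quotient_is_derive (f : R -> R) x l :
  filterlim (fun h => / h * (f (x + h) - f x)) (locally' 0) (locally l) ->
  is_derive f x l.
Proof.
intros H; apply is_derive_Reals; intros eps Heps.
destruct (H (ball l (mkposreal eps Heps)) (locally_ball _ _)) as [d Hd].
exists d; intros h Hh Hd'.
replace ((f (x + h) - f x) / h - l) with (/ h * (f (x + h) - f x) - l)
  by (unfold Rdiv; ring).
apply (Hd h); [|exact Hh].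
unfold ball; simpl; unfold AbsRing_ball, abs, minus, plus, opp; simpl.
now rewrite Ropp_0, Rplus_0_r.
Qed.

Lemma filterlim_quotient_is_deriveC (f : R -> C) (x : R) (l : C) :
  filterlim (fun h : R => (RtoC (/ h) * (f (x + h)%R - f x))%C)
    (locally' 0) (locally l) ->
  is_deriveC f x l.
Proof.
intros H; split; apply filterlim_quotient_is_derive.
- apply (filterlim_ext
    (fun h => Re (RtoC (/ h) * (f (x + h)%R - f x))%C)); [|exact (filterlim_Re _ _ _ H)].
  intros h; rewrite re_scal_l; reflexivity.
- apply (filterlim_ext
    (fun h => Im (RtoC (/ h) * (f (x + h)%R - f x))%C)); [|exact (filterlim_Im _ _ _ H)].
  intros h; rewrite im_scal_l; reflexivity.
Qed.

Lemma locally'_of_locally (P : R -> Prop) :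
  locally 0 P -> locally' 0 P.
Proof. intros H; apply filter_le_within; exact H. Qed.

(** A line [p] with direction [e] turns a directional derivative within [U] into a derivative in one
    real variable, restricted to parameters that stay in [U]. *)
Lemma is_derive_within_line {V : NormedModule R_AbsRing} (U : V -> Prop)
    (W : R -> Prop) (f : V -> C) (e : V) (p : R -> V) (x : R) (l : C) :
  (forall y h, plus (p y) (scal h e) = p (y + h)) ->
  (forall y, W y -> U (p y)) ->
  is_derive_within U f e (p x) l ->
  filterlim (fun h : R => (RtoC (/ h) * (f (p (x + h)%R) - f (p x)))%C)
    (within (fun h => W (x + h)) (locally' 0)) (locally l).
Proof.
intros Hp HW H.
apply (filterlim_ext (fun h : R =>
   (RtoC (/ h) * (f (plus (p x) (scal h e)) - f (p x)))%C)).
{ intros h; now rewrite Hp. }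
intros P HP; generalize (H P HP); unfold filtermap, within.
apply filter_imp; intros h Hh Hw; apply Hh; rewrite Hp; now apply HW.
Qed.

Lemma within_true_locally' (P Q : R -> Prop) :
  locally 0 P -> within P (locally' 0) Q -> locally' 0 Q.
Proof.
intros HP HQ; generalize (filter_and _ _ (locally'_of_locally P HP) HQ).
apply filter_imp; intros y [H1 H2]; now apply H2.
Qed.

(** The function [u n] is the entry of the family of derivatives indexed by the word that repeats
    the [rstar] direction [n] times. Differentiability is two-sided for [x < 0]; at the boundary
    there remain continuity from the left and the one-sided first derivative that occurs in the
    boundary conditions. *)
Lemma smooth_on_radial F (t c d : R) :
  smooth_on up_to_infinity F ->
  exists u : nat -> R -> C,
    (forall x, x <= 0 -> u 0%nat x = F (t, x, c, d)) /\
    (forall n x, x < 0 -> is_deriveC (u n) x (u (S n) x)) /\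
    (forall n, filterlim (u n) (at_left 0) (locally (u n 0))) /\
    is_derive_within (V := R_NormedModule) (fun x => x <= 0) (u 0%nat) 1 0
      (u 1%nat 0).
Proof.
intros [g [H0 [Hc Hd]]].
pose (e := (0, 1, 0, 0) : R * R * R * R).
pose (w := fix w n := match n with O => nil | S n => cons e (w n) end).
exists (fun n x => g (w n) (t, x, c, d)).
assert (line : forall y h : R, plus ((t, y, c, d) : R * R * R * R) (scal h e)
                        = (t, y + h, c, d)).
{ intros y h; unfold e, plus, scal; simpl.
  unfold prod_plus, prod_scal, plus, scal; simpl.
  unfold prod_plus, prod_scal, plus, scal; simpl.
  unfold prod_plus, prod_scal, plus, scal, mult; simpl; unfold mult; simpl.
  rewrite !Rmult_0_r, !Rplus_0_r, Rmult_1_r; reflexivity. }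
assert (D : forall n x, x <= 0 ->
  filterlim (fun h : R => (RtoC (/ h) *
     (g (w n) (t, (x + h)%R, c, d) - g (w n) (t, x, c, d)))%C)
    (within (fun h => x + h <= 0) (locally' 0)) (locally (g (w (S n)) (t, x, c, d)))).
{ intros n x Hx.
  apply (is_derive_within_line up_to_infinity (fun y => y <= 0) (g (w n)) e
           (fun x => (t, x, c, d)) x _ line).
  - intros y Hy; exact Hy.
  - apply Hd; exact Hx. }
split; [|split; [|split]].
- intros x Hx; apply H0; exact Hx.
- intros n x Hx; apply filterlim_quotient_is_deriveC.
  intros P HP; generalize (D n x (Rlt_le _ _ Hx) P HP).
  apply within_true_locally'.
  exists (mkposreal (- x) ltac:(lra)); simpl; intros y Hy.
  unfold ball in Hy; simpl in Hy; unfold AbsRing_ball, abs, minus, plus, opp in Hy.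
  simpl in Hy; apply Rabs_def2 in Hy; lra.
- intros n.
  apply (filterlim_comp _ _ _ (fun x => (t, x, c, d)) (g (w n)) (at_left 0)
           (within up_to_infinity (locally ((t, 0, c, d) : R * R * R * R)))).
  + intros P [eps HP]; exists eps; intros y Hy Hy0; apply HP.
    * repeat split; try apply ball_center; exact Hy.
    * simpl; lra.
  + apply Hc; simpl; lra.
- unfold is_derive_within.
  apply (filterlim_ext (fun h : R => (RtoC (/ h) *
     (g (w 0%nat) (t, (0 + h)%R, c, d) - g (w 0%nat) (t, 0, c, d)))%C)).
  + intros h; unfold plus, scal; simpl; unfold mult; simpl.
    now rewrite Rmult_1_r.
  + intros P HP; generalize (D 0%nat 0 (Rle_refl 0) P HP).
    unfold filtermap, within; apply filter_imp; intros h Hh H; apply Hh.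
    unfold plus, scal in H; simpl in H; unfold mult in H; simpl in H; lra.
Qed.

(** The line with second stereographic coordinate 0 is a meridian continued through the pole at
    [y = 0], so the tower is differentiable across the pole. *)
Lemma smooth_on_chart F (t x : R) :
  x <= 0 -> smooth_on up_to_infinity F ->
  exists u : nat -> R -> C,
    (forall y, u 0%nat y = F (t, x, y, 0)) /\
    (forall n y, is_deriveC (u n) y (u (S n) y)).
Proof.
intros Hx [g [H0 [Hc Hd]]].
pose (e := (0, 0, 1, 0) : R * R * R * R).
pose (w := fix w n := match n with O => nil | S n => cons e (w n) end).
exists (fun n y => g (w n) (t, x, y, 0)); split.
- intros y; now apply H0.
- intros n y; apply filterlim_quotient_is_deriveC.
  assert (line : forall y h : R, plus ((t, x, y, 0) : R * R * R * R) (scal h e)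
                        = (t, x, y + h, 0)).
  { intros y' h; unfold e, plus, scal; simpl.
    unfold prod_plus, prod_scal, plus, scal; simpl.
    unfold prod_plus, prod_scal, plus, scal; simpl.
    unfold prod_plus, prod_scal, plus, scal, mult; simpl; unfold mult; simpl.
    rewrite !Rmult_0_r, !Rplus_0_r, Rmult_1_r; reflexivity. }
  intros P HP.
  generalize (is_derive_within_line up_to_infinity (fun _ => True) (g (w n)) e
           (fun y => (t, x, y, 0)) y _ line (fun _ _ => Hx)
           (Hd (w n) e (t, x, y, 0) Hx) P HP).
  apply within_true_locally'; apply filter_forall; easy.
Qed.

(** Nonzero increments [h <= 0] exist in every neighbourhood of 0, so the filter of admissible
    increments is proper and its limits are unique. *)
Lemma is_derive_within_left_unique (f g : R -> C) (l l' : C) :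
  (forall x, x <= 0 -> f x = g x) ->
  is_derive_within (V := R_NormedModule) (fun x => x <= 0) f 1 0 l ->
  is_derive_within (V := R_NormedModule) (fun x => x <= 0) g 1 0 l' ->
  l = l'.
Proof.
intros E H H'.
pose (G := within (fun h : R => plus 0 (scal h 1) <= 0) (locally' 0)).
assert (PG : ProperFilter' G).
{ split; [|apply within_filter; apply locally'_filter].
  intros [eps He]; apply (He (- (eps / 2))).
  - unfold ball; simpl; unfold AbsRing_ball, abs, minus, plus, opp; simpl.
    rewrite Ropp_0, Rplus_0_r, Rabs_Ropp, Rabs_pos_eq; destruct eps; simpl; lra.
  - destruct eps; simpl; lra.
  - unfold plus, scal; simpl; unfold mult; simpl; destruct eps; simpl; lra. }
apply (filterlim_locally_unique (F := G) (V := C_R_NormedModule)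
  (fun h : R => (RtoC (/ h) * (f (plus 0 (scal h 1)) - f 0))%C) l l'); [exact H|].
intros P HP; generalize (H' P HP); unfold filtermap, G, within.
apply filter_imp; intros h Hh Hw.
rewrite (E _ Hw), (E 0 (Rle_refl 0)); now apply Hh.
Qed.

(** * Monotonicity arguments *)

Lemma le_of_derive_nonneg (f f' : R -> R) (x y : R) :
  x <= y -> (forall z, x <= z <= y -> is_derive f z (f' z)) ->
  (forall z, x <= z <= y -> 0 <= f' z) -> f x <= f y.
Proof.
intros Hxy Hd Hp.
destruct (MVT_gen f x y f') as [z [Hz E]].
- intros z; rewrite Rmin_left, Rmax_right by easy; intros Hz; apply Hd; lra.
- intros z; rewrite Rmin_left, Rmax_right by easy; intros Hz.
  apply derivable_continuous_pt; exists (f' z).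
  apply is_derive_Reals; now apply Hd.
- rewrite Rmin_left, Rmax_right in Hz by easy.
  assert (0 <= f' z * (y - x)) by (apply Rmult_le_pos; [now apply Hp|lra]); lra.
Qed.

Lemma limit_ge {T} (F : (T -> Prop) -> Prop) {FF : ProperFilter F} (f : T -> R) (l c : R) :
  filterlim f F (locally l) -> F (fun x => c <= f x) -> c <= l.
Proof.
intros Hl Hc.
exact (filterlim_le (fun _ => c) f c l Hc (filterlim_const c) Hl).
Qed.

Lemma limit_le {T} (F : (T -> Prop) -> Prop) {FF : ProperFilter F} (f : T -> R) (l c : R) :
  filterlim f F (locally l) -> F (fun x => f x <= c) -> l <= c.
Proof.
intros Hl Hc.
exact (filterlim_le f (fun _ => c) l c Hc Hl (filterlim_const c)).
Qed.

Lemma at_right_between (a x : R) : a < x -> at_right a (fun y => a < y < x).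
Proof.
intros H; exists (mkposreal (x - a) ltac:(lra)); intros y Hy Hay; split; [easy|].
unfold ball in Hy; simpl in Hy; unfold AbsRing_ball, abs, minus, plus, opp in Hy.
simpl in Hy; apply Rabs_def2 in Hy; lra.
Qed.

Lemma at_left_between (b x : R) : x < b -> at_left b (fun y => x < y < b).
Proof.
intros H; exists (mkposreal (b - x) ltac:(lra)); intros y Hy Hay; split; [|easy].
unfold ball in Hy; simpl in Hy; unfold AbsRing_ball, abs, minus, plus, opp in Hy.
simpl in Hy; apply Rabs_def2 in Hy; lra.
Qed.

(** Monotonicity squeezes every value of [f] between its two end limits, both 0; so [f] is
    constant. *)
Lemma monotone_vanishing_ends (f f' : R -> R) (a b : R) :
  (forall x, a < x < b -> is_derive f x (f' x)) ->
  (forall x, a < x < b -> 0 <= f' x) ->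
  filterlim f (at_right a) (locally 0) ->
  filterlim f (at_left b) (locally 0) ->
  forall x, a < x < b -> f' x = 0.
Proof.
intros Hd Hp Ha Hb.
assert (Z : forall x, a < x < b -> f x = 0).
{ intros x Hx; apply Rle_antisym.
  - apply (limit_ge _ f 0 (f x) Hb).
    generalize (at_left_between b x (proj2 Hx)); apply filter_imp; intros y Hy.
    apply (le_of_derive_nonneg f f' x y); [lra| |]; intros z Hz;
      [apply Hd|apply Hp]; lra.
  - apply (limit_le _ f 0 (f x) Ha).
    generalize (at_right_between a x (proj1 Hx)); apply filter_imp; intros y Hy.
    apply (le_of_derive_nonneg f f' y x); [lra| |]; intros z Hz;
      [apply Hd|apply Hp]; lra. }
intros x Hx; rewrite <- (is_derive_unique _ _ _ (Hd x Hx)).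
apply is_derive_unique; apply (is_derive_ext_loc (fun _ => 0)).
- generalize (filter_and _ _ (locally_interval (fun y => a < y) x a p_infty
    (proj1 Hx) I (fun y H _ => H)) (locally_interval (fun y => y < b) x m_infty b
    I (proj2 Hx) (fun y _ H => H))).
  apply filter_imp; intros y Hy; symmetry; now apply Z.
- auto_derive; auto.
Qed.

(** With [q = dr*/dr] and [Phi = dN/dr*], this says that a nonnegative function
    which is convex in [r*], stationary at infinity and vanishing at the
    horizon is zero. *)
Lemma convex_vanishing (N Phi Phi' q : R -> R) (a : R) :
  (forall r, a < r -> 0 <= N r) ->
  (forall r, a < r -> is_derive N r (q r * Phi r)) ->
  (forall r, a < r -> 0 < q r) ->
  (forall r, a < r -> is_derive Phi r (Phi' r)) ->
  (forall r, a < r -> 0 <= Phi' r) ->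
  filterlim Phi (Rbar_locally p_infty) (locally 0) ->
  filterlim N (at_right a) (locally 0) ->
  forall r, a < r -> N r = 0.
Proof.
intros HN Hd Hq HdP HP Hinf Ha.
assert (Z : forall r, a < r -> Phi r <= 0).
{ intros r Hr; apply (limit_ge _ Phi 0 (Phi r) Hinf).
  exists r; intros y Hy; apply (le_of_derive_nonneg Phi Phi' r y); [lra| |];
    intros z Hz; [apply HdP|apply HP]; lra. }
intros r Hr; apply Rle_antisym; [|now apply HN].
apply (limit_ge _ N 0 (N r) Ha).
generalize (at_right_between a r Hr); apply filter_imp; intros y Hy.
assert (- N y <= - N r); [|lra].
apply (le_of_derive_nonneg (fun r => - N r) (fun r => - (q r * Phi r)) y r);
  [lra| |]; intros z Hz.
- apply (is_derive_opp N); apply Hd; lra.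
- assert (0 < q z) by (apply Hq; lra); assert (Phi z <= 0) by (apply Z; lra).
  nra.
Qed.

(** * Algebra of a separated mode in the Teukolsky operator *)

Lemma Ci_sq : (Ci * Ci)%C = RtoC (-1).
Proof. apply C_ext; simpl; ring. Qed.

Lemma RtoC_neq_0 x : x <> 0 -> RtoC x <> 0%C.
Proof. intros H E; apply H; now injection E. Qed.

(** The factor [l] is the logarithmic derivative of the renormalisation; it
    makes the first-order radial coefficient independent of the spin. *)
Lemma teukolsky_collect (F R0 R1 R2 S0 S1 S2 : C)
    (sg l l1 D D1 D2 Sg X Dth d1 sn ct w K H om r a k q4 q5 q6 : R) :
  sg * sg = 1 -> D <> 0 -> Sg <> 0 -> Dth <> 0 -> sn <> 0 -> w <> 0 ->
  l = - sg * (D1 / D) - r / w ->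
  l1 = - sg * (D2 / D - D1 ^ 2 / D ^ 2) - (1 / w - 2 * r ^ 2 / w ^ 2) ->
  (RtoC (/ Sg) * (F * ((RtoC D1 * (R1 + RtoC l * R0)
      + RtoC D * (R2 + RtoC l * R1 + RtoC l1 * R0
                  + RtoC l * (R1 + RtoC l * R0))) * S0))
   - RtoC (X ^ 2 / (Sg * D)) * (F * (Ci * RtoC (sg * K) * (Ci * RtoC (sg * K) * (R0 * S0))))
   + RtoC (/ (Sg * sn)) * (F * (R0 * (RtoC d1 * S1 + RtoC (Dth * sn) * S2)))
   + RtoC (X ^ 2 / (Sg * Dth)) * (F * (Ci * RtoC (sg * H) * (Ci * RtoC (sg * H) * (R0 * S0))))
   + RtoC (sg * 2 * (D1 / Sg)) * (F * ((R1 + RtoC l * R0) * S0))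
   + RtoC (sg * 2 * X * (D1 / (Sg * D))) * (F * (Ci * RtoC (sg * K) * (R0 * S0)))
   - RtoC (sg * 8 * (X * r / Sg)) * (F * (Ci * RtoC (- sg * om) * (R0 * S0)))
   + RtoC ((6 * k ^ 2 * r ^ 2 + (1 + sg) * D2) / Sg) * (F * (R0 * S0))
   + Ci * RtoC (sg * 4 * (X * ct / (Sg * Dth)) * q4)
       * (F * (Ci * RtoC (sg * H) * (R0 * S0)))
   - Ci * RtoC (sg * 8 * (X / Sg) * a * q5) * (F * (Ci * RtoC (- sg * om) * (R0 * S0)))
   - RtoC (/ Sg * q6) * (F * (R0 * S0)))%C
  = (F * RtoC (/ Sg) *
     ((RtoC D * R2 + RtoC (D1 - 2 * r * D / w) * R1
       + (RtoC (X ^ 2 * K ^ 2 / D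
                - (D1 ^ 2 / D - D2 + D1 * r / w + D * (1 / w - 3 * r ^ 2 / w ^ 2)
                   - 6 * k ^ 2 * r ^ 2))
          + Ci * RtoC (X * (2 * D1 * K / D + 8 * r * om))) * R0) * S0
      + R0 * (RtoC Dth * S2 + RtoC (d1 / sn) * S1
              - RtoC (X ^ 2 / Dth * H ^ 2 + 4 * X * (ct / Dth) * q4 * H
                      + 8 * X * a * q5 * om + q6) * S0)))%C.
Proof.
intros Hsg HD HS Hth Hsn Hw El El1.
transitivity (F *
  (RtoC (/ Sg * D) * (R2 * S0)
   + RtoC (/ Sg * (D1 + 2 * D * l) + sg * 2 * (D1 / Sg)) * (R1 * S0)
   + RtoC (/ Sg * (D1 * l + D * (l1 + l * l)) + X ^ 2 / (Sg * D) * (sg * K * (sg * K))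
           - X ^ 2 / (Sg * Dth) * (sg * H * (sg * H)) + sg * 2 * (D1 / Sg) * l
           + (6 * k ^ 2 * r ^ 2 + (1 + sg) * D2) / Sg
           - sg * 4 * (X * ct / (Sg * Dth)) * q4 * (sg * H)
           + sg * 8 * (X / Sg) * a * q5 * (- sg * om)
           - / Sg * q6) * (R0 * S0)
   + Ci * RtoC (sg * 2 * X * (D1 / (Sg * D)) * (sg * K)
                - sg * 8 * (X * r / Sg) * (- sg * om)) * (R0 * S0)
   + RtoC (/ (Sg * sn) * d1) * (R0 * S1)
   + RtoC (/ (Sg * sn) * (Dth * sn)) * (R0 * S2)))%C.
(* With the real coefficients made opaque, collecting terms needs no division, only
   [Ci * Ci = -1]. *)
- generalize (X ^ 2 / (Sg * D)) (X ^ 2 / (Sg * Dth)) (/ Sg) (/ (Sg * sn))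
    (sg * 2 * (D1 / Sg)) (sg * 2 * X * (D1 / (Sg * D))) (sg * 8 * (X * r / Sg))
    ((6 * k ^ 2 * r ^ 2 + (1 + sg) * D2) / Sg)
    (sg * 4 * (X * ct / (Sg * Dth)) * q4)  (sg * 8 * (X / Sg) * a * q5)
    (sg * K) (sg * H) (- sg * om).
  clear; intros.
  rewrite ?RtoC_mult, ?RtoC_plus, ?RtoC_minus, ?RtoC_plus, ?RtoC_mult.
  repeat (rewrite ?RtoC_minus, ?RtoC_plus, ?RtoC_mult).
  ring [Ci_sq].
- transitivity (F * RtoC (/ Sg) *
  (RtoC D * (R2 * S0) + RtoC (D1 - 2 * r * D / w) * (R1 * S0)
   + RtoC ((X ^ 2 * K ^ 2 / D
                - (D1 ^ 2 / D - D2 + D1 * r / w + D * (1 / w - 3 * r ^ 2 / w ^ 2)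
                   - 6 * k ^ 2 * r ^ 2))
      - (X ^ 2 / Dth * H ^ 2 + 4 * X * (ct / Dth) * q4 * H
                      + 8 * X * a * q5 * om + q6)) * (R0 * S0)
   + Ci * RtoC (X * (2 * D1 * K / D + 8 * r * om)) * (R0 * S0)
   + RtoC (d1 / sn) * (R0 * S1) + RtoC Dth * (R0 * S2)))%C;
  [|rewrite (RtoC_minus (X ^ 2 * K ^ 2 / D - _)); ring].
  rewrite <- (Cmult_assoc F); apply (f_equal (Cmult F)).
  rewrite !Cmult_plus_distr_l.
  (* From here on the real and imaginary coefficients are compared one by one, with the common
     factor [/ Sg] taken out. *)
  assert (A : forall x y z, x = / Sg * y -> (RtoC x * z)%C = (RtoC (/ Sg) * (RtoC y * z))%C)
    by (intros x y z ->; rewrite RtoC_mult; ring).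
  assert (A' : forall x y z, x = / Sg * y ->
     (Ci * RtoC x * z)%C = (RtoC (/ Sg) * (Ci * RtoC y * z))%C)
    by (intros x y z ->; rewrite RtoC_mult; ring).
  assert (sq : forall x y, sg * x * (sg * y) = x * y)
    by (intros x y; transitivity (sg * sg * (x * y)); [ring|rewrite Hsg; ring]).
  repeat apply (f_equal2 Cplus); (apply A' || apply A); subst l l1.
  + ring.
  + field; auto.
  (* All terms linear in [sg] cancel: [sg * D2] in the potential against the one in [l1], and
     likewise the multiples of [D1 ^ 2 / D] and of [D1 * r / w]. The rest contains [sg] only through
     its square. *)
  + rewrite !sq.
    field_simplify_eq; [|repeat split; auto].
    replace (sg ^ 2) with 1 by lra; try ring.
  + field_simplify_eq; [|repeat split; auto].
    replace (sg ^ 2) with 1 by lra; try ring.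
  + field; auto.
  + field; auto.
Qed.

(** * Separation of variables *)

Definition dDelta (M a k r : R) : R :=
  2 * r * (1 + k ^ 2 * r ^ 2) + 2 * k ^ 2 * r * (r ^ 2 + a ^ 2) - 2 * M.
Definition ddDelta (a k r : R) : R := 12 * k ^ 2 * r ^ 2 + 2 + 2 * a ^ 2 * k ^ 2.

Lemma is_derive_Delta M a k r : is_derive (Delta M a k) r (dDelta M a k r).
Proof. unfold Delta, dDelta; auto_derive; [auto|ring]. Qed.

Lemma is_derive_dDelta M a k r : is_derive (dDelta M a k) r (ddDelta a k r).
Proof. unfold dDelta, ddDelta; auto_derive; [auto|ring]. Qed.

Lemma Derive_Delta M a k r : Derive (Delta M a k) r = dDelta M a k r.
Proof. apply is_derive_unique, is_derive_Delta. Qed.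

Lemma Derive2_Delta M a k r : Derive_n (Delta M a k) 2 r = ddDelta a k r.
Proof.
simpl; rewrite (Derive_ext _ (dDelta M a k)) by apply Derive_Delta.
apply is_derive_unique, is_derive_dDelta.
Qed.

(** Modes with an arbitrary profile in [(r, th)]: this class is stable under [op_K] and [op_H],
    which act on the profile by multiplication. *)
Definition modef (tau nu : R) (g : R -> R -> C) : field :=
  fun t r th ph => (cis (tau * t) * cis (nu * ph) * g r th)%C.

Lemma cis_0 : cis 0 = 1%C.
Proof. unfold cis; now rewrite cos_0, sin_0. Qed.

Lemma cis_neq_0 x : cis x <> 0%C.
Proof.
intros E; injection E; intros H1 H2; generalize (sin2_cos2 x).
rewrite H1, H2; unfold Rsqr; lra.
Qed.

Lemma Cmod_cis x : Cmod (cis x) = 1.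
Proof.
unfold Cmod, cis; cbn [fst snd].
replace (cos x ^ 2 + sin x ^ 2) with 1 by (rewrite <- (sin2_cos2 x); unfold Rsqr; ring).
apply sqrt_1.
Qed.

Lemma is_deriveC_cis c x :
  is_deriveC (fun y => cis (c * y)) x (Ci * RtoC c * cis (c * x))%C.
Proof.
split; unfold cis; simpl; auto_derive; auto; unfold Re, Im; simpl; ring.
Qed.

Lemma is_deriveC_eq f x l l' : is_deriveC f x l -> l = l' -> is_deriveC f x l'.
Proof. now intros H <-. Qed.

Lemma is_deriveC_ext f g x l :
  (forall y, f y = g y) -> is_deriveC f x l -> is_deriveC g x l.
Proof. intros E; apply is_deriveC_ext_loc; now apply filter_forall. Qed.

Lemma d_t_modef tau nu g :
  d_t (modef tau nu g) = modef tau nu (fun r th => Ci * RtoC tau * g r th)%C.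
Proof.
apply functional_extensionality; intros t; apply functional_extensionality; intros r.
apply functional_extensionality; intros th; apply functional_extensionality; intros ph.
unfold d_t, modef; apply DeriveC_unique.
apply (is_deriveC_ext (fun y => (cis (nu * ph) * g r th) * cis (tau * y))%C).
{ intros y; ring. }
apply (is_deriveC_eq _ _ _ _ (is_deriveC_scal _ _ _ _ (is_deriveC_cis tau t))); ring.
Qed.

Lemma d_ph_modef tau nu g :
  d_ph (modef tau nu g) = modef tau nu (fun r th => Ci * RtoC nu * g r th)%C.
Proof.
apply functional_extensionality; intros t; apply functional_extensionality; intros r.
apply functional_extensionality; intros th; apply functional_extensionality; intros ph.
unfold d_ph, modef; apply DeriveC_unique.
apply (is_deriveC_ext (fun y => (cis (tau * t) * g r th) * cis (nu * y))%C).
{ intros y; ring. }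
apply (is_deriveC_eq _ _ _ _ (is_deriveC_scal _ _ _ _ (is_deriveC_cis nu ph))); ring.
Qed.

Lemma op_K_modef a tau nu g :
  op_K a (modef tau nu g) =
  modef tau nu (fun r th => Ci * RtoC (a * nu + (r ^ 2 + a ^ 2) * tau) * g r th)%C.
Proof.
apply functional_extensionality; intros t; apply functional_extensionality; intros r.
apply functional_extensionality; intros th; apply functional_extensionality; intros ph.
unfold op_K; rewrite d_t_modef, d_ph_modef; unfold modef.
rewrite (RtoC_plus (a * nu)), (RtoC_mult (r ^ 2 + a ^ 2)), (RtoC_mult a); ring.
Qed.

Lemma op_H_modef a tau nu g :
  op_H a (modef tau nu g) =
  modef tau nu (fun r th => Ci * RtoC (a * sin th * tau + / sin th * nu) * g r th)%C.
Proof.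
apply functional_extensionality; intros t; apply functional_extensionality; intros r.
apply functional_extensionality; intros th; apply functional_extensionality; intros ph.
unfold op_H; rewrite d_t_modef, d_ph_modef; unfold modef.
rewrite (RtoC_plus (a * sin th * tau)), (RtoC_mult (a * sin th) tau), (RtoC_mult (/ sin th)); ring.
Qed.

Lemma d_r_modef tau nu g t r th ph l :
  is_deriveC (fun x => g x th) r l ->
  d_r (modef tau nu g) t r th ph = (cis (tau * t) * cis (nu * ph) * l)%C.
Proof.
intros H; unfold d_r, modef; apply DeriveC_unique; now apply is_deriveC_scal.
Qed.

Lemma d_th_modef tau nu g t r th ph l :
  is_deriveC (fun x => g r x) th l ->
  d_th (modef tau nu g) t r th ph = (cis (tau * t) * cis (nu * ph) * l)%C.
Proof.
intros H; unfold d_th, modef; apply DeriveC_unique; now apply is_deriveC_scal.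
Qed.

Lemma stationary_mode_modef s m omega Rf Sf :
  stationary_mode s m omega Rf Sf =
  modef (- IZR (sgn s) * (IZR m * omega)) (IZR (sgn s) * IZR m)
    (fun r th => Rf r * Sf th)%C.
Proof.
apply functional_extensionality; intros t; apply functional_extensionality; intros r.
apply functional_extensionality; intros th; apply functional_extensionality; intros ph.
unfold stationary_mode, modef; rewrite <- !Rmult_assoc; ring.
Qed.

Definition renorm (M a k : R) (s : spin) (r : R) : R :=
  powerRZ (Delta M a k r) (- sgn s) * / sqrt (r ^ 2 + a ^ 2).
Definition dlog_renorm (M a k : R) (s : spin) (r : R) : R :=
  - IZR (sgn s) * (dDelta M a k r / Delta M a k r) - r / (r ^ 2 + a ^ 2).

Lemma is_derive_renorm M a k s r :
  0 < Delta M a k r -> 0 < r ->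
  is_derive (renorm M a k s) r (dlog_renorm M a k s r * renorm M a k s r).
Proof.
intros HD Hr; assert (Hw : 0 < r ^ 2 + a ^ 2) by nra.
assert (Hs : is_derive (fun r => / sqrt (r ^ 2 + a ^ 2)) r
   (- (r / (r ^ 2 + a ^ 2)) * / sqrt (r ^ 2 + a ^ 2))).
{ assert (sqrt (r ^ 2 + a ^ 2) <> 0) by (apply Rgt_not_eq, sqrt_lt_R0, Hw).
  auto_derive.
  - replace (r * (r * 1) + a * (a * 1)) with (r ^ 2 + a ^ 2) by ring; auto.
  - replace (r * (r * 1) + a * (a * 1)) with (r ^ 2 + a ^ 2) by ring.
    assert (Hq : sqrt (r ^ 2 + a ^ 2) * sqrt (r ^ 2 + a ^ 2) = r ^ 2 + a ^ 2)
      by (apply sqrt_sqrt; lra).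
    set (q := sqrt (r ^ 2 + a ^ 2)) in *; rewrite <- Hq.
    field; auto. }
assert (Hp : is_derive (fun r => powerRZ (Delta M a k r) (- sgn s)) r
   (- IZR (sgn s) * (dDelta M a k r / Delta M a k r) * powerRZ (Delta M a k r) (- sgn s))).
{ destruct s; simpl.
  - apply (is_derive_ext (fun r => / Delta M a k r)).
    { intros t; now rewrite Rmult_1_r. }
    apply (is_derive_eq _ _ _ _ (is_derive_inv _ _ _ (is_derive_Delta M a k r)
             (Rgt_not_eq _ _ HD))).
    field; lra.
  - apply (is_derive_ext (Delta M a k)).
    { intros t; now rewrite Rmult_1_r. }
    apply (is_derive_eq _ _ _ _ (is_derive_Delta M a k r)); field; lra. }
apply (is_derive_eq _ _ _ _ (Derive.is_derive_mult _ _ _ _ _ Hp Hs)).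
unfold dlog_renorm, renorm; ring.
Qed.

Lemma renorm_neq_0 M a k s r :
  0 < Delta M a k r -> 0 < r -> renorm M a k s r <> 0.
Proof.
intros HD Hr; unfold renorm; apply Rmult_integral_contrapositive_currified.
- apply powerRZ_NOR; lra.
- apply Rinv_neq_0_compat, Rgt_not_eq, sqrt_lt_R0; nra.
Qed.

Lemma is_derive_dlog_renorm M a k s r :
  0 < Delta M a k r -> 0 < r ->
  is_derive (dlog_renorm M a k s) r
    (- IZR (sgn s) * (ddDelta a k r / Delta M a k r
                      - dDelta M a k r ^ 2 / Delta M a k r ^ 2)
     - (1 / (r ^ 2 + a ^ 2) - 2 * r ^ 2 / (r ^ 2 + a ^ 2) ^ 2)).
Proof.
intros HD Hr; assert (Hw : 0 < r ^ 2 + a ^ 2) by nra.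
unfold dlog_renorm.
apply (is_derive_eq _ _ (plus (- IZR (sgn s) * ((ddDelta a k r * Delta M a k r
    - dDelta M a k r * dDelta M a k r) / Delta M a k r ^ 2))
  (opp (1 / (r ^ 2 + a ^ 2) - 2 * r ^ 2 / (r ^ 2 + a ^ 2) ^ 2)))).
- apply (is_derive_minus (V := R_NormedModule)).
  + apply is_derive_scal; apply is_derive_div;
      [apply is_derive_dDelta|apply is_derive_Delta|lra].
  + auto_derive; [nra|field; nra].
- unfold plus, opp; simpl; field; lra.
Qed.

Lemma unrenormalised_modef M a k s tau nu g :
  unrenormalised M a k s (modef tau nu g) =
  modef tau nu (fun r th => RtoC (renorm M a k s r) * g r th)%C.
Proof.
apply functional_extensionality; intros t; apply functional_extensionality; intros r.
apply functional_extensionality; intros th; apply functional_extensionality; intros ph.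
unfold unrenormalised, modef; fold (renorm M a k s r); ring.
Qed.

(** On the stationary mode of spin [s], with [om] equal to [m] times the frequency, [op_K] and
    [op_H] are multiplication by [i * sgn s] times [Kf] and [Hf]. *)
Definition Kf (a m om r : R) : R := a * m - (r ^ 2 + a ^ 2) * om.
Definition Hf (a m om th : R) : R := m / sin th - a * om * sin th.

Definition radial_potential (M a k r : R) : R :=
  dDelta M a k r ^ 2 / Delta M a k r - ddDelta a k r
  + dDelta M a k r * r / (r ^ 2 + a ^ 2)
  + Delta M a k r * (1 / (r ^ 2 + a ^ 2) - 3 * r ^ 2 / (r ^ 2 + a ^ 2) ^ 2)
  - 6 * k ^ 2 * r ^ 2.

(** The first two terms are [(r^2 + a^2)^2 / Delta] times the second derivative in [rstar]. *)
Definition radial_op (M a k m om : R) (f : R -> C) (r : R) : C :=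
  (RtoC (Delta M a k r) * DeriveC (DeriveC f) r
   + RtoC (dDelta M a k r - 2 * r * Delta M a k r / (r ^ 2 + a ^ 2)) * DeriveC f r
   + (RtoC (Xi a k ^ 2 * Kf a m om r ^ 2 / Delta M a k r - radial_potential M a k r)
      + Ci * RtoC (Xi a k * (2 * dDelta M a k r * Kf a m om r / Delta M a k r
                             + 8 * r * om))) * f r)%C.

Definition dsinDth (a k th : R) : R :=
  2 * a ^ 2 * k ^ 2 * cos th * sin th * sin th + Delta_th a k th * cos th.

Definition angular_potential (a k m om th : R) : R :=
  Xi a k ^ 2 / Delta_th a k th * Hf a m om th ^ 2
  + 4 * Xi a k * (cot th / Delta_th a k th) * (1 - a ^ 2 * k ^ 2 * cos (2 * th))
      * Hf a m om th
  + 8 * Xi a k * a * cos th * om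
  + (2 * Delta_th a k th + 2 * a ^ 2 * k ^ 2
     + 4 * (Xi a k ^ 2 * cot th ^ 2 / Delta_th a k th)).

(** The first two terms are the divergence form [(1 / sin th) d_th (Delta_th sin th d_th f)],
    written out. *)
Definition angular_op (a k m om : R) (f : R -> C) (th : R) : C :=
  (RtoC (Delta_th a k th) * DeriveC (DeriveC f) th
   + RtoC (dsinDth a k th / sin th) * DeriveC f th
   - RtoC (angular_potential a k m om th) * f th)%C.

Lemma is_derive_sinDth a k th :
  is_derive (fun th => Delta_th a k th * sin th) th (dsinDth a k th).
Proof. unfold Delta_th, dsinDth, Delta_th; auto_derive; [auto|ring]. Qed.

Lemma Delta_th_pos a k th : 0 <= a -> 0 < k -> a * k < 1 -> 0 < Delta_th a k th.
Proof.
intros Ha Hk Hak; unfold Delta_th; generalize (COS_bound th); intros [H1 H2].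
assert (0 <= a * k) by nra; assert (cos th ^ 2 <= 1) by nra.
assert ((a * k) ^ 2 < 1) by nra.
assert ((a * k) ^ 2 * cos th ^ 2 <= (a * k) ^ 2 * 1)
  by (apply Rmult_le_compat_l; [apply pow2_ge_0|easy]).
nra.
Qed.

Lemma sgn_sq s : IZR (sgn s) * IZR (sgn s) = 1.
Proof. destruct s; simpl; ring. Qed.

Lemma open_gt c : forall x, c < x -> locally x (fun y => c < y).
Proof.
intros x Hx; exact (locally_interval (fun y => c < y) x c p_infty Hx I (fun y H _ => H)).
Qed.

Lemma open_between c d : forall x, c < x < d -> locally x (fun y => c < y < d).
Proof.
intros x [H1 H2].
exact (locally_interval (fun y => c < y < d) x c d H1 H2 (fun y H H' => conj H H')).
Qed.

(** The sign of the spin enters the equation, the phases and the renormalisation; these signs cancel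
    or pair into squares, so the radial and angular operators do not depend on [s]. *)
Lemma teukolsky_separation M a k rp s m omega Rf Sf t r th ph :
  0 <= a -> 0 < k -> a * k < 1 -> 0 < rp ->
  (forall x, rp < x -> 0 < Delta M a k x) ->
  smoothC (fun x => rp < x) Rf -> smoothC (fun x => 0 < x < PI) Sf ->
  exterior rp r th ->
  teukolsky_op M a k s
    (unrenormalised M a k s (stationary_mode s m omega Rf Sf)) t r th ph =
  (cis (- IZR (sgn s) * (IZR m * omega) * t) * cis (IZR (sgn s) * IZR m * ph)
   * RtoC (renorm M a k s r) * RtoC (/ Sigma a r th)
   * (radial_op M a k (IZR m) (IZR m * omega) Rf r * Sf th
      + Rf r * angular_op a k (IZR m) (IZR m * omega) Sf th))%C.
Proof.
intros Ha Hk Hak Hrp HD HR HS [Hr Hth].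
rewrite stationary_mode_modef, unrenormalised_modef.
set (tau := - IZR (sgn s) * (IZR m * omega)); set (nu := IZR (sgn s) * IZR m).
set (g := fun r th => (RtoC (renorm M a k s r) * (Rf r * Sf th))%C).
set (om := IZR m * omega) in *.
set (R1 := DeriveC Rf); set (R2 := DeriveC R1).
set (S1 := DeriveC Sf); set (S2 := DeriveC S1).
assert (dR : forall x, rp < x -> is_deriveC Rf x (R1 x)) by apply (HR 1%nat).
assert (dR1 : forall x, rp < x -> is_deriveC R1 x (R2 x)) by apply (HR 2%nat).
assert (dS : forall x, 0 < x < PI -> is_deriveC Sf x (S1 x)) by apply (HS 1%nat).
assert (dS1 : forall x, 0 < x < PI -> is_deriveC S1 x (S2 x)) by apply (HS 2%nat).
set (l := dlog_renorm M a k s); set (c := renorm M a k s) in *.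
set (l1 := - IZR (sgn s) * (ddDelta a k r / Delta M a k r
                      - dDelta M a k r ^ 2 / Delta M a k r ^ 2)
     - (1 / (r ^ 2 + a ^ 2) - 2 * r ^ 2 / (r ^ 2 + a ^ 2) ^ 2)).
assert (dc : forall x, rp < x -> is_deriveC (fun x => RtoC (c x)) x (RtoC (l x * c x))).
{ intros x Hx; apply is_deriveC_RtoC, is_derive_renorm; [now apply HD|lra]. }
assert (dl : is_deriveC (fun x => RtoC (l x)) r (RtoC l1)).
{ apply is_deriveC_RtoC, is_derive_dlog_renorm; [now apply HD|lra]. }
assert (dg : forall x y, rp < x -> is_deriveC (fun x => g x y) x
   (RtoC (c x) * ((R1 x + RtoC (l x) * Rf x) * Sf y))%C).
{ intros x y Hx.
  apply (is_deriveC_eq _ _ _ _ (is_deriveC_mult _ _ _ _ _ (dc x Hx)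
     (is_deriveC_mult _ _ _ _ _ (dR x Hx) (is_deriveC_const (Sf y) x)))).
  rewrite RtoC_mult; ring. }
set (E := (cis (tau * t) * cis (nu * ph))%C).
assert (Er : d_r (modef tau nu g) t r th ph
  = (E * RtoC (c r) * ((R1 r + RtoC (l r) * Rf r) * Sf th))%C).
{ rewrite (d_r_modef _ _ _ _ _ _ _ _ (dg r th Hr)); unfold E; ring. }
assert (Err : d_r (fun t r th ph => RtoC (Delta M a k r)
                     * d_r (modef tau nu g) t r th ph)%C t r th ph
  = (E * RtoC (c r) * ((RtoC (dDelta M a k r) * (R1 r + RtoC (l r) * Rf r)
      + RtoC (Delta M a k r) * (R2 r + RtoC (l r) * R1 r + RtoC l1 * Rf r
                  + RtoC (l r) * (R1 r + RtoC (l r) * Rf r))) * Sf th))%C).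
{ apply DeriveC_unique.
  apply (is_deriveC_ext_loc (fun x => E * (RtoC (Delta M a k x)
     * (RtoC (c x) * ((R1 x + RtoC (l x) * Rf x) * Sf th))))%C).
  { generalize (open_gt rp r Hr); apply filter_imp; intros x Hx.
    rewrite (d_r_modef _ _ _ _ _ _ _ _ (dg x th Hx)); unfold E; ring. }
  apply (is_deriveC_eq _ _ _ _ (is_deriveC_scal _ _ _ _ (is_deriveC_mult _ _ _ _ _
    (is_deriveC_RtoC _ _ _ (is_derive_Delta M a k r))
    (is_deriveC_mult _ _ _ _ _ (dc r Hr)
      (is_deriveC_mult _ _ _ _ _
        (is_deriveC_plus _ _ _ _ _ (dR1 r Hr)
           (is_deriveC_mult _ _ _ _ _ dl (dR r Hr)))
        (is_deriveC_const (Sf th) r)))))).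
  rewrite RtoC_mult; ring. }
assert (dgth : forall y, 0 < y < PI -> is_deriveC (fun y => g r y) y
   (RtoC (c r) * (Rf r * S1 y))%C).
{ intros y Hy.
  exact (is_deriveC_scal _ _ _ _ (is_deriveC_scal _ _ _ _ (dS y Hy))). }
assert (Eth : d_th (fun t r th ph => RtoC (Delta_th a k th * sin th)
                     * d_th (modef tau nu g) t r th ph)%C t r th ph
  = (E * RtoC (c r) * (Rf r * (RtoC (dsinDth a k th) * S1 th
                       + RtoC (Delta_th a k th * sin th) * S2 th)))%C).
{ apply DeriveC_unique.
  apply (is_deriveC_ext_loc (fun y => E * RtoC (c r) * Rf r *
     (RtoC (Delta_th a k y * sin y) * S1 y))%C).
  { generalize (open_between 0 PI th Hth); apply filter_imp; intros y Hy.
    rewrite (d_th_modef _ _ _ _ _ _ _ _ (dgth y Hy)); unfold E; ring. }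
  apply (is_deriveC_eq _ _ _ _ (is_deriveC_scal _ _ _ _ (is_deriveC_mult _ _ _ _ _
    (is_deriveC_RtoC _ _ _ (is_derive_sinDth a k th)) (dS1 th Hth)))).
  ring. }
assert (Hsin : 0 < sin th) by (apply sin_gt_0; apply Hth).
assert (HDr := HD r Hr).
assert (HSig : 0 < Sigma a r th).
{ unfold Sigma; assert (0 <= (a * cos th) ^ 2) by apply pow2_ge_0; nra. }
assert (HDth := Delta_th_pos a k th Ha Hk Hak).
unfold teukolsky_op, Box; cbv zeta.
rewrite Derive_Delta, Derive2_Delta, Er, Err, Eth.
rewrite !op_K_modef, !op_H_modef, d_t_modef; unfold modef, g.
fold E.
set (sg := IZR (sgn s)) in *.
replace (a * nu + (r ^ 2 + a ^ 2) * tau) with (sg * Kf a (IZR m) om r)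
  by (unfold nu, tau, Kf; ring).
replace (a * sin th * tau + / sin th * nu) with (sg * Hf a (IZR m) om th)
  by (unfold nu, tau, Hf; field; lra).
refine (eq_trans _ (teukolsky_collect (E * RtoC (c r)) (Rf r) (R1 r) (R2 r) (Sf th) (S1 th) (S2 th)
  sg (l r) l1 (Delta M a k r) (dDelta M a k r) (ddDelta a k r) (Sigma a r th)
  (Xi a k) (Delta_th a k th) (dsinDth a k th) (sin th) (cot th) (r ^ 2 + a ^ 2)
  (Kf a (IZR m) om r) (Hf a (IZR m) om th) om r a k
  (1 - a ^ 2 * k ^ 2 * cos (2 * th)) (cos th)
  (2 * Delta_th a k th + 2 * a ^ 2 * k ^ 2
   + 4 * (Xi a k ^ 2 * cot th ^ 2 / Delta_th a k th)) _ _ _ _ _ _ _ _));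
  try lra; try reflexivity.
- replace (- sg * om) with tau by (unfold tau; ring).
  ring.
- apply sgn_sq.
- nra.
Qed.

(** * Estimates on the coefficients *)

Lemma Delta_expand M a k p r :
  Delta M a k r = Delta M a k p + dDelta M a k p * (r - p)
    + (k ^ 2 * (r ^ 2 + 2 * r * p + 3 * p ^ 2) + 1 + a ^ 2 * k ^ 2) * (r - p) ^ 2.
Proof. unfold Delta, dDelta; ring. Qed.

(** The second root [r1 < rp] makes the horizon non-degenerate: expanding at [rp] and evaluating at
    [r1] gives [Delta'(rp) = Q (rp - r1)] with [Q > 0]. *)
Lemma admissible_horizon M a k rp :
  admissible M a k -> is_r_plus M a k rp -> 0 < rp /\ 0 < dDelta M a k rp.
Proof.
intros [HM [Hk [Ha [Hak [r1 [r2 [H1 [H12 [D1 D2]]]]]]]]] [D0 Hmax].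
assert (H2 := Hmax r2 D2); assert (Hp : 0 < rp) by lra; split; [easy|].
assert (E := Delta_expand M a k rp r1); rewrite D0, D1 in E.
set (Q := k ^ 2 * (r1 ^ 2 + 2 * r1 * rp + 3 * rp ^ 2) + 1 + a ^ 2 * k ^ 2) in *.
assert (HQ : 0 < Q).
{ unfold Q; assert (0 <= r1 * rp) by nra; assert (0 <= (a * k) ^ 2) by apply pow2_ge_0.
  assert (0 <= k ^ 2 * (r1 ^ 2 + 2 * r1 * rp + 3 * rp ^ 2)); [|nra].
  apply Rmult_le_pos; nra. }
assert (E' : dDelta M a k rp = Q * (rp - r1)).
{ apply (Rmult_eq_reg_r (rp - r1)); [nra|lra]. }
rewrite E'; apply Rmult_lt_0_compat; lra.
Qed.

(** The quartic term controls [K^2], which is a multiple of [(r^2 - rp^2)^2] at the stationary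
    frequency; the linear term records the simple zero at the horizon. *)
Lemma Delta_lower_bound M a k rp r :
  0 < rp -> Delta M a k rp = 0 -> rp <= r ->
  k ^ 2 * (r ^ 2 - rp ^ 2) ^ 2 + dDelta M a k rp * (r - rp) <= Delta M a k r.
Proof.
intros Hp D0 Hr; rewrite (Delta_expand M a k rp r), D0.
assert (0 <= (1 + a ^ 2 * k ^ 2 + 2 * k ^ 2 * rp ^ 2) * (r - rp) ^ 2); [|nra].
apply Rmult_le_pos; [|apply pow2_ge_0].
assert (0 <= (a * k) ^ 2) by apply pow2_ge_0; assert (0 <= (k * rp) ^ 2) by apply pow2_ge_0.
nra.
Qed.

Lemma Delta_pos M a k rp r :
  0 < rp -> Delta M a k rp = 0 -> 0 < dDelta M a k rp -> rp < r ->
  0 < Delta M a k r.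
Proof.
intros Hp D0 D1 Hr; assert (H := Delta_lower_bound M a k rp r Hp D0 (Rlt_le _ _ Hr)).
assert (0 <= (k * (r ^ 2 - rp ^ 2)) ^ 2) by apply pow2_ge_0.
assert (0 < dDelta M a k rp * (r - rp)) by (apply Rmult_lt_0_compat; lra); nra.
Qed.

Lemma ratio_bounds a rp r : 0 < rp -> rp <= r ->
  0 <= r ^ 2 / (r ^ 2 + a ^ 2) <= 1 /\ 0 <= r / (r ^ 2 + a ^ 2) <= / rp.
Proof.
intros Hp Hr; assert (0 < r ^ 2) by nra; assert (0 <= a ^ 2) by nra.
assert (Hw : 0 < r ^ 2 + a ^ 2) by nra.
repeat split.
- apply Rlt_le, Rdiv_lt_0_compat; lra.
- apply -> Rcomplements.Rdiv_le_1; lra.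
- apply Rlt_le, Rdiv_lt_0_compat; lra.
- apply Rle_div_l; [easy|]; apply (Rmult_le_reg_l rp); [easy|].
  rewrite <- Rmult_assoc, Rinv_r by lra; nra.
Qed.

(** The terms of order [r^2] at infinity cancel: 16 - 12 + 4 - 2 - 6 = 0. *)
Lemma radial_potential_lower_bound M a k rp :
  0 < M -> 0 < rp -> Delta M a k rp = 0 -> 0 < dDelta M a k rp ->
  exists Cst, forall r, rp < r -> - Cst <= radial_potential M a k r.
Proof.
intros HM Hp D0 D1; set (B := dDelta M a k rp) in *; set (b := 1 + a ^ 2 * k ^ 2).
(* In order: the deficit in [T1], the constant part of [ddDelta], the lower-order terms of [T2], and
   the terms of [T3] without [k^2 r^2], using [rho <= 1] and [sig <= / rp]. *)
exists (8 * b * M / B + 2 + 2 * a ^ 2 * k ^ 2 + 2 * a ^ 2 * k ^ 2 + 2 * M * / rp + 2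
        + 2 * M * / rp).
intros r Hr; assert (HDr := Delta_pos M a k rp r Hp D0 D1 Hr).
destruct (ratio_bounds a rp r Hp (Rlt_le _ _ Hr)) as [[Hrho Hrho1] [Hsig Hsig1]].
set (rho := r ^ 2 / (r ^ 2 + a ^ 2)) in *; set (sig := r / (r ^ 2 + a ^ 2)) in *.
assert (Hw : 0 < r ^ 2 + a ^ 2) by nra.
assert (Hb : 0 < b) by (unfold b; assert (0 <= (a * k) ^ 2) by apply pow2_ge_0; nra).
assert (T1 : 16 * k ^ 2 * r ^ 2 - 8 * b * M / B <= dDelta M a k r ^ 2 / Delta M a k r).
{ apply Rle_div_r; [easy|].
  assert (L : B * (r - rp) <= Delta M a k r).
  { assert (H := Delta_lower_bound M a k rp r Hp D0 (Rlt_le _ _ Hr)).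
    assert (0 <= (k * (r ^ 2 - rp ^ 2)) ^ 2) by apply pow2_ge_0; fold B in H; nra. }
  assert (L' : 8 * b * M * (r - rp) <= 8 * b * M / B * Delta M a k r).
  { replace (8 * b * M * (r - rp)) with (8 * b * M / B * (B * (r - rp))) by (field; lra).
    apply Rmult_le_compat_l; [|easy].
    apply Rlt_le, Rdiv_lt_0_compat; [|easy].
    repeat apply Rmult_lt_0_compat; lra. }
  (* The powers [r^6] and [r^4] cancel. What remains is a cubic in [r] whose only negative
     coefficient is [- 8 b M], that of [r]. Subtracting its value at [rp] exposes the factor
     [r - rp], so the negative part is absorbed by [Delta >= B (r - rp)]. *)
  assert (E : dDelta M a k r ^ 2 - 16 * k ^ 2 * r ^ 2 * Delta M a k r
      = dDelta M a k rp ^ 2 - 16 * k ^ 2 * rp ^ 2 * Delta M a k rp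
        + (r - rp) * (16 * M * k ^ 2 * (r ^ 2 + r * rp + rp ^ 2)
                      + 4 * (1 - a ^ 2 * k ^ 2) ^ 2 * (r + rp) - 8 * b * M)).
  { unfold dDelta, Delta, b; ring. }
  rewrite D0 in E.
  assert (P1 : 0 <= (r - rp) * (16 * M * k ^ 2 * (r ^ 2 + r * rp + rp ^ 2)
                      + 4 * (1 - a ^ 2 * k ^ 2) ^ 2 * (r + rp))).
  { apply Rmult_le_pos; [lra|]; apply Rplus_le_le_0_compat.
    - apply Rmult_le_pos; [|nra]; apply Rmult_le_pos; [lra|apply pow2_ge_0].
    - apply Rmult_le_pos; [|lra]; apply Rmult_le_pos; [lra|apply pow2_ge_0]. }
  assert (0 <= dDelta M a k rp ^ 2) by apply pow2_ge_0.
  nra. }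
assert (T2 : dDelta M a k r * r / (r ^ 2 + a ^ 2)
   = 4 * k ^ 2 * r ^ 2 + 2 * rho - 2 * k ^ 2 * a ^ 2 * rho - 2 * M * sig).
{ unfold rho, sig, dDelta; field; lra. }
assert (T3 : Delta M a k r * (1 / (r ^ 2 + a ^ 2) - 3 * r ^ 2 / (r ^ 2 + a ^ 2) ^ 2)
   = (1 + k ^ 2 * r ^ 2 - 2 * M * sig) * (1 - 3 * rho)).
{ unfold rho, sig, Delta; field; lra. }
unfold radial_potential; rewrite T2, T3; unfold ddDelta.
assert (0 <= k ^ 2 * r ^ 2 * (1 - rho)) by
  (apply Rmult_le_pos; [apply Rmult_le_pos; apply pow2_ge_0|lra]).
assert (0 <= k ^ 2 * a ^ 2 * (1 - rho)) by
  (apply Rmult_le_pos; [apply Rmult_le_pos; apply pow2_ge_0|lra]).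
assert (M * sig <= M * / rp) by (apply Rmult_le_compat_l; lra).
assert (0 <= M * sig * rho) by (apply Rmult_le_pos; [apply Rmult_le_pos|]; lra).
nra.
Qed.

(** At the stationary frequency, [mu * m^2] is the value at the equator of the leading term
    [Xi^2 H^2 / Delta_th] of the angular potential. *)
Definition mu (a k rp : R) : R := (Xi a k * (rp ^ 2 / (rp ^ 2 + a ^ 2))) ^ 2.

Lemma Xi_pos a k : 0 <= a -> 0 < k -> a * k < 1 -> 0 < Xi a k <= 1.
Proof. intros; unfold Xi; assert (0 <= a * k) by nra; split; nra. Qed.

Lemma mu_pos a k rp : 0 <= a -> 0 < k -> a * k < 1 -> 0 < rp -> 0 < mu a k rp.
Proof.
intros Ha Hk Hak Hp; unfold mu; apply pow_lt, Rmult_lt_0_compat.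
- now apply Xi_pos.
- apply Rdiv_lt_0_compat; nra.
Qed.

(** The stationary frequency makes [K] vanish at the horizon; Hawking-Reall is
    what makes the constant [(a / (k rp^2))^2] smaller than 1. *)
Lemma K_bound M a k rp m r :
  0 < k -> 0 < rp -> Delta M a k rp = 0 -> 0 < dDelta M a k rp -> rp < r ->
  Xi a k ^ 2 * Kf a m (m * omega_plus a rp) r ^ 2 / Delta M a k r
  <= (a / (k * rp ^ 2)) ^ 2 * mu a k rp * m ^ 2.
Proof.
intros Hk Hp D0 D1 Hr; assert (HDr := Delta_pos M a k rp r Hp D0 D1 Hr).
apply Rle_div_l; [easy|].
assert (H := Delta_lower_bound M a k rp r Hp D0 (Rlt_le _ _ Hr)).
assert (L : k ^ 2 * (r ^ 2 - rp ^ 2) ^ 2 <= Delta M a k r).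
{ assert (0 < dDelta M a k rp * (r - rp)) by (apply Rmult_lt_0_compat; lra); lra. }
assert (Hw : 0 < rp ^ 2 + a ^ 2) by nra.
(* At this frequency [K = - a m (r^2 - rp^2) / (rp^2 + a^2)]. *)
replace (Xi a k ^ 2 * Kf a m (m * omega_plus a rp) r ^ 2) with
  ((Xi a k * a * m / (k * (rp ^ 2 + a ^ 2))) ^ 2 * (k ^ 2 * (r ^ 2 - rp ^ 2) ^ 2))
  by (unfold Kf, omega_plus; field; lra).
replace ((a / (k * rp ^ 2)) ^ 2 * mu a k rp * m ^ 2) with
  ((Xi a k * a * m / (k * (rp ^ 2 + a ^ 2))) ^ 2) by (unfold mu; field; lra).
apply Rmult_le_compat_l; [apply pow2_ge_0|easy].
Qed.

(** At the stationary frequency [H = m h / sin th] with [hp <= h <= 1], and [Delta_th <= 1], so the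
    leading term is at least [mu m^2]. The cotangent term and the term with [cos th * om] can each
    lose [8 |m|], whence 16; the remaining terms are nonnegative. *)
Lemma angular_potential_lower_bound a k rp m th :
  0 <= a -> 0 < k -> a * k < 1 -> 0 < rp -> 0 < th < PI ->
  0 <= mu a k rp * m ^ 2 - 16 * Rabs m ->
  mu a k rp * m ^ 2 - 16 * Rabs m
    <= angular_potential a k m (m * omega_plus a rp) th.
Proof.
intros Ha Hk Hak Hp Hth Hm.
assert (Hs : 0 < sin th) by (apply sin_gt_0; apply Hth).
assert (Hs1 : sin th <= 1) by apply SIN_bound.
assert (Hc : sin th ^ 2 + cos th ^ 2 = 1) by (rewrite <- (sin2_cos2 th); unfold Rsqr; ring).
assert (HD := Delta_th_pos a k th Ha Hk Hak).
destruct (Xi_pos a k Ha Hk Hak) as [HX HX1].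
assert (HDX : Xi a k <= Delta_th a k th).
{ unfold Xi, Delta_th; assert (0 <= (a * k) ^ 2 * sin th ^ 2)
    by (apply Rmult_le_pos; apply pow2_ge_0); nra. }
assert (HD1 : Delta_th a k th <= 1).
{ unfold Delta_th; assert (0 <= (a * k * cos th) ^ 2) by apply pow2_ge_0; nra. }
set (e := a * omega_plus a rp).
set (hp := rp ^ 2 / (rp ^ 2 + a ^ 2)).
assert (Hw : 0 < rp ^ 2 + a ^ 2) by nra.
assert (Ehp : hp = 1 - e) by (unfold hp, e, omega_plus; field; lra).
assert (Hhp : 0 < hp) by (apply Rdiv_lt_0_compat; nra).
assert (He : 0 <= e).
{ unfold e, omega_plus; apply Rmult_le_pos; [easy|].
  apply Rmult_le_pos; [easy|apply Rlt_le, Rinv_0_lt_compat, Hw]. }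
set (s := sin th) in *; set (co := cos th) in *.
set (h := 1 - e * s ^ 2).
assert (Hss : 0 < s ^ 2 <= 1) by nra.
assert (Hh : hp <= h <= 1) by (unfold h; rewrite Ehp; split; nra).
set (D := Delta_th a k th) in *; set (X := Xi a k) in *.
assert (EH : Hf a m (m * omega_plus a rp) th = m * h / s).
{ unfold Hf, h, e; fold s; field; lra. }
assert (E2 : 1 - a ^ 2 * k ^ 2 * cos (2 * th) = 2 * D - X).
{ rewrite cos_2a_cos; fold co; unfold D, X, Delta_th, Xi; fold co; ring. }
assert (EP : angular_potential a k m (m * omega_plus a rp) th =
  (X ^ 2 / D * (m * h) ^ 2 + 4 * X * (2 - X / D) * (co * (m * h))) / s ^ 2
  + 8 * X * co * (m * e) + 2 * D + 2 * a ^ 2 * k ^ 2 + 4 * X ^ 2 * co ^ 2 / (D * s ^ 2)).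
{ unfold angular_potential; fold D X; rewrite EH, E2; unfold cot; fold s co.
  unfold e; field; lra. }
rewrite EP.
assert (Hco : Rabs co <= 1) by (apply Rabs_le, COS_bound).
assert (Hm0 := Rabs_pos m).
assert (B1 : mu a k rp * m ^ 2 <= X ^ 2 / D * (m * h) ^ 2).
{ unfold mu; fold X hp.
  replace (X ^ 2 / D * (m * h) ^ 2) with ((X * m) ^ 2 * (h ^ 2 / D)) by (field; lra).
  replace ((X * hp) ^ 2 * m ^ 2) with ((X * m) ^ 2 * hp ^ 2) by ring.
  apply Rmult_le_compat_l; [apply pow2_ge_0|].
  apply -> (Rle_div_r (hp ^ 2) (h ^ 2) D); [|lra].
  assert (hp ^ 2 <= h ^ 2) by (apply pow_incr; lra).
  assert (0 <= hp ^ 2) by apply pow2_ge_0.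
  apply Rle_trans with (hp ^ 2 * 1); [apply Rmult_le_compat_l|]; lra. }
assert (Q : 0 <= X * (2 - X / D) <= 2).
{ assert (0 <= X / D) by (apply Rlt_le, Rdiv_lt_0_compat; lra).
  assert (X / D <= 1) by (apply -> Rcomplements.Rdiv_le_1; lra).
  split; nra. }
assert (B2 : - (8 * Rabs m) <= 4 * X * (2 - X / D) * (co * (m * h))).
{ assert (Rabs (X * (2 - X / D) * (co * (m * h))) <= 2 * Rabs m).
  { rewrite !Rabs_mult, <- Rabs_mult.
    rewrite (Rabs_pos_eq (X * _)) by lra; rewrite (Rabs_pos_eq h) by lra.
    assert (Rabs co * (Rabs m * h) <= Rabs m).
    { assert (Rabs m * h <= Rabs m) by nra.
      assert (0 <= Rabs m * h) by (apply Rmult_le_pos; lra).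
      assert (0 <= Rabs co) by apply Rabs_pos; nra. }
    assert (0 <= Rabs co * (Rabs m * h)).
    { apply Rmult_le_pos; [apply Rabs_pos|apply Rmult_le_pos; lra]. }
    nra. }
  assert (H' := Rabs_le_between (X * (2 - X / D) * (co * (m * h))) (2 * Rabs m)).
  apply H' in H; lra. }
assert (B3 : - (8 * Rabs m) <= 8 * X * co * (m * e)).
{ assert (Rabs (X * co * (m * e)) <= Rabs m).
  { rewrite !Rabs_mult, (Rabs_pos_eq X), (Rabs_pos_eq e) by lra.
    assert (0 <= Rabs co) by apply Rabs_pos.
    assert (X * Rabs co <= 1) by nra; assert (0 <= X * Rabs co) by nra.
    assert (0 <= Rabs m * e <= Rabs m) by (split; nra).
    nra. }
  apply Rabs_le_between in H; lra. }
assert (B4 : 0 <= 4 * X ^ 2 * co ^ 2 / (D * s ^ 2)).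
{ apply Rmult_le_pos; [|apply Rlt_le, Rinv_0_lt_compat, Rmult_lt_0_compat; lra].
  assert (0 <= (X * co) ^ 2) by apply pow2_ge_0; nra. }
(* The numerator is bounded below by a nonnegative quantity, so dividing by [s ^ 2 <= 1] preserves
   the bound. The leading term and the cotangent term must be kept together: near the poles each is
   of order [1 / s ^ 2]. *)
assert (B5 : mu a k rp * m ^ 2 - 8 * Rabs m
   <= (X ^ 2 / D * (m * h) ^ 2 + 4 * X * (2 - X / D) * (co * (m * h))) / s ^ 2).
{ apply Rle_div_r; [lra|].
  assert (0 <= mu a k rp * m ^ 2 - 8 * Rabs m) by lra; nra. }
assert (0 <= (a * k) ^ 2) by apply pow2_ge_0.
nra.
Qed.

(** * The angular equation *)

Lemma dotC_plus_r z w1 w2 : dotC z (w1 + w2) = dotC z w1 + dotC z w2.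
Proof. unfold dotC, Re, Im; simpl; ring. Qed.

Lemma dotC_scal_r z x w : dotC z (RtoC x * w) = x * dotC z w.
Proof. unfold dotC, Re, Im; simpl; ring. Qed.

Lemma dotC_mult_self z w : dotC z (w * z) = Re w * normsq z.
Proof. unfold dotC, normsq, Re, Im; simpl; ring. Qed.

Lemma dotC_self z : dotC z z = normsq z.
Proof. unfold dotC, normsq, Re, Im; simpl; ring. Qed.

Definition angular_flux (a k : R) (f : R -> C) (th : R) : R :=
  Delta_th a k th * sin th * (2 * dotC (f th) (DeriveC f th)).

(** In the chart coordinate [psi] the profile and its derivative stay continuous at the pole [p],
    while the weight contains [sin th], which vanishes there. The hypothesis on [psi] covers both
    half-angle coordinates, with [c] equal to [/ 2] or [- / 2]. *)
Lemma angular_flux_pole a k Sf (v : nat -> R -> C) (psi : R -> R) c p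
    (F : (R -> Prop) -> Prop) {FF : Filter F} :
  sin p = 0 ->
  (forall th, 0 < th < PI \/ th = p -> is_derive psi th (c * (1 + psi th ^ 2))) ->
  (forall n y, is_deriveC (v n) y (v (S n) y)) ->
  (forall th, 0 < th < PI -> Sf th = v 0%nat (psi th)) ->
  F (fun th => 0 < th < PI) -> filter_le F (locally p) ->
  filterlim (angular_flux a k Sf) F (locally 0).
Proof.
intros Hp Hpsi Hv HS HF Hle.
assert (dS : forall th, 0 < th < PI ->
  DeriveC Sf th = (RtoC (c * (1 + psi th ^ 2)) * v 1%nat (psi th))%C).
{ intros th Hth; apply DeriveC_unique.
  apply (is_deriveC_ext_loc (fun th => v 0%nat (psi th))).
  - generalize (open_between 0 PI th Hth); apply filter_imp; intros y Hy.
    symmetry; now apply HS.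
  - apply is_deriveC_comp; [apply Hv|apply Hpsi; now left]. }
set (phi := fun th => Delta_th a k th * sin th *
  (2 * dotC (v 0%nat (psi th)) (RtoC (c * (1 + psi th ^ 2)) * v 1%nat (psi th)))).
assert (Hc : continuous phi p).
{ apply (ex_derive_continuous (V := R_NormedModule)).
  assert (Dp := Hpsi p (or_intror eq_refl)).
  assert (D2 : ex_derive (fun th => c * (1 + psi th ^ 2)) p).
  { apply ex_derive_scal; apply (ex_derive_plus (V := R_NormedModule)).
    - auto_derive; auto.
    - apply ex_derive_pow; eexists; exact Dp. }
  destruct D2 as [l2 D2].
  apply ex_derive_mult; [eexists; apply is_derive_sinDth|].
  apply ex_derive_scal; eexists; apply is_derive_dotC.
  - apply is_deriveC_comp; [apply Hv|exact Dp].
  - apply is_deriveC_mult; [apply is_deriveC_RtoC; exact D2|].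
    apply is_deriveC_comp; [apply Hv|exact Dp]. }
replace (locally 0) with (locally (phi p))
  by (unfold phi; rewrite Hp, Rmult_0_r, Rmult_0_l; reflexivity).
apply (filterlim_ext_loc phi).
- revert HF; apply filter_imp; intros th Hth; unfold phi, angular_flux.
  rewrite (HS th Hth), (dS th Hth); reflexivity.
- intros P HP; apply Hle; now apply Hc.
Qed.

Lemma is_derive_tan_half th :
  0 <= th < PI ->
  is_derive (fun th => tan (th / 2)) th (/ 2 * (1 + tan (th / 2) ^ 2)).
Proof.
intros Hth; assert (0 < cos (th / 2)) by (apply cos_gt_0; lra).
unfold tan; auto_derive; [lra|].
unfold Rdiv; generalize (sin2_cos2 (th * / 2)); unfold Rsqr; intros E.
unfold Rdiv in H; set (x := th * / 2) in *.
field_simplify_eq; [|lra]; ring.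
Qed.

(** Written as [cos / sin] so that the formula extends through [th = PI], where [tan (th / 2)] is
    singular. *)
Lemma is_derive_cot_half th :
  0 < th <= PI ->
  is_derive (fun th => cos (th / 2) / sin (th / 2)) th
    (- / 2 * (1 + (cos (th / 2) / sin (th / 2)) ^ 2)).
Proof.
intros Hth; assert (0 < sin (th / 2)) by (apply sin_gt_0; generalize PI_RGT_0; lra).
auto_derive; [lra|].
unfold Rdiv; unfold Rdiv in H; set (x := th * / 2) in *.
field_simplify_eq; [|lra]; ring.
Qed.

(** Along the meridian [ph = 0] the spin-weight factors are 1, so each chart presents the profile as
    a function of its stereographic coordinate that is smooth on the whole line, pole included. *)
Definition regular_at_poles (Sf : R -> C) : Prop :=
  exists v w : nat -> R -> C,
    (forall n y, is_deriveC (v n) y (v (S n) y)) /\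
    (forall n y, is_deriveC (w n) y (w (S n) y)) /\
    (forall th, 0 < th < PI -> Sf th = v 0%nat (tan (th / 2))) /\
    (forall th, 0 < th < PI -> Sf th = w 0%nat (/ tan (th / 2))).

Lemma regular_at_poles_smooth Sf :
  regular_at_poles Sf -> smoothC (fun th => 0 < th < PI) Sf.
Proof.
intros [v [_ [Hv [_ [E _]]]]].
apply (smoothC_ext _ (open_between 0 PI) (fun th => v 0%nat (tan (th / 2)))).
{ intros th Hth; symmetry; now apply E. }
apply (smoothC_comp _ (open_between 0 PI) v (fun th => tan (th / 2))
         (fun th => / 2 * (1 + tan (th / 2) ^ 2))).
- intros th Hth; apply is_derive_tan_half; lra.
(* The derivative of [y = tan (th / 2)] is the polynomial [(1 + y^2) / 2] in [y], so smoothness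
   bootstraps. *)
- assert (T : smoothC (fun th => 0 < th < PI) (fun th => RtoC (tan (th / 2)))).
  { intros n; induction n as [|n IH]; [easy|].
    apply (diffn_intro _ (open_between 0 PI) n _ (fun th =>
      RtoC (/ 2) * (RtoC 1 + RtoC (tan (th / 2)) * RtoC (tan (th / 2))))%C).
    - intros th Hth; rewrite <- RtoC_mult, <- RtoC_plus, <- RtoC_mult.
      apply is_deriveC_RtoC; apply (is_derive_eq _ _ _ _ (is_derive_tan_half th ltac:(lra))).
      ring.
    - apply diffn_mult; [apply open_between|apply diffn_const, open_between|].
      apply diffn_plus; [apply open_between|apply diffn_const, open_between|].
      apply diffn_mult; [apply open_between|exact IH|exact IH]. }
  apply (smoothC_ext _ (open_between 0 PI) (fun th =>
      RtoC (/ 2) * (RtoC 1 + RtoC (tan (th / 2)) * RtoC (tan (th / 2))))%C).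
  + intros th _; rewrite <- RtoC_mult, <- RtoC_plus, <- RtoC_mult; f_equal; ring.
  + apply smoothC_mult; [apply open_between|apply smoothC_const, open_between|].
    apply smoothC_plus; [apply open_between|apply smoothC_const, open_between|].
    apply smoothC_mult; [apply open_between|exact T|exact T].
- intros n th _; apply Hv.
Qed.

(** If [Re lam] were below the potential, the flux would be increasing while
    vanishing at both poles. *)
Lemma angular_eigenvalue_bound a k rp m Sf lam :
  0 <= a -> 0 < k -> a * k < 1 -> 0 < rp ->
  0 <= mu a k rp * m ^ 2 - 16 * Rabs m ->
  regular_at_poles Sf ->
  (forall th, 0 < th < PI ->
     angular_op a k m (m * omega_plus a rp) Sf th = (- lam * Sf th)%C) ->
  (exists th, 0 < th < PI /\ Sf th <> 0%C) ->
  mu a k rp * m ^ 2 - 16 * Rabs m <= Re lam.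
Proof.
intros Ha Hk Hak Hp Hm Hreg Hode [th0 [Hth0 HS0]].
assert (HS := regular_at_poles_smooth Sf Hreg).
destruct Hreg as [v [w [Hv [Hw [Ev Ew]]]]].
apply Rnot_lt_le; intros Hlt.
set (P := angular_potential a k m (m * omega_plus a rp)) in *.
(* The derivative of [angular_flux] after the second derivative of [Sf] has been eliminated by the
   equation; the weight [Delta_th * sin th] makes the first-order terms cancel. *)
set (f' := fun th => 2 * sin th * (Delta_th a k th * normsq (DeriveC Sf th)
                       + (P th - Re lam) * normsq (Sf th))).
assert (HP : forall th, 0 < th < PI -> 0 < P th - Re lam).
{ intros th Hth.
  assert (H := angular_potential_lower_bound a k rp m th Ha Hk Hak Hp Hth Hm).
  fold P in H; lra. }
assert (Hpi := PI_RGT_0).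
assert (Hf : forall th, 0 < th < PI -> f' th = 0).
{ apply (monotone_vanishing_ends (angular_flux a k Sf)).
  - intros th Hth.
    assert (Hs : 0 < sin th) by (apply sin_gt_0; apply Hth).
    assert (D1 := HS 1%nat); assert (D2 := HS 2%nat).
    apply (is_derive_eq _ _ _ _ (Derive.is_derive_mult _ _ _ _ _
      (is_derive_sinDth a k th) (is_derive_scal _ _ 2 _
        (is_derive_dotC _ _ _ _ _ (proj1 D1 th Hth) (proj1 (proj2 D2) th Hth))))).
    assert (E := f_equal (dotC (Sf th)) (Hode th Hth)); unfold angular_op in E.
    replace (_ - _)%C with
      (RtoC (Delta_th a k th) * DeriveC (DeriveC Sf) th
       + RtoC (dsinDth a k th / sin th) * DeriveC Sf th
       + RtoC (- P th) * Sf th)%C in E by (unfold P; rewrite RtoC_opp; ring).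
    rewrite !dotC_plus_r, !dotC_scal_r, dotC_mult_self, dotC_self in E.
    rewrite dotC_self; unfold f'.
    replace (Re (- lam)) with (- Re lam) in E by reflexivity.
    assert (E' : Delta_th a k th * dotC (Sf th) (DeriveC (DeriveC Sf) th)
      = (P th - Re lam) * normsq (Sf th)
        - dsinDth a k th / sin th * dotC (Sf th) (DeriveC Sf th)) by lra.
    transitivity (2 * dsinDth a k th * dotC (Sf th) (DeriveC Sf th)
      + 2 * sin th * (Delta_th a k th * normsq (DeriveC Sf th)
         + Delta_th a k th * dotC (Sf th) (DeriveC (DeriveC Sf) th))).
    { ring. }
    rewrite E'; field; lra.
  - intros th Hth; unfold f'.
    assert (Hs : 0 < sin th) by (apply sin_gt_0; apply Hth).
    assert (HD := Delta_th_pos a k th Ha Hk Hak).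
    assert (N1 := normsq_ge_0 (Sf th)); assert (N2 := normsq_ge_0 (DeriveC Sf th)).
    assert (Hq := HP th Hth).
    apply Rmult_le_pos; [lra|].
    apply Rplus_le_le_0_compat; apply Rmult_le_pos; lra.
  - apply (angular_flux_pole a k Sf v (fun th => tan (th / 2)) (/ 2) 0 (at_right 0)).
    + apply sin_0.
    + intros th Hth; apply is_derive_tan_half; lra.
    + exact Hv.
    + exact Ev.
    + now apply at_right_between.
    + intros Q HQ; now apply filter_le_within.
  - apply (angular_flux_pole a k Sf w (fun th => cos (th / 2) / sin (th / 2)) (- / 2)
             PI (at_left PI)).
    + apply sin_PI.
    + intros th Hth; apply is_derive_cot_half; lra.
    + exact Hw.
    + intros th Hth; rewrite (Ew th Hth); f_equal; unfold tan.
      rewrite Rinv_div; reflexivity.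
    + now apply at_left_between.
    + intros Q HQ; now apply filter_le_within. }
assert (E := Hf th0 Hth0); unfold f' in E.
assert (Hs : 0 < sin th0) by (apply sin_gt_0; apply Hth0).
assert (HD := Delta_th_pos a k th0 Ha Hk Hak).
assert (N1 := normsq_ge_0 (DeriveC Sf th0)).
assert (Hq := HP th0 Hth0).
assert (N0 : 0 < normsq (Sf th0)).
{ destruct (normsq_ge_0 (Sf th0)) as [H|H]; [easy|].
  symmetry in H; apply normsq_eq_0 in H; now elim HS0. }
assert (0 < (P th0 - Re lam) * normsq (Sf th0)) by (apply Rmult_lt_0_compat; lra).
assert (0 <= Delta_th a k th0 * normsq (DeriveC Sf th0)) by (apply Rmult_le_pos; lra).
assert (0 < 2 * sin th0 * (Delta_th a k th0 * normsq (DeriveC Sf th0)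
                       + (P th0 - Re lam) * normsq (Sf th0)))
  by (apply Rmult_lt_0_compat; lra).
lra.
Qed.

(** * The radial equation *)

(** The derivative of [|f|^2] in [rstar]. *)
Definition radial_flux (M a k : R) (f : R -> C) (r : R) : R :=
  Delta M a k r / (r ^ 2 + a ^ 2) * (2 * dotC (f r) (DeriveC f r)).

(** Pairing the equation with [Rf] by [dotC] keeps only the real parts [Q] and [Re lam], and the
    first-order terms cancel against the derivative of [Delta / (r^2 + a^2)]. The hypothesis on
    [Re lam] gives [Q <= Re lam]. *)
Lemma radial_flux_increasing M a k rp m Rf lam Cst r :
  0 < k -> 0 < rp -> Delta M a k rp = 0 -> 0 < dDelta M a k rp ->
  (forall x, rp < x -> - Cst <= radial_potential M a k x) ->
  smoothC (fun x => rp < x) Rf ->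
  (forall x, rp < x -> radial_op M a k m (m * omega_plus a rp) Rf x = (lam * Rf x)%C) ->
  (a / (k * rp ^ 2)) ^ 2 * mu a k rp * m ^ 2 + Cst <= Re lam ->
  rp < r ->
  exists l, is_derive (radial_flux M a k Rf) r l /\ 0 <= l.
Proof.
intros Hk Hp D0 D1 HC HR Hode Hlam Hr.
assert (HDr := Delta_pos M a k rp r Hp D0 D1 Hr).
assert (Hw : 0 < r ^ 2 + a ^ 2) by nra.
assert (dR := proj1 (HR 1%nat) r Hr); assert (dR1 := proj1 (proj2 (HR 2%nat)) r Hr).
set (Q := Xi a k ^ 2 * Kf a m (m * omega_plus a rp) r ^ 2 / Delta M a k r
          - radial_potential M a k r).
assert (HQ : 0 <= Re lam - Q).
{ assert (H1 := K_bound M a k rp m r Hk Hp D0 D1 Hr).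
  assert (H2 := HC r Hr); unfold Q; lra. }
exists (2 * (Delta M a k r * normsq (DeriveC Rf r) + (Re lam - Q) * normsq (Rf r))
        / (r ^ 2 + a ^ 2)); split.
- assert (dw : is_derive (fun r => Delta M a k r / (r ^ 2 + a ^ 2)) r
     ((dDelta M a k r * (r ^ 2 + a ^ 2) - Delta M a k r * (2 * r)) / (r ^ 2 + a ^ 2) ^ 2)).
  { apply (is_derive_div (Delta M a k) (fun r => r ^ 2 + a ^ 2)); [apply is_derive_Delta| |lra].
    auto_derive; [auto|ring]. }
  apply (is_derive_eq _ _ _ _ (Derive.is_derive_mult _ _ _ _ _ dw
      (is_derive_scal _ _ 2 _ (is_derive_dotC _ _ _ _ _ dR dR1)))).
  assert (E := f_equal (dotC (Rf r)) (Hode r Hr)); unfold radial_op in E.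
  fold Q in E.
  set (q := Xi a k * (2 * dDelta M a k r * Kf a m (m * omega_plus a rp) r / Delta M a k r
                             + 8 * r * (m * omega_plus a rp))) in E.
  rewrite !dotC_plus_r, !dotC_scal_r, !dotC_mult_self in E.
  replace (Re (Q + Ci * q)) with Q in E by (simpl; ring).
  rewrite dotC_self.
  assert (E' : Delta M a k r * dotC (Rf r) (DeriveC (DeriveC Rf) r)
     = (Re lam - Q) * normsq (Rf r)
       - (dDelta M a k r - 2 * r * Delta M a k r / (r ^ 2 + a ^ 2))
         * dotC (Rf r) (DeriveC Rf r)) by lra.
  transitivity ((2 * (dDelta M a k r - 2 * r * Delta M a k r / (r ^ 2 + a ^ 2))
         * dotC (Rf r) (DeriveC Rf r)
     + 2 * Delta M a k r * normsq (DeriveC Rf r)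
     + 2 * (Delta M a k r * dotC (Rf r) (DeriveC (DeriveC Rf) r))) / (r ^ 2 + a ^ 2)).
  { field; lra. }
  rewrite E'; field; lra.
- assert (N1 := normsq_ge_0 (Rf r)); assert (N2 := normsq_ge_0 (DeriveC Rf r)).
  apply Rmult_le_pos; [|apply Rlt_le, Rinv_0_lt_compat, Hw].
  apply Rmult_le_pos; [lra|].
  apply Rplus_le_le_0_compat; apply Rmult_le_pos; lra.
Qed.

(** * Decay at the horizon *)

Definition bounded_right (p : R) (f : R -> C) : Prop :=
  exists B eps, 0 < eps /\ forall r, p < r < p + eps -> Cmod (f r) <= B.
Definition linear_right (p : R) (f : R -> C) : Prop :=
  exists B eps, 0 < eps /\ forall r, p < r < p + eps -> Cmod (f r) <= B * (r - p).

Lemma linear_right_plus p f g :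
  linear_right p f -> linear_right p g -> linear_right p (fun r => f r + g r)%C.
Proof.
intros [B [e [He Hf]]] [B' [e' [He' Hg]]].
exists (B + B'), (Rmin e e'); split; [now apply Rmin_glb_lt|]; intros r Hr.
assert (H1 := Rmin_l e e'); assert (H2 := Rmin_r e e').
apply (Rle_trans _ _ _ (Cmod_triangle _ _)).
assert (H3 := Hf r ltac:(lra)); assert (H4 := Hg r ltac:(lra)); lra.
Qed.

Lemma linear_right_mult p f g :
  linear_right p f -> bounded_right p g -> linear_right p (fun r => f r * g r)%C.
Proof.
intros [B [e [He Hf]]] [B' [e' [He' Hg]]].
exists (B * B'), (Rmin e e'); split; [now apply Rmin_glb_lt|]; intros r Hr.
assert (H1 := Rmin_l e e'); assert (H2 := Rmin_r e e').
rewrite Cmod_mult.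
assert (H3 := Hf r ltac:(lra)); assert (H4 := Hg r ltac:(lra)).
replace (B * B' * (r - p)) with (B * (r - p) * B') by ring.
apply Rmult_le_compat; try apply Cmod_ge_0; easy.
Qed.

Lemma linear_right_ext p f g :
  (forall r, p < r -> f r = g r) -> linear_right p f -> linear_right p g.
Proof.
intros E [B [e [He H]]]; exists B, e; split; [easy|]; intros r Hr.
rewrite <- E; [now apply H|lra].
Qed.

Lemma Cmod_Ci : Cmod Ci = 1.
Proof.
unfold Cmod, Ci; simpl; transitivity (sqrt 1); [f_equal; ring|apply sqrt_1].
Qed.

Lemma is_deriveC_bounds p f l :
  is_deriveC f p l ->
  exists B eps, 0 < eps /\
    forall r, p < r < p + eps -> Cmod (f r - f p) <= B * (r - p).
Proof.
intros [H1 H2].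
assert (K : forall g l, is_derive g p l -> exists B eps, 0 < eps /\
    forall r, p < r < p + eps -> Rabs (g r - g p) <= B * (r - p)).
{ intros g lg Hg; apply is_derive_Reals in Hg.
  destruct (Hg 1 Rlt_0_1) as [d Hd]; exists (Rabs lg + 1), d; split; [apply d|].
  intros r Hr; assert (H := Hd (r - p) ltac:(lra) ltac:(rewrite Rabs_pos_eq; lra)).
  replace (p + (r - p)) with r in H by ring.
  replace (g r - g p) with ((((g r - g p) / (r - p) - lg) + lg) * (r - p)) by (field; lra).
  rewrite Rabs_mult, (Rabs_pos_eq (r - p)) by lra.
  apply Rmult_le_compat_r; [lra|].
  apply (Rle_trans _ _ _ (Rabs_triang _ _)); lra. }
destruct (K _ _ H1) as [B [e [He Hf]]]; destruct (K _ _ H2) as [B' [e' [He' Hg]]].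
exists (B + B'), (Rmin e e'); split; [now apply Rmin_glb_lt|]; intros r Hr.
assert (H3 := Hf r ltac:(generalize (Rmin_l e e'); lra)).
assert (H4 := Hg r ltac:(generalize (Rmin_r e e'); lra)).
replace (f r - f p)%C with (RtoC (Re (f r) - Re (f p)) + Ci * RtoC (Im (f r) - Im (f p)))%C
  by (apply C_ext; simpl; unfold Re, Im; ring).
apply (Rle_trans _ _ _ (Cmod_triangle _ _)); rewrite Cmod_mult, !Cmod_R.
rewrite Cmod_Ci.
lra.
Qed.

Lemma is_deriveC_bounded_right p f l : is_deriveC f p l -> bounded_right p f.
Proof.
intros H; destruct (is_deriveC_bounds p f l H) as [B [e [He Hf]]].
exists (Cmod (f p) + Rabs B * e), e; split; [easy|]; intros r Hr.
replace (f r) with (f p + (f r - f p))%C by ring.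
apply (Rle_trans _ _ _ (Cmod_triangle _ _)).
assert (H3 := Hf r Hr); assert (H4 := Rle_abs B); assert (H5 := Rabs_pos B).
assert (B * (r - p) <= Rabs B * e); [|lra].
apply (Rle_trans _ (Rabs B * (r - p))); [apply Rmult_le_compat_r|apply Rmult_le_compat_l];
  lra.
Qed.

Lemma is_deriveC_linear_right p f l :
  is_deriveC f p l -> f p = 0%C -> linear_right p f.
Proof.
intros H E; destruct (is_deriveC_bounds p f l H) as [B [e [He Hf]]].
exists B, e; split; [easy|]; intros r Hr.
replace (f r) with (f r - f p)%C by (rewrite E; ring); now apply Hf.
Qed.

Lemma linear_right_cancel p f g l :
  is_deriveC f p l -> f p <> 0%C -> linear_right p (fun r => f r * g r)%C ->
  linear_right p g.
Proof.
intros H E [B [e [He Hfg]]].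
destruct (is_deriveC_bounds p f l H) as [B' [e' [He' Hf]]].
assert (Hc : 0 < Cmod (f p)) by now apply Cmod_gt_0.
(* Within distance [d] the function [f] varies by at most half of [Cmod (f p)]; the [+ 1] keeps the
   denominator positive when [B'] is zero. *)
set (d := Cmod (f p) / (2 * (Rabs B' + 1))).
assert (HB := Rabs_pos B'); assert (HB2 := Rle_abs B').
assert (Hd : 0 < d) by (apply Rdiv_lt_0_compat; lra).
exists (2 * B / Cmod (f p)), (Rmin e (Rmin e' d)); split.
{ repeat apply Rmin_glb_lt; easy. }
intros r Hr.
assert (H1 := Rmin_l e (Rmin e' d)); assert (H2 := Rmin_r e (Rmin e' d)).
assert (H3 := Rmin_l e' d); assert (H4 := Rmin_r e' d).
assert (H5 := Hfg r ltac:(lra)); assert (H6 := Hf r ltac:(lra)).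
rewrite Cmod_mult in H5.
assert (H7 : Cmod (f p) / 2 <= Cmod (f r)).
{ assert (T := Cmod_triangle (f r) (f p - f r)).
  replace (f r + (f p - f r))%C with (f p) in T by ring.
  replace (Cmod (f p - f r)) with (Cmod (f r - f p)) in T
    by (rewrite <- Cmod_opp; f_equal; ring).
  assert (B' * (r - p) <= Cmod (f p) / 2); [|lra].
  apply (Rle_trans _ ((Rabs B' + 1) * d)).
  - apply (Rle_trans _ ((Rabs B' + 1) * (r - p)));
      [apply Rmult_le_compat_r|apply Rmult_le_compat_l]; lra.
  - unfold d; right; field; lra. }
replace (2 * B / Cmod (f p) * (r - p)) with (B * (r - p) / (Cmod (f p) / 2))
  by (field; lra).
apply -> (Rle_div_r (Cmod (g r)) (B * (r - p)) (Cmod (f p) / 2)); [|lra].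
assert (0 <= Cmod (g r)) by apply Cmod_ge_0; nra.
Qed.

Lemma filterlim_right_0 p f B eps :
  0 < eps -> (forall r, p < r < p + eps -> 0 <= f r <= B * (r - p)) ->
  filterlim f (at_right p) (locally 0).
Proof.
intros He H.
apply (filterlim_le_le (fun _ => 0) f (fun r => B * (r - p)) 0).
- generalize (at_right_between p (p + eps) ltac:(lra)); apply filter_imp; exact H.
- apply filterlim_const.
- intros P HP; apply filter_le_within; revert P HP.
  change (filterlim (fun r => B * (r - p)) (locally p) (locally 0)).
  replace (locally 0) with (locally (B * (p - p))) by (f_equal; ring).
  apply (ex_derive_continuous (V := R_NormedModule) (fun r => B * (r - p))).
  auto_derive; auto.
Qed.

(** * Smoothness of the real coefficients *)

Definition smoothR (U : R -> Prop) (f : R -> R) : Prop :=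
  smoothC U (fun x => RtoC (f x)).

Section SmoothReal.
Variable U : R -> Prop.
Hypothesis U_open : forall x, U x -> locally x U.

Lemma smoothR_const c : smoothR U (fun _ => c).
Proof. exact (smoothC_const U U_open (RtoC c)). Qed.

Lemma smoothR_plus f g :
  smoothR U f -> smoothR U g -> smoothR U (fun x => f x + g x).
Proof.
intros Hf Hg; apply (smoothC_ext _ U_open (fun x => RtoC (f x) + RtoC (g x))%C).
- intros x _; now rewrite RtoC_plus.
- now apply smoothC_plus.
Qed.

Lemma smoothR_mult f g :
  smoothR U f -> smoothR U g -> smoothR U (fun x => f x * g x).
Proof.
intros Hf Hg; apply (smoothC_ext _ U_open (fun x => RtoC (f x) * RtoC (g x))%C).
- intros x _; now rewrite RtoC_mult.
- now apply smoothC_mult.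
Qed.

Lemma smoothR_opp f : smoothR U f -> smoothR U (fun x => - f x).
Proof.
intros Hf; apply (smoothC_ext _ U_open (fun x => RtoC (-1) * RtoC (f x))%C).
- intros x _; rewrite <- RtoC_mult; f_equal; ring.
- apply smoothC_mult; [easy|exact (smoothC_const U U_open (RtoC (-1)))|exact Hf].
Qed.

Lemma smoothR_minus f g :
  smoothR U f -> smoothR U g -> smoothR U (fun x => f x - g x).
Proof. intros Hf Hg; apply smoothR_plus; [easy|now apply smoothR_opp]. Qed.

Lemma smoothR_id : smoothR U (fun x => x).
Proof. exact (smoothC_RtoC_id U U_open). Qed.

Lemma smoothR_pow f n : smoothR U f -> smoothR U (fun x => f x ^ n).
Proof.
intros Hf; induction n as [|n IH]; simpl; [apply smoothR_const|].
now apply smoothR_mult.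
Qed.

Lemma smoothR_inv f f' :
  (forall x, U x -> f x <> 0) -> (forall x, U x -> is_derive f x (f' x)) ->
  smoothR U f' -> smoothR U (fun x => / f x).
Proof. intros; now apply (smoothC_Rinv U U_open f f'). Qed.

End SmoothReal.

(** Quotients become products with inverses; the smoothness of each inverse must already be in the
    context, where [assumption] finds it. *)
Ltac smooth_real :=
  unfold Rdiv;
  repeat first
    [ assumption
    | apply smoothR_const; assumption
    | apply smoothR_id; assumption
    | apply smoothR_plus; [assumption| |]
    | apply smoothR_minus; [assumption| |]
    | apply smoothR_mult; [assumption| |]
    | apply smoothR_opp; [assumption|]
    | apply smoothR_pow; [assumption|] ].

(** * The radial equation in terms of derivatives regular at the horizon *)

(** The vector field [Delta^-1 Lbar] acting on the radial profile of a
    stationary mode. *)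
Definition horizon_step (M a k m om : R) (f : R -> C) (r : R) : C :=
  (RtoC (/ Delta M a k r) *
   (Ci * RtoC (Xi a k * Kf a m om r / (r ^ 2 + a ^ 2)) * f r
    + RtoC (- (Delta M a k r / (r ^ 2 + a ^ 2))) * DeriveC f r))%C.

(** The starting point [Delta * f] is the quantity whose derivatives are bounded for spin +2. *)
Definition horizon_jet (M a k m om : R) (f : R -> C) (q : nat) : R -> C :=
  Nat.iter q (horizon_step M a k m om) (fun r => RtoC (Delta M a k r) * f r)%C.

(** The left-hand side is [Delta] times the radial equation, once the jets of order 0, 1 and 2 are
    written through [R0], [R1], [R2]. In this form no coefficient is singular at the horizon. *)
Lemma horizon_equation_algebra (R0 R1 R2 lam : C)
    (D D1 D2 w r a m k X K om : R) :
  D <> 0 -> w <> 0 -> K = a * m - w * om ->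
  (RtoC D * R2 + RtoC (D1 - 2 * r * D / w) * R1
   + (RtoC (X ^ 2 * K ^ 2 / D - (D1 ^ 2 / D - D2 + D1 * r / w
        + D * (1 / w - 3 * r ^ 2 / w ^ 2) - 6 * k ^ 2 * r ^ 2))
      + Ci * RtoC (X * (2 * D1 * K / D + 8 * r * om))) * R0 = lam * R0)%C ->
  (RtoC (D * w ^ 2) * (RtoC (/ D) * (Ci * RtoC (X * K / w) *
      ((Ci * RtoC (X * K / w) + RtoC (- (D1 / w))) * R0 + RtoC (- (D / w)) * R1)
     + RtoC (- (D / w)) *
      ((Ci * RtoC (X * (- 2 * r * om) / w - 2 * r * X * K / w ^ 2)
        + RtoC (- (D2 / w) + 2 * r * D1 / w ^ 2)) * R0
       + (Ci * RtoC (X * K / w) + RtoC (- (D1 / w))) * R1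
       + RtoC (- (D1 / w) + 2 * r * D / w ^ 2) * R1
       + RtoC (- (D / w)) * R2)))
   + (RtoC (w * D1) + Ci * RtoC (- (2 * X * w * K))) *
      ((Ci * RtoC (X * K / w) + RtoC (- (D1 / w))) * R0 + RtoC (- (D / w)) * R1)
   + (RtoC (D * (3 * r ^ 2 / w ^ 2 - 1 / w) + D1 * r / w + 6 * k ^ 2 * r ^ 2)
      + Ci * RtoC (X * (8 * r * om - 2 * r * (a * m) / w)) - lam) * (RtoC D * R0))%C
  = 0%C.
Proof.
intros HD Hw HK E.
transitivity (RtoC D * ((RtoC D * R2 + RtoC (D1 - 2 * r * D / w) * R1
   + (RtoC (X ^ 2 * K ^ 2 / D - (D1 ^ 2 / D - D2 + D1 * r / w
        + D * (1 / w - 3 * r ^ 2 / w ^ 2) - 6 * k ^ 2 * r ^ 2))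
      + Ci * RtoC (X * (2 * D1 * K / D + 8 * r * om))) * R0) - lam * R0))%C;
  [|rewrite E; ring].
transitivity (
  RtoC (D * w ^ 2 * / D * (- (D / w)) * (- (D / w))) * R2
  + RtoC (D * w ^ 2 * / D * (- (D / w)) * (- (D1 / w) + (- (D1 / w) + 2 * r * D / w ^ 2))
          + w * D1 * (- (D / w))) * R1
  + Ci * RtoC (D * w ^ 2 * / D * (X * K / w * (- (D / w)) + (- (D / w)) * (X * K / w))
          + (- (2 * X * w * K)) * (- (D / w))) * R1
  + RtoC (D * w ^ 2 * / D * (- (X * K / w * (X * K / w))
             + - (D / w) * (- (D2 / w) + 2 * r * D1 / w ^ 2))
          + w * D1 * (- (D1 / w)) - - (2 * X * w * K) * (X * K / w)
          + (D * (3 * r ^ 2 / w ^ 2 - 1 / w) + D1 * r / w + 6 * k ^ 2 * r ^ 2) * D) * R0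
  + Ci * RtoC (D * w ^ 2 * / D * (X * K / w * (- (D1 / w))
             + - (D / w) * (X * (- 2 * r * om) / w - 2 * r * X * K / w ^ 2))
          + w * D1 * (X * K / w) + - (2 * X * w * K) * (- (D1 / w))
          + X * (8 * r * om - 2 * r * (a * m) / w) * D) * R0
  - lam * (RtoC D * R0))%C.
(* Collecting terms is again a division-free identity in opaque coefficients; [field] is then used
   on real coefficients only. *)
- generalize (/ D) (- (D / w)) (X * K / w) (- (D1 / w)) (w * D1) (- (2 * X * w * K))
   (X * (- 2 * r * om) / w - 2 * r * X * K / w ^ 2)
   (- (D2 / w) + 2 * r * D1 / w ^ 2) (2 * r * D / w ^ 2)
   (D * (3 * r ^ 2 / w ^ 2 - 1 / w) + D1 * r / w + 6 * k ^ 2 * r ^ 2)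
   (X * (8 * r * om - 2 * r * (a * m) / w)) (D * w ^ 2).
  clear; intros.
  repeat (rewrite ?RtoC_minus, ?RtoC_plus, ?RtoC_opp, ?RtoC_mult).
  ring [Ci_sq].
- transitivity (
  RtoC (D * D) * R2 + RtoC (D * (D1 - 2 * r * D / w)) * R1 + Ci * RtoC 0 * R1
  + RtoC (D * (X ^ 2 * K ^ 2 / D - (D1 ^ 2 / D - D2 + D1 * r / w
        + D * (1 / w - 3 * r ^ 2 / w ^ 2) - 6 * k ^ 2 * r ^ 2))) * R0
  + Ci * RtoC (D * (X * (2 * D1 * K / D + 8 * r * om))) * R0
  - lam * (RtoC D * R0))%C; [|rewrite !(RtoC_mult D); ring].
  repeat apply (f_equal2 Cplus); try reflexivity;
    apply (f_equal2 Cmult); try reflexivity;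
    try apply (f_equal (Cmult Ci)); apply f_equal; try (subst K; field; auto).
Qed.

Lemma horizon_step_smooth M a k m om rp f :
  0 < rp -> Delta M a k rp = 0 -> 0 < dDelta M a k rp ->
  smoothC (fun r => rp < r) f ->
  smoothC (fun r => rp < r) (horizon_step M a k m om f).
Proof.
intros Hp D0 D1 Hf; assert (Hop := open_gt rp).
set (U := fun r => rp < r) in *.
assert (iw : smoothR U (fun r => / (r ^ 2 + a ^ 2))).
{ apply (smoothR_inv U Hop _ (fun r => 2 * r)).
  - intros x Hx; unfold U in Hx; nra.
  - intros x Hx; auto_derive; [auto|ring].
  - smooth_real. }
assert (sD : smoothR U (Delta M a k)) by (unfold Delta; smooth_real).
assert (iD : smoothR U (fun r => / Delta M a k r)).
{ apply (smoothR_inv U Hop _ (dDelta M a k)).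
  - intros x Hx; apply Rgt_not_eq; now apply (Delta_pos M a k rp).
  - intros x Hx; apply is_derive_Delta.
  - unfold dDelta; smooth_real. }
assert (sK : smoothR U (fun r => Xi a k * Kf a m om r / (r ^ 2 + a ^ 2)))
  by (unfold Kf; smooth_real).
assert (sDw : smoothR U (fun r => - (Delta M a k r / (r ^ 2 + a ^ 2)))) by smooth_real.
unfold horizon_step.
apply smoothC_mult; [easy|exact iD|]; apply smoothC_plus; [easy| |].
- apply smoothC_mult; [easy| |exact Hf].
  apply smoothC_mult; [easy|now apply smoothC_const|exact sK].
- apply smoothC_mult; [easy|exact sDw|now apply smoothC_DeriveC].
Qed.

Lemma horizon_jet_smooth M a k m om rp f q :
  0 < rp -> Delta M a k rp = 0 -> 0 < dDelta M a k rp ->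
  smoothC (fun r => rp < r) f ->
  smoothC (fun r => rp < r) (horizon_jet M a k m om f q).
Proof.
intros Hp D0 D1 Hf; unfold horizon_jet; induction q as [|q IH]; simpl.
- apply smoothC_mult; [apply open_gt| |exact Hf].
  assert (Hop := open_gt rp); change (smoothR (fun r => rp < r) (Delta M a k)).
  unfold Delta; smooth_real.
- now apply (horizon_step_smooth M a k m om rp).
Qed.

(** Solving for the derivative closes the jets under differentiation: each one differentiates into
    itself, with a purely imaginary factor, and the next one. *)
Lemma horizon_step_inv M a k m om f r :
  Delta M a k r <> 0 -> r ^ 2 + a ^ 2 <> 0 ->
  DeriveC f r =
  (Ci * RtoC (Xi a k * Kf a m om r / Delta M a k r) * f r
   + RtoC (- (r ^ 2 + a ^ 2)) * horizon_step M a k m om f r)%C.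
Proof.
intros HD Hw; unfold horizon_step.
generalize (Xi a k * Kf a m om r); intros K.
transitivity (Ci * RtoC (K / Delta M a k r
   + - (r ^ 2 + a ^ 2) * (/ Delta M a k r * (K / (r ^ 2 + a ^ 2)))) * f r
   + RtoC (- (r ^ 2 + a ^ 2) * (/ Delta M a k r * - (Delta M a k r / (r ^ 2 + a ^ 2))))
     * DeriveC f r)%C.
- replace (- (r ^ 2 + a ^ 2) * (/ Delta M a k r * - (Delta M a k r / (r ^ 2 + a ^ 2))))
    with 1 by (field; auto).
  replace (K / Delta M a k r
   + - (r ^ 2 + a ^ 2) * (/ Delta M a k r * (K / (r ^ 2 + a ^ 2)))) with 0
    by (field; auto).
  ring.
- generalize (- (r ^ 2 + a ^ 2)) (/ Delta M a k r) (K / (r ^ 2 + a ^ 2))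
    (- (Delta M a k r / (r ^ 2 + a ^ 2))) (K / Delta M a k r).
  intros; repeat (rewrite ?RtoC_plus, ?RtoC_mult); ring.
Qed.

Definition jet_coef1 (M a k m om r : R) : C :=
  (RtoC ((r ^ 2 + a ^ 2) * dDelta M a k r)
   + Ci * RtoC (- (2 * Xi a k * (r ^ 2 + a ^ 2) * Kf a m om r)))%C.

Definition jet_pot (M a k r : R) : R :=
  Delta M a k r * (3 * r ^ 2 / (r ^ 2 + a ^ 2) ^ 2 - 1 / (r ^ 2 + a ^ 2))
  + dDelta M a k r * r / (r ^ 2 + a ^ 2) + 6 * k ^ 2 * r ^ 2.

Definition jet_phase (a k rp r : R) : R :=
  Xi a k * (8 * r * omega_plus a rp - 2 * r * a / (r ^ 2 + a ^ 2)).

(** The dependence on [m] and [lam] is displayed so that the horizon values of [jet_pot],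
    [jet_phase] and their derivatives are constants independent of the mode. *)
Definition jet_coef0 (M a k rp m : R) (lam : C) (r : R) : C :=
  (RtoC (jet_pot M a k r) + Ci * RtoC (m * jet_phase a k rp r) - lam)%C.

(** With bounded jets, the factor [Delta] on the second one turns this into a relation between the
    first two up to O(r - rp). *)
Lemma horizon_jet_equation M a k m rp f lam r :
  0 < rp -> Delta M a k rp = 0 -> 0 < dDelta M a k rp ->
  smoothC (fun r => rp < r) f ->
  (forall r, rp < r -> radial_op M a k m (m * omega_plus a rp) f r = (lam * f r)%C) ->
  rp < r ->
  (RtoC (Delta M a k r * (r ^ 2 + a ^ 2) ^ 2)
     * horizon_jet M a k m (m * omega_plus a rp) f 2 r
   + jet_coef1 M a k m (m * omega_plus a rp) r
     * horizon_jet M a k m (m * omega_plus a rp) f 1 r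
   + jet_coef0 M a k rp m lam r * horizon_jet M a k m (m * omega_plus a rp) f 0 r)%C
  = 0%C.
Proof.
intros Hp D0 D1 Hf Hode Hr; set (om := m * omega_plus a rp) in *.
assert (dR := proj1 (Hf 1%nat)); assert (dR1 := proj1 (proj2 (Hf 2%nat))).
assert (HDp := fun x => Delta_pos M a k rp x Hp D0 D1).
assert (Hwp : forall x, rp < x -> 0 < x ^ 2 + a ^ 2) by (intros; nra).
(* The first jet with [/ Delta] cancelled, in a form that can be differentiated directly. *)
set (Y1 := fun r => ((Ci * RtoC (Xi a k * Kf a m om r / (r ^ 2 + a ^ 2))
   + RtoC (- (dDelta M a k r / (r ^ 2 + a ^ 2)))) * f r
   + RtoC (- (Delta M a k r / (r ^ 2 + a ^ 2))) * DeriveC f r)%C).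
assert (E1 : forall x, rp < x -> Y1 x = horizon_jet M a k m om f 1 x).
{ intros x Hx; assert (HD := HDp x Hx); assert (Hw := Hwp x Hx).
  unfold horizon_jet; simpl; unfold horizon_step.
  rewrite (DeriveC_unique _ _ _ (is_deriveC_mult _ _ _ _ _
    (is_deriveC_RtoC _ _ _ (is_derive_Delta M a k x)) (dR x Hx))).
  unfold Y1.
  replace (- (dDelta M a k x / (x ^ 2 + a ^ 2))) with
    (/ Delta M a k x * - (Delta M a k x / (x ^ 2 + a ^ 2)) * dDelta M a k x)
    by (field; lra).
  assert (E : RtoC (/ Delta M a k x) = (/ RtoC (Delta M a k x))%C)
    by (apply RtoC_inv; lra).
  rewrite !RtoC_mult, E; field; apply RtoC_neq_0; lra. }
assert (dY : is_deriveC Y1 r ((Ci * RtoC (Xi a k * (- 2 * r * om) / (r ^ 2 + a ^ 2)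
          - 2 * r * Xi a k * Kf a m om r / (r ^ 2 + a ^ 2) ^ 2)
        + RtoC (- (ddDelta a k r / (r ^ 2 + a ^ 2))
                + 2 * r * dDelta M a k r / (r ^ 2 + a ^ 2) ^ 2)) * f r
       + (Ci * RtoC (Xi a k * Kf a m om r / (r ^ 2 + a ^ 2))
          + RtoC (- (dDelta M a k r / (r ^ 2 + a ^ 2)))) * DeriveC f r
       + RtoC (- (dDelta M a k r / (r ^ 2 + a ^ 2))
               + 2 * r * Delta M a k r / (r ^ 2 + a ^ 2) ^ 2) * DeriveC f r
       + RtoC (- (Delta M a k r / (r ^ 2 + a ^ 2))) * DeriveC (DeriveC f) r)%C).
{ assert (Hw := Hwp r Hr).
  assert (q1 : is_derive (fun r => Xi a k * Kf a m om r / (r ^ 2 + a ^ 2)) r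
    (Xi a k * (- 2 * r * om) / (r ^ 2 + a ^ 2)
          - 2 * r * Xi a k * Kf a m om r / (r ^ 2 + a ^ 2) ^ 2)).
  { unfold Kf; auto_derive; [nra|field; nra]. }
  assert (q2 : is_derive (fun r => - (dDelta M a k r / (r ^ 2 + a ^ 2))) r
    (- (ddDelta a k r / (r ^ 2 + a ^ 2))
                + 2 * r * dDelta M a k r / (r ^ 2 + a ^ 2) ^ 2)).
  { unfold dDelta, ddDelta; auto_derive; [nra|field; nra]. }
  assert (q3 : is_derive (fun r => - (Delta M a k r / (r ^ 2 + a ^ 2))) r
    (- (dDelta M a k r / (r ^ 2 + a ^ 2))
               + 2 * r * Delta M a k r / (r ^ 2 + a ^ 2) ^ 2)).
  { unfold dDelta, Delta; auto_derive; [nra|field; nra]. }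
  apply (is_deriveC_eq _ _ _ _ (is_deriveC_plus _ _ _ _ _
    (is_deriveC_mult _ _ _ _ _
      (is_deriveC_plus _ _ _ _ _
        (is_deriveC_scal Ci _ _ _ (is_deriveC_RtoC _ _ _ q1))
        (is_deriveC_RtoC _ _ _ q2)) (dR r Hr))
    (is_deriveC_mult _ _ _ _ _ (is_deriveC_RtoC _ _ _ q3) (dR1 r Hr)))).
  ring. }
assert (E2 : horizon_jet M a k m om f 2 r = horizon_step M a k m om Y1 r).
{ change (horizon_jet M a k m om f 2) with
    (horizon_step M a k m om (horizon_jet M a k m om f 1)).
  unfold horizon_step at 1; rewrite <- (E1 r Hr).
  rewrite (DeriveC_ext_loc (horizon_jet M a k m om f 1) Y1); [unfold horizon_step; reflexivity|].
  generalize (open_gt rp r Hr); apply filter_imp; intros y Hy; symmetry; now apply E1. }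
rewrite E2, <- (E1 r Hr); unfold horizon_step; rewrite (DeriveC_unique _ _ _ dY).
unfold Y1, jet_coef1, jet_coef0, horizon_jet; simpl Nat.iter.
replace (m * jet_phase a k rp r) with
  (Xi a k * (8 * r * om - 2 * r * (a * m) / (r ^ 2 + a ^ 2)))
  by (unfold jet_phase, om; field; assert (Hw := Hwp r Hr); lra).
apply horizon_equation_algebra.
- apply Rgt_not_eq, HDp, Hr.
- apply Rgt_not_eq, Hwp, Hr.
- unfold Kf; ring.
- exact (Hode r Hr).
Qed.

Lemma horizon_jet_derivative M a k m om f q r :
  Delta M a k r <> 0 -> r ^ 2 + a ^ 2 <> 0 ->
  DeriveC (horizon_jet M a k m om f q) r =
  (Ci * RtoC (Xi a k * Kf a m om r / Delta M a k r) * horizon_jet M a k m om f q r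
   + RtoC (- (r ^ 2 + a ^ 2)) * horizon_jet M a k m om f (S q) r)%C.
Proof. intros HD Hw; now apply horizon_step_inv. Qed.

(** The jet coefficients, unlike the mode, are smooth across the horizon; smoothness on [0 < r]
    makes their derivatives available at [rp] itself. *)
Lemma smoothR_inv_w a : smoothR (fun r => 0 < r) (fun r => / (r ^ 2 + a ^ 2)).
Proof.
assert (Hop := open_gt 0).
apply (smoothR_inv _ Hop _ (fun r => 2 * r)).
- intros x Hx; nra.
- intros x Hx; auto_derive; [auto|ring].
- smooth_real.
Qed.

Lemma jet_coef1_smooth M a k m om : smoothC (fun r => 0 < r) (jet_coef1 M a k m om).
Proof.
assert (Hop := open_gt 0); set (U := fun r => 0 < r) in *.
assert (s1 : smoothR U (fun r => (r ^ 2 + a ^ 2) * dDelta M a k r))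
  by (unfold dDelta; smooth_real).
assert (s2 : smoothR U (fun r => - (2 * Xi a k * (r ^ 2 + a ^ 2) * Kf a m om r)))
  by (unfold Kf; smooth_real).
apply smoothC_plus; [easy|exact s1|].
apply smoothC_mult; [easy|now apply smoothC_const|exact s2].
Qed.

Lemma jet_pot_smooth M a k : smoothR (fun r => 0 < r) (jet_pot M a k).
Proof.
assert (Hop := open_gt 0); assert (iw := smoothR_inv_w a).
assert (iw2 : smoothR (fun r => 0 < r) (fun r => / (r ^ 2 + a ^ 2) ^ 2)).
{ apply (smoothC_ext _ Hop (fun r => RtoC ((/ (r ^ 2 + a ^ 2)) ^ 2))).
  - intros x Hx; f_equal; apply pow_inv.
  - change (smoothR (fun r => 0 < r) (fun r => (/ (r ^ 2 + a ^ 2)) ^ 2)); smooth_real. }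
unfold jet_pot, Delta, dDelta; smooth_real.
Qed.

Lemma jet_phase_smooth a k rp : smoothR (fun r => 0 < r) (jet_phase a k rp).
Proof.
assert (Hop := open_gt 0); assert (iw := smoothR_inv_w a).
unfold jet_phase; smooth_real.
Qed.

Lemma jet_coef0_smooth M a k rp m lam :
  smoothC (fun r => 0 < r) (jet_coef0 M a k rp m lam).
Proof.
assert (Hop := open_gt 0); set (U := fun r => 0 < r) in *.
assert (s1 := jet_pot_smooth M a k); assert (s2 := jet_phase_smooth a k rp).
assert (s3 : smoothR U (fun r => m * jet_phase a k rp r)) by smooth_real.
apply smoothC_plus; [easy| |exact (smoothC_const _ Hop (- lam)%C)].
apply smoothC_plus; [easy|exact s1|].
apply smoothC_mult; [easy|now apply smoothC_const|exact s3].
Qed.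

(** The derivative of [horizon_jet_equation], with the phase [i Xi K / Delta]
    cancelled by [horizon_jet_equation] itself; the right-hand side vanishes at
    the horizon because [Delta] and [K] do. *)
Lemma horizon_jet_equation_derivative M a k m rp f lam r :
  0 < rp -> Delta M a k rp = 0 -> 0 < dDelta M a k rp ->
  smoothC (fun r => rp < r) f ->
  (forall r, rp < r -> radial_op M a k m (m * omega_plus a rp) f r = (lam * f r)%C) ->
  rp < r ->
  let Y := horizon_jet M a k m (m * omega_plus a rp) f in
  let w := r ^ 2 + a ^ 2 in
  ((DeriveC (jet_coef1 M a k m (m * omega_plus a rp)) r
      + RtoC (- w) * jet_coef0 M a k rp m lam r) * Y 1%nat r
    + DeriveC (jet_coef0 M a k rp m lam) r * Y 0%nat r
   = RtoC (Delta M a k r * w ^ 3) * Y 3%nat r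
     + RtoC (- (4 * r * w * Delta M a k r)) * Y 2%nat r
     + Ci * RtoC (- (2 * Xi a k * Kf a m (m * omega_plus a rp) r * w ^ 2))
         * Y 2%nat r)%C.
Proof.
intros Hp D0 D1 Hf Hode Hr Y w; set (om := m * omega_plus a rp) in *.
assert (HD := Delta_pos M a k rp r Hp D0 D1 Hr).
assert (Hw : 0 < w) by (unfold w; nra).
assert (dY : forall q, is_deriveC (Y q) r (DeriveC (Y q) r)).
{ intros q; exact (proj1 (horizon_jet_smooth M a k m om rp f q Hp D0 D1 Hf 1%nat) r Hr). }
assert (d1 := proj1 (jet_coef1_smooth M a k m om 1%nat) r ltac:(lra)).
assert (d0 := proj1 (jet_coef0_smooth M a k rp m lam 1%nat) r ltac:(lra)).
assert (d2 : is_deriveC (fun r => RtoC (Delta M a k r * (r ^ 2 + a ^ 2) ^ 2)) r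
   (RtoC (dDelta M a k r * w ^ 2 + 4 * r * w * Delta M a k r))).
{ apply is_deriveC_RtoC; apply (is_derive_eq _ _ _ _ (Derive.is_derive_mult _ _ _ _ _
    (is_derive_Delta M a k r) (is_derive_pow (fun r => r ^ 2 + a ^ 2) 2 r (2 * r)
      ltac:(auto_derive; [auto|ring])))).
  unfold w; simpl; ring. }
assert (E := horizon_jet_equation M a k m rp f lam r Hp D0 D1 Hf Hode Hr).
fold om Y in E.
assert (L := is_deriveC_plus _ _ _ _ _ (is_deriveC_plus _ _ _ _ _
  (is_deriveC_mult _ _ _ _ _ d2 (dY 2%nat))
  (is_deriveC_mult _ _ _ _ _ d1 (dY 1%nat)))
  (is_deriveC_mult _ _ _ _ _ d0 (dY 0%nat))).
apply (is_deriveC_ext_loc _ (fun _ => 0%C)) in L.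
2:{ generalize (open_gt rp r Hr); apply filter_imp; intros x Hx.
    exact (horizon_jet_equation M a k m rp f lam x Hp D0 D1 Hf Hode Hx). }
apply (is_deriveC_unique _ _ _ _ (is_deriveC_const 0%C r)) in L.
assert (H := fun q => horizon_jet_derivative M a k m om f q r (Rgt_not_eq _ _ HD)
  (Rgt_not_eq _ _ Hw)); fold Y w in H.
rewrite !H in L; clear H dY d1 d0 d2.
set (b1 := DeriveC (jet_coef1 M a k m om) r) in *.
set (b0 := DeriveC (jet_coef0 M a k rp m lam) r) in *.
set (a0 := jet_coef0 M a k rp m lam r) in *.
unfold jet_coef1 in L, E; fold w in L, E.
set (kap := Xi a k * Kf a m om r / Delta M a k r) in *.
assert (Z := f_equal (Cmult (Ci * RtoC kap)) E).
apply (f_equal (fun z => (z - RtoC 0)%C)) in L.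
match type of L with ?x = ?y => assert (L' : (y - Ci * RtoC kap * (RtoC (Delta M a k r * w ^ 2) * Y 2%nat r +
    (RtoC (w * dDelta M a k r) + Ci * RtoC (- (2 * Xi a k * w * Kf a m om r))) *
    Y 1%nat r + a0 * Y 0%nat r) = 0)%C) by (rewrite <- L, Z; ring) end.
clear L E Z.
set (X := Xi a k) in *; set (K := Kf a m om r) in *; set (D := Delta M a k r) in *.
set (D' := dDelta M a k r) in *.
match goal with |- ?x = ?y => assert (G : (x - y = 0)%C) end.
{ rewrite <- L'; clear L'.
  (* Besides the phase, the terms [D' w^2 Y 2] cancel: one comes from differentiating [D w^2], the
     other from [- w] times the real part [w D'] of [jet_coef1]. Every remaining term on the
     right-hand side then carries a factor [D] or [K]. *)
  clearbody b1 b0 a0 kap X K D D' w Y.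
  repeat (rewrite ?RtoC_plus, ?RtoC_opp, ?RtoC_mult, ?RtoC_pow); simpl.
  repeat (rewrite ?RtoC_plus, ?RtoC_opp, ?RtoC_mult, ?RtoC_pow); ring [Ci_sq]. }
match goal with |- ?x = ?y => transitivity (x - y + y)%C; [ring|rewrite G; ring] end.
Qed.

(** Integrating [N' <= C (r - p)^2] from [p] gives the cubic bound; the quadratic bound on [N] only
    serves to exclude a positive boundary value at [p]. The constant [C] is kept in place of
    [C / 3]. *)
Lemma cubic_of_quadratic (N N' : R -> R) (p B C eps : R) :
  0 < eps -> 0 <= B -> 0 <= C ->
  (forall r, p < r < p + eps -> is_derive N r (N' r)) ->
  (forall r, p < r < p + eps -> N' r <= C * (r - p) ^ 2) ->
  (forall r, p < r < p + eps -> N r <= B * (r - p) ^ 2) ->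
  forall r, p < r < p + eps -> N r <= C * (r - p) ^ 3.
Proof.
intros He HB HC Hd HN' HN r Hr.
set (G := fun r => C * (r - p) ^ 3 - N r).
assert (HG : forall s, p < s < r -> - (B * (s - p) ^ 2) <= G r).
{ intros s Hs.
  assert (M : G s <= G r).
  { apply (le_of_derive_nonneg G (fun r => 3 * C * (r - p) ^ 2 - N' r)); [lra| |].
    - intros z Hz; apply (is_derive_minus (V := R_NormedModule)); [|apply Hd; lra].
      auto_derive; [auto|ring].
    - intros z Hz; assert (H := HN' z ltac:(lra)).
      assert (0 <= C * (z - p) ^ 2) by (apply Rmult_le_pos; [easy|apply pow2_ge_0]).
      lra. }
  assert (H := HN s ltac:(lra)); unfold G in M at 1.
  assert (0 <= C * (s - p) ^ 3) by (apply Rmult_le_pos; [easy|apply pow_le; lra]).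
  lra. }
assert (0 <= G r); [|unfold G in *; lra].
apply Rnot_lt_le; intros Hneg.
(* A point so close to [p] that [HG] there contradicts [G r < 0]: it lies left of [r], and
   [B d^2 <= B d <= - G r / 2]. *)
set (d := Rmin ((r - p) / 2) (Rmin 1 (- G r / (2 * (B + 1))))).
assert (Hd0 : 0 < d).
{ repeat apply Rmin_glb_lt; try lra; apply Rdiv_lt_0_compat; lra. }
assert (H1 : d <= (r - p) / 2) by apply Rmin_l.
assert (H2 : d <= 1) by (eapply Rle_trans; [apply Rmin_r|apply Rmin_l]).
assert (H3 : d <= - G r / (2 * (B + 1))) by (eapply Rle_trans; [apply Rmin_r|apply Rmin_r]).
assert (H := HG (p + d) ltac:(lra)).
replace (p + d - p) with d in H by ring.
assert (H4 : (B + 1) * d <= - G r / 2).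
{ apply (Rle_trans _ ((B + 1) * (- G r / (2 * (B + 1))))).
  - apply Rmult_le_compat_l; lra.
  - right; field; lra. }
assert (d ^ 2 <= d) by nra.
assert (B * d ^ 2 <= B * d) by (apply Rmult_le_compat_l; lra).
lra.
Qed.

(** The indicial exponents of [Delta R] at the horizon are 0 and 2. The exponent
    0 solution carries a logarithm whose coefficient, the nonzero quantity [J],
    is excluded by three bounded derivatives. *)
Lemma horizon_decay_plus M a k rp :
  0 <= a -> 0 < k -> 0 < rp -> Delta M a k rp = 0 -> 0 < dDelta M a k rp ->
  exists A B, forall m lam f,
    smoothC (fun r => rp < r) f ->
    (forall r, rp < r -> radial_op M a k m (m * omega_plus a rp) f r = (lam * f r)%C) ->
    (forall q, bounded_right rp (horizon_jet M a k m (m * omega_plus a rp) f q)) ->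
    A + B * Rabs m <= Re lam ->
    filterlim (fun r => normsq (f r)) (at_right rp) (locally 0).
Proof.
intros Ha Hk Hp D0 D1.
set (w0 := rp ^ 2 + a ^ 2); assert (Hw0 : 0 < w0) by (unfold w0; nra).
set (e1 := 2 * rp * dDelta M a k rp + w0 * ddDelta a k rp).
destruct (proj1 (jet_pot_smooth M a k 1%nat) rp Hp) as [dpot _]; simpl in dpot.
destruct (proj1 (jet_phase_smooth a k rp 1%nat) rp Hp) as [dphase _]; simpl in dphase.
set (c1 := Derive (jet_pot M a k) rp); set (c2 := Derive (jet_phase a k rp) rp).
assert (dpot' : is_derive (jet_pot M a k) rp c1) by exact dpot.
assert (dphase' : is_derive (jet_phase a k rp) rp c2) by exact dphase.
(* Chosen for the proof of [NJ]: [(Rabs e1 + 1) / w0] makes [Re (b1 rp) >= 1], and the terms with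
   [c1] and [c2] make [|a0 rp|] exceed [|a1 rp|] times the modulus of the derivative of [a0]. That
   derivative is free of [lam] and affine in [m], which is why a bound linear in [|m|] suffices. *)
exists (jet_pot M a k rp + 1 + (Rabs e1 + 1) / w0 + w0 * dDelta M a k rp * Rabs c1 + 1),
  (w0 * dDelta M a k rp * Rabs c2).
intros m lam f Hf Hode Hbd Hlam.
set (om := m * omega_plus a rp) in *.
set (Y := horizon_jet M a k m om f) in *.
set (a1 := jet_coef1 M a k m om); set (a0 := jet_coef0 M a k rp m lam).
assert (s1 := jet_coef1_smooth M a k m om); fold a1 in s1.
assert (s0 := jet_coef0_smooth M a k rp m lam); fold a0 in s0.
assert (d1 := proj1 (s1 1%nat) rp Hp); assert (d0 := proj1 (s0 1%nat) rp Hp).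
assert (d1' := proj1 (proj2 (s1 2%nat)) rp Hp).
assert (d0' := proj1 (proj2 (s0 2%nat)) rp Hp).
assert (HD := is_deriveC_RtoC _ _ _ (is_derive_Delta M a k rp)).
assert (HDl : linear_right rp (fun r => RtoC (Delta M a k r))).
{ apply (is_deriveC_linear_right _ _ _ HD); now rewrite D0. }
assert (K0 : Kf a m om rp = 0) by (unfold Kf, om, omega_plus; field; nra).
assert (bd : forall g l, is_derive g rp l -> bounded_right rp (fun r => RtoC (g r))).
{ intros g l Hg; exact (is_deriveC_bounded_right _ _ _ (is_deriveC_RtoC _ _ _ Hg)). }
(* First relation: the jet equation, whose remaining term contains [Delta] and the bounded [Y 2]. *)
assert (O1 : linear_right rp (fun r => a1 r * Y 1%nat r + a0 r * Y 0%nat r)%C).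
{ apply (linear_right_ext _ (fun r => RtoC (Delta M a k r) *
    RtoC (- (r ^ 2 + a ^ 2) ^ 2) * Y 2%nat r)%C).
  - intros r Hr.
    assert (E := horizon_jet_equation M a k m rp f lam r Hp D0 D1 Hf Hode Hr).
    fold om in E; fold Y a1 a0 in E; rewrite RtoC_mult in E.
    rewrite RtoC_opp.
    match type of E with (?x + ?y + ?z)%C = _ =>
      transitivity (- x + (x + y + z))%C; [rewrite E; ring|ring] end.
  - apply linear_right_mult; [|apply Hbd]; apply linear_right_mult; [exact HDl|].
    eapply bd; auto_derive; [auto|reflexivity]. }
set (b1 := fun r => (DeriveC a1 r + RtoC (- (r ^ 2 + a ^ 2)) * a0 r)%C).
(* Second relation: the differentiated jet equation; [Y 2] and [Y 3] occur only with factors [Delta]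
   or [K], which vanish at [rp]. *)
assert (O2 : linear_right rp (fun r => b1 r * Y 1%nat r + DeriveC a0 r * Y 0%nat r)%C).
{ apply (linear_right_ext _ (fun r =>
     RtoC (Delta M a k r) * RtoC ((r ^ 2 + a ^ 2) ^ 3) * Y 3%nat r
     + RtoC (Delta M a k r) * RtoC (- (4 * r * (r ^ 2 + a ^ 2))) * Y 2%nat r
     + RtoC (Kf a m om r) * (Ci * RtoC (- (2 * Xi a k * (r ^ 2 + a ^ 2) ^ 2)))
         * Y 2%nat r)%C).
  - intros r Hr.
    assert (E := horizon_jet_equation_derivative M a k m rp f lam r Hp D0 D1 Hf Hode Hr).
    cbv zeta in E; fold om in E; fold Y a1 a0 in E; unfold b1; rewrite E.
    replace (- (4 * r * (r ^ 2 + a ^ 2) * Delta M a k r)) with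
      (Delta M a k r * - (4 * r * (r ^ 2 + a ^ 2))) by ring.
    replace (- (2 * Xi a k * Kf a m om r * (r ^ 2 + a ^ 2) ^ 2)) with
      (Kf a m om r * - (2 * Xi a k * (r ^ 2 + a ^ 2) ^ 2)) by ring.
    rewrite !(RtoC_mult (Delta M a k r)), (RtoC_mult (Kf a m om r)); ring.
  - apply linear_right_plus; [apply linear_right_plus|];
      (apply linear_right_mult; [|apply Hbd]).
    + apply linear_right_mult; [exact HDl|].
      eapply bd; auto_derive; [auto|reflexivity].
    + apply linear_right_mult; [exact HDl|].
      eapply bd; auto_derive; [auto|reflexivity].
    + apply linear_right_mult.
      * eapply (is_deriveC_linear_right _ (fun r => RtoC (Kf a m om r)));
          [apply is_deriveC_RtoC; unfold Kf; auto_derive; [auto|reflexivity]|].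
        now rewrite K0.
      * eapply is_deriveC_bounded_right, is_deriveC_scal, is_deriveC_RtoC.
        auto_derive; [auto|reflexivity]. }
assert (db1 : exists l, is_deriveC b1 rp l).
{ eexists; apply is_deriveC_plus; [exact d1'|].
  apply is_deriveC_mult; [|exact d0].
  apply is_deriveC_RtoC; auto_derive; [auto|reflexivity]. }
destruct db1 as [l1 db1].
(* Up to sign, the determinant of the two relations in [Y 1] and [Y 0]. At [rp] it is quadratic in
   [lam] with leading coefficient [- w0]. *)
set (J := fun r => (b1 r * a0 r + - a1 r * DeriveC a0 r)%C).
assert (dm1 : is_deriveC (fun r => - a1 r)%C rp (- DeriveC a1 rp)%C).
{ apply (is_deriveC_ext (fun r => RtoC (-1) * a1 r)%C); [intros y; ring|].
  apply (is_deriveC_eq _ _ _ _ (is_deriveC_scal _ _ _ _ d1)); ring. }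
assert (dJ := is_deriveC_plus _ _ _ _ _ (is_deriveC_mult _ _ _ _ _ db1 d0)
   (is_deriveC_mult _ _ _ _ _ dm1 d0')).
assert (bnd := is_deriveC_bounded_right).
assert (Ea1 : a1 rp = RtoC (w0 * dDelta M a k rp)).
{ unfold a1, jet_coef1; rewrite K0, Rmult_0_r, Ropp_0; fold w0; ring. }
assert (Hw1 : 0 < w0 * dDelta M a k rp) by (apply Rmult_lt_0_compat; lra).
assert (Na1 : a1 rp <> 0%C) by (rewrite Ea1; apply RtoC_neq_0; lra).
assert (Ea0' : DeriveC a0 rp = (RtoC c1 + Ci * RtoC (m * c2))%C).
{ apply DeriveC_unique; unfold a0, jet_coef0.
  apply (is_deriveC_ext (fun r => RtoC (jet_pot M a k r)
     + Ci * RtoC (m * jet_phase a k rp r) + - lam)%C); [intros y; ring|].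
  apply (is_deriveC_eq _ _ _ _ (is_deriveC_plus _ _ _ _ _ (is_deriveC_plus _ _ _ _ _
    (is_deriveC_RtoC _ _ _ dpot') (is_deriveC_scal Ci _ _ _ (is_deriveC_RtoC _ _ _
      (is_derive_scal _ _ m _ dphase')))) (is_deriveC_const (- lam)%C rp))).
  unfold scal; simpl; unfold mult; simpl; ring. }
assert (Ha0' : Cmod (DeriveC a0 rp) <= Rabs c1 + Rabs m * Rabs c2).
{ rewrite Ea0'; apply (Rle_trans _ _ _ (Cmod_triangle _ _)).
  rewrite Cmod_mult, !Cmod_R, Cmod_Ci, Rabs_mult; lra. }
assert (Ea1' : Re (DeriveC a1 rp) = e1).
{ destruct (is_derive_unique _ _ _ (proj1 d1)).
  apply is_derive_unique.
  apply (is_derive_ext (fun r => (r ^ 2 + a ^ 2) * dDelta M a k r)).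
  { intros r; unfold a1, jet_coef1; simpl; ring. }
  apply (is_derive_eq _ _ _ _ (Derive.is_derive_mult (fun r => r ^ 2 + a ^ 2) _ rp (2 * rp) _
    ltac:(auto_derive; [auto|ring]) (is_derive_dDelta M a k rp))).
  unfold e1, w0; ring. }
set (T := Re lam - jet_pot M a k rp).
assert (Ea0 : Re (a0 rp) = - T) by (unfold a0, jet_coef0, T; simpl; unfold Re; ring).
assert (HT : 1 + (Rabs e1 + 1) / w0 + w0 * dDelta M a k rp * (Rabs c1 + Rabs m * Rabs c2)
   + 1 <= T) by (unfold T; lra).
(* The product [b1 a0] dominates: its modulus is at least [T], because [|a0| >= T] and [|b1| >= 1],
   whereas the other product has modulus less than [T]. *)
assert (NJ : J rp <> 0%C).
{ intros EJ; unfold J in EJ.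
  assert (E : (b1 rp * a0 rp)%C = (a1 rp * DeriveC a0 rp)%C).
  { transitivity (b1 rp * a0 rp + - a1 rp * DeriveC a0 rp + a1 rp * DeriveC a0 rp)%C;
      [ring|rewrite EJ; ring]. }
  apply (f_equal Cmod) in E; rewrite !Cmod_mult, Ea1, Cmod_R, Rabs_pos_eq in E by lra.
  assert (H1 : T <= Cmod (a0 rp)).
  { apply (Rle_trans _ (Rabs (Re (a0 rp)))); [|apply re_le_Cmod].
    rewrite Ea0, Rabs_Ropp; apply Rle_abs. }
  assert (P0 : 0 <= (Rabs e1 + 1) / w0).
  { apply Rmult_le_pos; [generalize (Rabs_pos e1); lra|].
    apply Rlt_le, Rinv_0_lt_compat, Hw0. }
  assert (P1 : 0 <= Rabs c1 + Rabs m * Rabs c2).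
  { apply Rplus_le_le_0_compat; [|apply Rmult_le_pos]; apply Rabs_pos. }
  assert (P2 : 0 <= w0 * dDelta M a k rp * (Rabs c1 + Rabs m * Rabs c2))
    by (apply Rmult_le_pos; lra).
  assert (H2 : 1 <= Cmod (b1 rp)).
  { apply (Rle_trans _ (Rabs (Re (b1 rp)))); [|apply re_le_Cmod].
    apply (Rle_trans _ (Re (b1 rp))); [|apply Rle_abs].
    unfold b1; fold w0.
    replace (Re (DeriveC a1 rp + RtoC (- w0) * a0 rp))
      with (Re (DeriveC a1 rp) + - w0 * Re (a0 rp)) by (simpl; unfold Re; ring).
    rewrite Ea1', Ea0.
    assert (H3 : w0 * ((Rabs e1 + 1) / w0) <= w0 * T)
      by (apply Rmult_le_compat_l; lra).
    replace (w0 * ((Rabs e1 + 1) / w0)) with (Rabs e1 + 1) in H3 by (field; lra).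
    assert (H4 := Rle_abs (- e1)); rewrite Rabs_Ropp in H4; lra. }
  assert (H3 : w0 * dDelta M a k rp * Cmod (DeriveC a0 rp)
    <= w0 * dDelta M a k rp * (Rabs c1 + Rabs m * Rabs c2))
    by (apply Rmult_le_compat_l; lra).
  assert (1 * T <= Cmod (b1 rp) * Cmod (a0 rp)) by (apply Rmult_le_compat; lra).
  lra. }
(* Cramer's rule: eliminating [Y 1] leaves [J * Y 0]. Then [Y 1] follows from the first relation,
   since [a1 rp] is nonzero. *)
assert (L0 : linear_right rp (Y 0%nat)).
{ apply (linear_right_cancel rp J _ _ dJ NJ).
  apply (linear_right_ext _ (fun r =>
    (a1 r * Y 1%nat r + a0 r * Y 0%nat r) * b1 r
    + (b1 r * Y 1%nat r + DeriveC a0 r * Y 0%nat r) * - a1 r)%C).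
  { intros r _; unfold J; ring. }
  apply linear_right_plus; apply linear_right_mult; try assumption.
  - exact (bnd _ _ _ db1).
  - exact (bnd _ _ _ dm1). }
assert (L1 : linear_right rp (Y 1%nat)).
{ apply (linear_right_cancel rp a1 _ _ d1 Na1).
  apply (linear_right_ext _ (fun r =>
    (a1 r * Y 1%nat r + a0 r * Y 0%nat r) + Y 0%nat r * (RtoC (-1) * a0 r))%C).
  { intros r _; ring. }
  apply linear_right_plus; [exact O1|]; apply linear_right_mult; [exact L0|].
  exact (bnd _ _ _ (is_deriveC_scal (RtoC (-1)) _ _ _ d0)). }
destruct L0 as [B0 [e0 [He0 HB0]]]; destruct L1 as [B1 [e1' [He1 HB1]]].
set (eps := Rmin e0 (Rmin e1' 1)).
assert (Heps : 0 < eps) by (repeat apply Rmin_glb_lt; lra).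
assert (I0 : eps <= e0) by apply Rmin_l.
assert (I1 : eps <= e1') by (eapply Rle_trans; [apply Rmin_r|apply Rmin_l]).
assert (I2 : eps <= 1) by (eapply Rle_trans; [apply Rmin_r|apply Rmin_r]).
(* An upper bound for [r ^ 2 + a ^ 2] on the interval, because [eps <= 1]. *)
set (W := (rp + 1) ^ 2 + a ^ 2).
assert (HW : 0 < W) by (unfold W; nra).
set (C := 2 * W * (Rabs B0 * Rabs B1)).
assert (HC : 0 <= C).
{ unfold C; apply Rmult_le_pos; [lra|apply Rmult_le_pos; apply Rabs_pos]. }
(* The linear bound on [Y 0 = Delta * f] shows only that [f] is bounded. In the derivative of
   [|Y 0|^2] the imaginary multiple of [Y 0] drops out, leaving [- 2 (r^2 + a^2) dotC (Y 0) (Y 1)],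
   which is quadratically small; integration gains one power. *)
assert (N3 : forall r, rp < r < rp + eps -> normsq (Y 0%nat r) <= C * (r - rp) ^ 3).
{ apply (cubic_of_quadratic _ (fun r => 2 * dotC (Y 0%nat r) (DeriveC (Y 0%nat) r))
           rp (B0 ^ 2) C eps Heps (pow2_ge_0 _) HC).
  - intros r Hr; apply is_derive_normsq.
    exact (proj1 (horizon_jet_smooth M a k m om rp f 0 Hp D0 D1 Hf 1%nat) r ltac:(lra)).
  - intros r Hr; assert (HDr := Delta_pos M a k rp r Hp D0 D1 ltac:(lra)).
    assert (Hwr : 0 < r ^ 2 + a ^ 2) by nra.
    unfold Y; rewrite horizon_jet_derivative by lra; fold Y.
    set (kap := Xi a k * Kf a m om r / Delta M a k r).
    replace (2 * dotC _ _) with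
      (2 * (r ^ 2 + a ^ 2) * - dotC (Y 0%nat r) (Y 1%nat r))
      by (rewrite dotC_plus_r, dotC_scal_r, dotC_mult_self; simpl; ring).
    assert (H1 := HB0 r ltac:(lra)); assert (H2 := HB1 r ltac:(lra)).
    assert (H3 := dotC_le (Y 0%nat r) (Y 1%nat r)).
    assert (H4 := Rle_abs (- dotC (Y 0%nat r) (Y 1%nat r))); rewrite Rabs_Ropp in H4.
    assert (H5 : Cmod (Y 0%nat r) * Cmod (Y 1%nat r)
       <= (Rabs B0 * (r - rp)) * (Rabs B1 * (r - rp))).
    { apply Rmult_le_compat; try apply Cmod_ge_0.
      - apply (Rle_trans _ _ _ H1), Rmult_le_compat_r; [lra|apply Rle_abs].
      - apply (Rle_trans _ _ _ H2), Rmult_le_compat_r; [lra|apply Rle_abs]. }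
    apply (Rle_trans _ (2 * (r ^ 2 + a ^ 2) * (Rabs B0 * (r - rp) * (Rabs B1 * (r - rp))))).
    + apply Rmult_le_compat_l; lra.
    + unfold C; replace (2 * W * (Rabs B0 * Rabs B1) * (r - rp) ^ 2) with
        (2 * W * (Rabs B0 * (r - rp) * (Rabs B1 * (r - rp)))) by ring.
      apply Rmult_le_compat_r.
      * apply Rmult_le_pos; apply Rmult_le_pos; try apply Rabs_pos; lra.
      * unfold W; nra.
  - intros r Hr; rewrite normsq_Cmod.
    assert (H1 := HB0 r ltac:(lra)); assert (H2 := Cmod_ge_0 (Y 0%nat r)).
    replace (B0 ^ 2 * (r - rp) ^ 2) with ((B0 * (r - rp)) ^ 2) by ring.
    apply pow_incr; lra. }
(* Dividing the cubic bound by [Delta^2 >= (Delta'(rp) (r - rp))^2] leaves a linear bound on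
   [|f|^2]. *)
apply (filterlim_right_0 rp _ (C / dDelta M a k rp ^ 2) eps Heps).
intros r Hr; split; [apply normsq_ge_0|].
assert (HDr := Delta_pos M a k rp r Hp D0 D1 ltac:(lra)).
assert (HN := N3 r Hr).
assert (EY : normsq (Y 0%nat r) = Delta M a k r ^ 2 * normsq (f r)).
{ unfold Y, horizon_jet; simpl Nat.iter; rewrite normsq_mult; f_equal.
  unfold normsq; simpl; ring. }
rewrite EY in HN.
assert (HL := Delta_lower_bound M a k rp r Hp D0 ltac:(lra)).
assert (H0 : 0 <= (k * (r ^ 2 - rp ^ 2)) ^ 2) by apply pow2_ge_0.
assert (HL' : dDelta M a k rp * (r - rp) <= Delta M a k r) by nra.
assert (HL2 : (dDelta M a k rp * (r - rp)) ^ 2 <= Delta M a k r ^ 2).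
{ apply pow_incr; split; [apply Rmult_le_pos; lra|easy]. }
assert (Nf := normsq_ge_0 (f r)).
assert (H1 : (dDelta M a k rp * (r - rp)) ^ 2 * normsq (f r) <= C * (r - rp) ^ 3).
{ apply (Rle_trans _ (Delta M a k r ^ 2 * normsq (f r))); [|easy].
  now apply Rmult_le_compat_r. }
apply (Rmult_le_reg_l ((dDelta M a k rp * (r - rp)) ^ 2)).
{ apply pow_lt, Rmult_lt_0_compat; lra. }
apply (Rle_trans _ _ _ H1); right; field; lra.
Qed.

(** For spin -2 the renormalisation works in the favourable direction: boundedness of [/ Delta * f]
    already gives [f = O(r - rp)]. *)
Lemma horizon_decay_minus M a k rp f :
  Delta M a k rp = 0 -> (forall r, rp < r -> 0 < Delta M a k r) ->
  bounded_right rp (fun r => RtoC (/ Delta M a k r) * f r)%C ->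
  filterlim (fun r => normsq (f r)) (at_right rp) (locally 0).
Proof.
intros D0 HD Hb.
assert (HL : linear_right rp (fun r => RtoC (Delta M a k r))).
{ apply (is_deriveC_linear_right _ _ _ (is_deriveC_RtoC _ _ _ (is_derive_Delta M a k rp))).
  now rewrite D0. }
assert (L := linear_right_mult _ _ _ HL Hb).
destruct L as [B [e [He H]]].
apply (filterlim_right_0 rp _ (B ^ 2) (Rmin e 1)); [apply Rmin_glb_lt; lra|].
intros r Hr; assert (H1 := Rmin_l e 1); assert (H2 := Rmin_r e 1).
split; [apply normsq_ge_0|].
assert (H3 := H r ltac:(lra)).
replace (RtoC (Delta M a k r) * (RtoC (/ Delta M a k r) * f r))%C with (f r) in H3.
2:{ rewrite Cmult_assoc, <- RtoC_mult, Rinv_r by (apply Rgt_not_eq, HD; lra); ring. }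
rewrite normsq_Cmod; assert (H4 := Cmod_ge_0 (f r)).
apply (Rle_trans _ ((B * (r - rp)) ^ 2)); [apply pow_incr; lra|].
replace ((B * (r - rp)) ^ 2) with (B ^ 2 * ((r - rp) * (r - rp))) by ring.
apply Rmult_le_compat_l; [apply pow2_ge_0|nra].
Qed.

(** * Stationary modes *)

(** Equality with a mode is assumed only for [rp < r], the form in which the iterates provide it;
    this is open in [r] and unrestricted in [t] and [ph], so all three partial derivatives are
    determined. *)
Lemma op_Lbar_modef M a k rp tau nu Y Sf f t r th ph :
  (forall t r th ph, rp < r -> f t r th ph = modef tau nu (fun r th => Y r * Sf th)%C t r th ph) ->
  (forall r, rp < r -> is_deriveC Y r (DeriveC Y r)) -> rp < r ->
  op_Lbar M a k f t r th ph =
  modef tau nu (fun r th =>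
    (Ci * RtoC (Xi a k * tau + a * Xi a k / (r ^ 2 + a ^ 2) * nu) * Y r
     + RtoC (- (Delta M a k r / (r ^ 2 + a ^ 2))) * DeriveC Y r) * Sf th)%C t r th ph.
Proof.
intros E dY Hr; unfold op_Lbar, op_T, d_rstar.
replace (d_t f t r th ph) with (d_t (modef tau nu (fun r th => Y r * Sf th)%C) t r th ph).
2:{ apply DeriveC_ext_loc, filter_forall; intros x; symmetry; now apply E. }
replace (d_ph f t r th ph) with (d_ph (modef tau nu (fun r th => Y r * Sf th)%C) t r th ph).
2:{ apply DeriveC_ext_loc, filter_forall; intros x; symmetry; now apply E. }
replace (d_r f t r th ph) with (d_r (modef tau nu (fun r th => Y r * Sf th)%C) t r th ph).
2:{ apply DeriveC_ext_loc; generalize (open_gt rp r Hr); apply filter_imp.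
    intros x Hx; symmetry; now apply E. }
rewrite d_t_modef, d_ph_modef, (d_r_modef _ _ _ _ _ _ _ (DeriveC Y r * Sf th)%C).
2:{ apply (is_deriveC_eq _ _ _ _ (is_deriveC_mult _ _ _ _ _ (dY r Hr)
      (is_deriveC_const (Sf th) r))); ring. }
unfold modef; rewrite RtoC_opp, (RtoC_plus (Xi a k * tau)), (RtoC_mult (Xi a k) tau),
  (RtoC_mult (a * Xi a k / (r ^ 2 + a ^ 2)) nu); ring.
Qed.

Lemma iter_Lbar_modef M a k rp m om Rf Sf f q :
  0 < rp -> Delta M a k rp = 0 -> 0 < dDelta M a k rp ->
  smoothC (fun r => rp < r) Rf ->
  (forall t r th ph, rp < r -> f t r th ph =
     modef (- om) m (fun r th => RtoC (Delta M a k r) * Rf r * Sf th)%C t r th ph) ->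
  forall t r th ph, rp < r ->
  Nat.iter q (fun f t r th ph =>
     RtoC (/ Delta M a k r) * op_Lbar M a k f t r th ph)%C f t r th ph =
  modef (- om) m (fun r th => horizon_jet M a k m om Rf q r * Sf th)%C t r th ph.
Proof.
intros Hp D0 D1 HR Ef; induction q as [|q IH]; intros t r th ph Hr; [now apply Ef|].
assert (dY := proj1 (horizon_jet_smooth M a k m om rp Rf q Hp D0 D1 HR 1%nat)).
simpl; rewrite (op_Lbar_modef M a k rp (- om) m _ Sf _ t r th ph IH dY Hr).
assert (Hw : 0 < r ^ 2 + a ^ 2) by nra.
unfold modef; unfold horizon_step; fold (horizon_jet M a k m om Rf q).
replace (Xi a k * - om + a * Xi a k / (r ^ 2 + a ^ 2) * m) with
  (Xi a k * Kf a m om r / (r ^ 2 + a ^ 2)) by (unfold Kf; field; lra).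
ring.
Qed.

(** * Profiles in the tortoise coordinate *)

Lemma tortoise_neg M a k rp rstar r :
  0 < rp -> (forall r, rp < r -> 0 < Delta M a k r) ->
  is_tortoise M a k rp rstar -> rp < r -> rstar r < 0.
Proof.
intros Hp HD [Hd Hl] Hr.
assert (Hpos : forall z, rp < z -> 0 < (z ^ 2 + a ^ 2) / Delta M a k z).
{ intros z Hz; apply Rdiv_lt_0_compat; [nra|now apply HD]. }
destruct (MVT_gen rstar r (r + 1) (fun z => (z ^ 2 + a ^ 2) / Delta M a k z))
  as [c [Hc E]].
- intros z; rewrite Rmin_left by lra; intros Hz; apply Hd; lra.
- intros z; rewrite Rmin_left by lra; intros Hz; apply derivable_continuous_pt.
  eexists; apply is_derive_Reals, Hd; lra.
- rewrite Rmin_left, Rmax_right in Hc by lra.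
  assert (H := Hpos c ltac:(lra)).
  assert (rstar (r + 1) <= 0); [|nra].
  apply (limit_ge (Rbar_locally' p_infty) rstar 0 _ Hl).
  exists (r + 1); intros y Hy.
  apply (le_of_derive_nonneg rstar (fun z => (z ^ 2 + a ^ 2) / Delta M a k z)); [lra| |].
  + intros z Hz; apply Hd; lra.
  + intros z Hz; apply Rlt_le, Hpos; lra.
Qed.

Lemma tortoise_at_left M a k rp rstar :
  0 < rp -> (forall r, rp < r -> 0 < Delta M a k r) ->
  is_tortoise M a k rp rstar ->
  filterlim rstar (Rbar_locally p_infty) (at_left 0).
Proof.
intros Hp HD Ht P [eps HP].
assert (H1 : Rbar_locally p_infty (fun r => ball 0 eps (rstar r)))
  by (apply (proj2 Ht); exists eps; easy).
assert (H2 : Rbar_locally p_infty (fun r => rp < r)) by (exists rp; easy).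
unfold filtermap; generalize (filter_and _ _ H1 H2); apply filter_imp; intros r [Hb Hr].
apply HP; [exact Hb|now apply (tortoise_neg M a k rp)].
Qed.

(** At [t = 0] and [ph = 0] every phase and spin-weight factor is 1, and the stereographic point is
    [(tan (th / 2), 0)] in one chart and [(/ tan (th / 2), 0)] in the other. *)
Lemma extension_profile M a k rp rstar s m omega Rf Sf A :
  0 < rp -> (forall r, rp < r -> 0 < Delta M a k r) ->
  is_tortoise M a k rp rstar ->
  is_extension_to_infinity rp rstar s (stationary_mode s m omega Rf Sf) A ->
  exists F G : R * R * R * R -> C,
    smooth_on up_to_infinity F /\ smooth_on up_to_infinity G /\
    (forall rs th, rs <= 0 -> 0 < th < PI -> A 0 rs th 0 = F (0, rs, tan (th / 2), 0)) /\
    (forall r th, rp < r -> 0 < th < PI ->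
       (Rf r * Sf th)%C = F (0, rstar r, tan (th / 2), 0)) /\
    (forall r th, rp < r -> 0 < th < PI ->
       (Rf r * Sf th)%C = G (0, rstar r, / tan (th / 2), 0)).
Proof.
intros Hp HD Ht [[[F [HF EF]] [G [HG EG]]] EA].
assert (E : forall r th, rp < r -> 0 < th < PI -> A 0 (rstar r) th 0 = (Rf r * Sf th)%C).
{ intros r th Hr Hth; rewrite EA by easy; unfold stationary_mode.
  rewrite !Rmult_0_r, cis_0; ring. }
assert (EF' : forall rs th, rs <= 0 -> 0 < th < PI ->
    A 0 rs th 0 = F (0, rs, tan (th / 2), 0)).
{ intros rs th Hrs Hth; assert (H := EF 0 rs th 0 Hrs Hth).
  rewrite Rmult_0_r, cis_0, cos_0, sin_0, Rmult_0_r, Rmult_1_r in H.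
  rewrite <- H; ring. }
exists F, G; split; [easy|]; split; [easy|]; split; [easy|]; split.
- intros r th Hr Hth; rewrite <- E by easy; apply EF'; [|easy].
  apply Rlt_le; now apply (tortoise_neg M a k rp).
- intros r th Hr Hth; rewrite <- E by easy.
  assert (Hrs : rstar r <= 0) by (apply Rlt_le; now apply (tortoise_neg M a k rp)).
  assert (H := EG 0 (rstar r) th 0 Hrs Hth).
  rewrite Rmult_0_r, cis_0, cos_0, sin_0, Rmult_0_r, Rmult_1_r in H.
  rewrite <- H; ring.
Qed.

Lemma is_deriveC_rstar M a k rp rstar u0 u1 f r :
  (forall r, rp < r -> rstar r < 0) -> is_tortoise M a k rp rstar ->
  (forall x, x < 0 -> is_deriveC u0 x (u1 x)) ->
  (forall r, rp < r -> f r = u0 (rstar r)) -> rp < r ->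
  is_deriveC f r (RtoC ((r ^ 2 + a ^ 2) / Delta M a k r) * u1 (rstar r))%C.
Proof.
intros Hn [Ht _] Hu E Hr.
apply (is_deriveC_ext_loc (fun r => u0 (rstar r))).
- generalize (open_gt rp r Hr); apply filter_imp; intros x Hx; symmetry; now apply E.
- apply is_deriveC_comp; [apply Hu; now apply Hn|now apply Ht].
Qed.

Lemma radial_profile_smooth M a k rp rstar (u : nat -> R -> C) f :
  0 < rp -> Delta M a k rp = 0 -> 0 < dDelta M a k rp ->
  is_tortoise M a k rp rstar ->
  (forall n x, x < 0 -> is_deriveC (u n) x (u (S n) x)) ->
  (forall r, rp < r -> f r = u 0%nat (rstar r)) ->
  smoothC (fun r => rp < r) f.
Proof.
intros Hp D0 D1 Ht Hu E; assert (Hop := open_gt rp).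
assert (HD := fun x => Delta_pos M a k rp x Hp D0 D1).
apply (smoothC_ext _ Hop (fun r => u 0%nat (rstar r))).
{ intros r Hr; symmetry; now apply E. }
apply (smoothC_comp _ Hop u rstar (fun r => (r ^ 2 + a ^ 2) / Delta M a k r)).
- exact (proj1 Ht).
- change (smoothR (fun r => rp < r) (fun r => (r ^ 2 + a ^ 2) / Delta M a k r)).
  assert (iD : smoothR (fun r => rp < r) (fun r => / Delta M a k r)).
  { apply (smoothR_inv _ Hop _ (dDelta M a k)).
    - intros x Hx; apply Rgt_not_eq; now apply HD.
    - intros x Hx; apply is_derive_Delta.
    - unfold dDelta; smooth_real. }
  smooth_real.
- intros n x Hx; apply Hu; now apply (tortoise_neg M a k rp).
Qed.

Lemma Cmult_eq_0_r (z w : C) : (z * w)%C = 0%C -> z <> 0%C -> w = 0%C.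
Proof.
intros H Hz; transitivity (/ z * (z * w))%C; [field; easy|rewrite H; ring].
Qed.

Lemma separation_constant M a k rp s m omega Rf Sf r0 th0 :
  0 <= a -> 0 < k -> a * k < 1 -> 0 < rp ->
  (forall x, rp < x -> 0 < Delta M a k x) ->
  smoothC (fun x => rp < x) Rf -> smoothC (fun x => 0 < x < PI) Sf ->
  solves_teukolsky M a k rp s (stationary_mode s m omega Rf Sf) ->
  rp < r0 -> 0 < th0 < PI -> Rf r0 <> 0%C -> Sf th0 <> 0%C ->
  exists lam : C,
    (forall r, rp < r ->
       radial_op M a k (IZR m) (IZR m * omega) Rf r = (lam * Rf r)%C) /\
    (forall th, 0 < th < PI ->
       angular_op a k (IZR m) (IZR m * omega) Sf th = (- lam * Sf th)%C).
Proof.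
intros Ha Hk Hak Hp HD HR HS Hsol Hr0 Hth0 NR NS.
set (Rad := radial_op M a k (IZR m) (IZR m * omega) Rf).
set (Ang := angular_op a k (IZR m) (IZR m * omega) Sf).
assert (E : forall r th, rp < r -> 0 < th < PI ->
   (Rad r * Sf th + Rf r * Ang th)%C = 0%C).
{ intros r th Hr Hth.
  assert (H := Hsol 0 r th 0 (conj Hr Hth)).
  rewrite (teukolsky_separation M a k rp s m omega Rf Sf 0 r th 0
    Ha Hk Hak Hp HD HR HS (conj Hr Hth)) in H; fold Rad Ang in H.
  assert (HSig : 0 < Sigma a r th).
  { unfold Sigma; assert (0 <= (a * cos th) ^ 2) by apply pow2_ge_0; nra. }
  apply (Cmult_eq_0_r _ _ H); repeat apply Cmult_neq_0; try apply cis_neq_0.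
  - apply RtoC_neq_0, renorm_neq_0; [now apply HD|lra].
  - apply RtoC_neq_0, Rinv_neq_0_compat; lra. }
exists (Rad r0 / Rf r0)%C.
assert (EA : forall th, 0 < th < PI -> Ang th = (- (Rad r0 / Rf r0) * Sf th)%C).
{ intros th Hth; assert (H := E r0 th Hr0 Hth).
  transitivity (/ Rf r0 * (Rad r0 * Sf th + Rf r0 * Ang th)
     - Rad r0 / Rf r0 * Sf th)%C; [field; easy|rewrite H; field; easy]. }
split; [|exact EA]; intros r Hr.
assert (H := E r th0 Hr Hth0); rewrite (EA th0 Hth0) in H.
transitivity (/ Sf th0 * (Rad r * Sf th0 + Rf r * (- (Rad r0 / Rf r0) * Sf th0))
   + Rad r0 / Rf r0 * Rf r)%C; [field; easy|rewrite H; field; easy].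
Qed.

(** Regularity is given for the product [Rf * Sf] alone. Freezing one variable where its factor is
    nonzero and dividing transfers it to the other factor. *)
Lemma nontrivial_mode M a k rp rstar s m (Rf Sf : R -> C) A r0 th0 :
  0 <= a -> 0 < k -> a * k < 1 -> 0 < rp ->
  Delta M a k rp = 0 -> 0 < dDelta M a k rp ->
  is_tortoise M a k rp rstar ->
  is_extension_to_infinity rp rstar s
    (stationary_mode s m (omega_plus a rp) Rf Sf) A ->
  solves_teukolsky M a k rp s (stationary_mode s m (omega_plus a rp) Rf Sf) ->
  0 <= mu a k rp * IZR m ^ 2 - 16 * Rabs (IZR m) ->
  rp < r0 -> 0 < th0 < PI -> Rf r0 <> 0%C -> Sf th0 <> 0%C ->
  smoothC (fun r => rp < r) Rf /\
  exists lam : C,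
    (forall r, rp < r ->
       radial_op M a k (IZR m) (IZR m * omega_plus a rp) Rf r = (lam * Rf r)%C) /\
    mu a k rp * IZR m ^ 2 - 16 * Rabs (IZR m) <= Re lam.
Proof.
intros Ha Hk Hak Hp D0 D1 Ht HA Hsol Hm Hr0 Hth0 NR NS.
assert (HD := fun x => Delta_pos M a k rp x Hp D0 D1).
destruct (extension_profile M a k rp rstar s m _ Rf Sf A Hp HD Ht HA)
  as [F [G [HF [HG [_ [EF EG]]]]]].
assert (HR : smoothC (fun r => rp < r) Rf).
{ destruct (smooth_on_radial F 0 (tan (th0 / 2)) 0 HF) as [u [Eu [du _]]].
  apply (radial_profile_smooth M a k rp rstar (fun n x => / Sf th0 * u n x)%C);
    try assumption.
  - intros n x Hx; apply is_deriveC_scal; now apply du.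
  - intros r Hr; rewrite Eu by (apply Rlt_le; now apply (tortoise_neg M a k rp)).
    rewrite <- (EF r th0 Hr Hth0); field; easy. }
assert (Hrs : rstar r0 <= 0) by (apply Rlt_le; now apply (tortoise_neg M a k rp)).
assert (HSreg : regular_at_poles Sf).
{ destruct (smooth_on_chart F 0 (rstar r0) Hrs HF) as [v [Ev dv]].
  destruct (smooth_on_chart G 0 (rstar r0) Hrs HG) as [w [Ew dw]].
  exists (fun n x => / Rf r0 * v n x)%C, (fun n x => / Rf r0 * w n x)%C.
  split; [intros n y; apply is_deriveC_scal, dv|].
  split; [intros n y; apply is_deriveC_scal, dw|].
  split; intros th Hth.
  - rewrite Ev, <- (EF r0 th Hr0 Hth); field; easy.
  - rewrite Ew, <- (EG r0 th Hr0 Hth); field; easy. }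
split; [exact HR|].
destruct (separation_constant M a k rp s m (omega_plus a rp) Rf Sf r0 th0 Ha Hk Hak Hp
  HD HR (regular_at_poles_smooth Sf HSreg) Hsol Hr0 Hth0 NR NS) as [lam [H1 H2]].
exists lam; split; [exact H1|].
apply (angular_eigenvalue_bound a k rp (IZR m) Sf lam); try assumption.
now exists th0.
Qed.

Definition time_at (k : R) (rstar : R -> R) (r : R) : R := / k * atan (k * r) - rstar r.

Lemma Cmod_modef tau nu g t r th ph : Cmod (modef tau nu g t r th ph) = Cmod (g r th).
Proof. unfold modef; rewrite !Cmod_mult, !Cmod_cis; ring. Qed.

Lemma bounded_right_of_product p (f : R -> C) (c : C) (B eps : R) :
  0 < eps -> c <> 0%C ->
  (forall r, p < r < p + eps -> Cmod (f r * c) <= B) -> bounded_right p f.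
Proof.
intros He Hc H; exists (B / Cmod c), eps; split; [easy|]; intros r Hr.
assert (Hc' : 0 < Cmod c) by now apply Cmod_gt_0.
apply -> (Rle_div_r (Cmod (f r)) B (Cmod c)); [|easy].
rewrite <- Cmod_mult; now apply H.
Qed.

(** The time [time_at k rstar r] puts the point on the slice [t_star = 0]. The modulus of a mode
    does not depend on [t], so the bound on the slice is a bound on the radial jet times
    [Sf th0]. *)
Lemma mode_bounded_plus M a k rp rstar m (Rf Sf : R -> C) th0 q :
  0 < rp -> Delta M a k rp = 0 -> 0 < dDelta M a k rp ->
  smoothC (fun r => rp < r) Rf -> 0 < th0 < PI -> Sf th0 <> 0%C ->
  regular_at_horizon M a k rp rstar plus2
    (stationary_mode plus2 m (omega_plus a rp) Rf Sf) ->
  bounded_right rp (horizon_jet M a k (IZR m) (IZR m * omega_plus a rp) Rf q).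
Proof.
intros Hp D0 D1 HR Hth0 NS Hreg.
destruct (Hreg 0%nat q 0) as [B [eps [He H]]].
apply (bounded_right_of_product rp _ (Sf th0) B eps He NS).
intros r Hr.
assert (Hb := H (time_at k rstar r) r th0 0 (conj (proj1 Hr) Hth0) (proj2 Hr)
  ltac:(unfold t_star, time_at; ring)).
simpl Nat.iter at 1 in Hb.
rewrite (iter_Lbar_modef M a k rp (IZR m) (IZR m * omega_plus a rp) Rf Sf _ q
  Hp D0 D1 HR) in Hb; [|clear Hb|exact (proj1 Hr)].
- now rewrite Cmod_modef in Hb.
- intros t x th ph Hx; rewrite stationary_mode_modef; unfold modef; simpl.
  rewrite Rmult_1_r, Ropp_mult_distr_l_reverse, !Rmult_1_l; ring.
Qed.

Lemma mode_bounded_minus M a k rp rstar m (Rf Sf : R -> C) th0 :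
  0 < th0 < PI -> Sf th0 <> 0%C ->
  regular_at_horizon M a k rp rstar minus2
    (stationary_mode minus2 m (omega_plus a rp) Rf Sf) ->
  bounded_right rp (fun r => RtoC (/ Delta M a k r) * Rf r)%C.
Proof.
intros Hth0 NS Hreg; destruct (Hreg 0%nat 0%nat 0) as [B [eps [He H]]].
apply (bounded_right_of_product rp _ (Sf th0) B eps He NS).
intros r Hr.
assert (Hb := H (time_at k rstar r) r th0 0 (conj (proj1 Hr) Hth0) (proj2 Hr)
  ltac:(unfold t_star, time_at; ring)).
simpl in Hb; rewrite stationary_mode_modef, Rmult_1_r, Cmod_mult, Cmod_modef in Hb.
now rewrite <- Cmult_assoc, Cmod_mult.
Qed.

(** * Convexity of the pair and the large-frequency conclusion *)

Lemma normsq_0 : normsq 0 = 0.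
Proof. unfold normsq; simpl; ring. Qed.

Lemma dotC_mult_r z w c : dotC (z * c) (w * c) = normsq c * dotC z w.
Proof. unfold dotC, normsq, Re, Im; simpl; ring. Qed.

(** What each spin contributes to the final argument: convexity of [|U|^2] in [rstar] and decay at
    the horizon. The zero profile qualifies, so the two members of the pair can be treated alike
    even if one vanishes. *)
Definition subharmonic_profile (M a k rp : R) (U : R -> C) : Prop :=
  (forall r, rp < r -> exists l, is_derive (radial_flux M a k U) r l /\ 0 <= l) /\
  filterlim (fun r => normsq (U r)) (at_right rp) (locally 0).

Lemma subharmonic_profile_zero M a k rp (U : R -> C) :
  (forall r, rp < r -> U r = 0%C) -> subharmonic_profile M a k rp U.
Proof.
intros E; split.
- intros r Hr; exists 0; split; [|lra].
  apply (is_derive_ext_loc (fun _ => 0)).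
  + generalize (open_gt rp r Hr); apply filter_imp; intros x Hx.
    unfold radial_flux; rewrite (E x Hx); unfold dotC; simpl; ring.
  + auto_derive; auto.
- apply (filterlim_ext_loc (fun _ => 0)); [|apply filterlim_const].
  generalize (at_right_between rp (rp + 1) ltac:(lra)); apply filter_imp; intros x Hx.
  rewrite E by lra; now rewrite normsq_0.
Qed.

Lemma subharmonic_profile_scal M a k rp f c :
  (forall r, rp < r -> is_deriveC f r (DeriveC f r)) ->
  subharmonic_profile M a k rp f -> subharmonic_profile M a k rp (fun r => f r * c)%C.
Proof.
intros df [H1 H2]; split.
- intros r Hr; destruct (H1 r Hr) as [l [Hl Hl0]].
  exists (normsq c * l); split; [|apply Rmult_le_pos; [apply normsq_ge_0|easy]].
  apply (is_derive_ext_loc (fun r => normsq c * radial_flux M a k f r)).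
  + generalize (open_gt rp r Hr); apply filter_imp; intros x Hx.
    unfold radial_flux.
    rewrite (DeriveC_unique (fun r => f r * c)%C x (DeriveC f x * c)%C).
    * rewrite dotC_mult_r; match goal with |- ?x = ?y => change (@eq R x y) end; ring.
    * apply (is_deriveC_eq _ _ _ _ (is_deriveC_mult _ _ _ _ _ (df x Hx)
        (is_deriveC_const c x))); ring.
  + now apply is_derive_scal.
- apply (filterlim_ext (fun r => normsq (f r) * normsq c)).
  { intros r; now rewrite normsq_mult. }
  replace (locally 0) with (locally (0 * normsq c)) by (rewrite Rmult_0_l; reflexivity).
  apply (filterlim_comp_2 _ _ Rmult H2 (filterlim_const (normsq c))).
  apply (filterlim_mult 0 (normsq c)).
Qed.

(** With [x = |m|], the three conclusions serve the angular bound, the convexity of the radial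
    profiles, and the nonvanishing of the logarithmic coefficient for spin +2. *)
Lemma large_m_threshold (nu eta A B Cst : R) :
  0 < nu -> 0 <= eta < 1 ->
  exists m0 : nat, forall x, INR m0 <= x ->
    0 <= nu * x ^ 2 - 16 * x /\
    eta * nu * x ^ 2 + Cst <= nu * x ^ 2 - 16 * x /\
    A + B * x <= nu * x ^ 2 - 16 * x.
Proof.
intros Hnu Heta; set (d := (1 - eta) * nu).
assert (Hd : 0 < d) by (apply Rmult_lt_0_compat; lra).
set (T := 16 + Rabs B + Rabs A + Rabs Cst).
(* The threshold gives [x >= 1] and [T <= d x], so [d x^2 >= T x] dominates the linear and constant
   terms collected in [T]. *)
destruct (INR_unbounded (1 + T / d)) as [m0 Hm0]; exists m0; intros x Hx.
assert (HB := Rabs_pos B); assert (HA := Rabs_pos A); assert (HC := Rabs_pos Cst).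
assert (HB' := Rle_abs B); assert (HA' := Rle_abs A); assert (HC' := Rle_abs Cst).
assert (HT : 0 < T / d) by (apply Rdiv_lt_0_compat; [unfold T; lra|easy]).
assert (H1 : T <= d * x).
{ apply (Rle_trans _ (d * (T / d))); [right; field; lra|].
  apply Rmult_le_compat_l; lra. }
assert (Hx1 : 1 <= x) by lra.
assert (H2 : T * x <= d * x ^ 2) by nra.
assert (H3 : (16 + Rabs B) * x + Rabs A + Rabs Cst <= T * x) by (unfold T; nra).
assert (H4 : d * x ^ 2 = nu * x ^ 2 - eta * nu * x ^ 2) by (unfold d; ring).
assert (H5 : 0 <= eta * nu * x ^ 2).
{ apply Rmult_le_pos; [apply Rmult_le_pos; lra|apply pow2_ge_0]. }
assert (H6 : B * x <= Rabs B * x) by nra.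
assert (0 <= Rabs B * x) by nra.
repeat split; lra.
Qed.

Lemma filterlim_dotC {T} (F : (T -> Prop) -> Prop) {FF : Filter F} (f g : T -> C) (l l' : C) :
  filterlim f F (locally l) -> filterlim g F (locally l') ->
  filterlim (fun x => dotC (f x) (g x)) F (locally (dotC l l')).
Proof.
intros Hf Hg; unfold dotC.
apply (filterlim_comp_2 (G := locally (Re l * Re l')) (H := locally (Im l * Im l')) _ _ Rplus).
- apply (filterlim_comp_2 (G := locally (Re l)) (H := locally (Re l')) _ _ Rmult).
  + exact (filterlim_Re _ _ _ Hf).
  + exact (filterlim_Re _ _ _ Hg).
  + apply (filterlim_mult (Re l) (Re l')).
- apply (filterlim_comp_2 (G := locally (Im l)) (H := locally (Im l')) _ _ Rmult).
  + exact (filterlim_Im _ _ _ Hf).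
  + exact (filterlim_Im _ _ _ Hg).
  + apply (filterlim_mult (Im l) (Im l')).
- apply (filterlim_plus (Re l * Re l') (Im l * Im l')).
Qed.

Lemma is_derive_within_conj f l :
  is_derive_within (V := R_NormedModule) (fun x => x <= 0) f 1 0 l ->
  is_derive_within (V := R_NormedModule) (fun x => x <= 0)
    (fun x => Cconj (f x)) 1 0 (Cconj l).
Proof.
intros H P [eps HP].
assert (Hc : locally l (fun z : C => P (Cconj z))).
{ exists eps; intros z [Hz1 Hz2]; apply HP; split; [exact Hz1|].
  unfold ball in Hz2 |- *; simpl in Hz2 |- *.
  unfold AbsRing_ball, abs, minus, plus, opp in Hz2 |- *; simpl in Hz2 |- *.
  replace (- snd z + - - snd l) with (- (snd z + - snd l)) by ring.
  now rewrite Rabs_Ropp. }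
generalize (H _ Hc); unfold filtermap, within; apply filter_imp.
intros h Hh Hw; assert (Q := Hh Hw).
rewrite Cmult_conj, Cminus_conj in Q.
replace (Cconj (RtoC (/ h))) with (RtoC (/ h)) in Q; [exact Q|].
apply C_ext; simpl; [reflexivity|ring].
Qed.

(** If the product vanishes for all [r] at this [th], the zero profile applies; otherwise there is a
    point with both factors nonzero, which is what yields a separation constant. *)
Lemma mode_subharmonic M a k rp rstar s m (Rf Sf : R -> C) A Cst th :
  0 <= a -> 0 < k -> a * k < 1 -> 0 < rp ->
  Delta M a k rp = 0 -> 0 < dDelta M a k rp ->
  (forall x, rp < x -> - Cst <= radial_potential M a k x) ->
  is_tortoise M a k rp rstar ->
  is_extension_to_infinity rp rstar s
    (stationary_mode s m (omega_plus a rp) Rf Sf) A ->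
  solves_teukolsky M a k rp s (stationary_mode s m (omega_plus a rp) Rf Sf) ->
  0 <= mu a k rp * IZR m ^ 2 - 16 * Rabs (IZR m) ->
  (a / (k * rp ^ 2)) ^ 2 * mu a k rp * IZR m ^ 2 + Cst
    <= mu a k rp * IZR m ^ 2 - 16 * Rabs (IZR m) ->
  (forall lam th0, smoothC (fun r => rp < r) Rf ->
     (forall r, rp < r ->
        radial_op M a k (IZR m) (IZR m * omega_plus a rp) Rf r = (lam * Rf r)%C) ->
     mu a k rp * IZR m ^ 2 - 16 * Rabs (IZR m) <= Re lam ->
     0 < th0 < PI -> Sf th0 <> 0%C ->
     filterlim (fun r => normsq (Rf r)) (at_right rp) (locally 0)) ->
  0 < th < PI ->
  subharmonic_profile M a k rp (fun r => Rf r * Sf th)%C.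
Proof.
intros Ha Hk Hak Hp D0 D1 HC Ht HA Hsol Hm1 Hm2 Hdec Hth.
destruct (classic (exists r0, rp < r0 /\ (Rf r0 * Sf th)%C <> 0%C)) as [[r0 [Hr0 N]]|Z].
- assert (NR : Rf r0 <> 0%C) by (intros E; apply N; rewrite E; ring).
  assert (NS : Sf th <> 0%C) by (intros E; apply N; rewrite E; ring).
  destruct (nontrivial_mode M a k rp rstar s m Rf Sf A r0 th Ha Hk Hak Hp D0 D1 Ht HA
    Hsol Hm1 Hr0 Hth NR NS) as [HR [lam [Hode Hlam]]].
  apply subharmonic_profile_scal; [exact (proj1 (HR 1%nat))|split].
  + intros r Hr.
    apply (radial_flux_increasing M a k rp (IZR m) Rf lam Cst r Hk Hp D0 D1 HC HR Hode);
      [lra|exact Hr].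
  + exact (Hdec lam th HR Hode Hlam Hth NS).
- apply (subharmonic_profile_zero M a k rp).
  intros r Hr.
  destruct (classic ((Rf r * Sf th)%C = 0%C)) as [E|N]; [exact E|].
  exfalso; apply Z; exists r; exact (conj Hr N).
Qed.

(** At infinity the boundary conditions make the two fluxes cancel. *)
Lemma boundary_flux_cancel (u0 u1 v0 v1 : C) :
  (u0 - Cconj v0)%C = 0%C -> (u1 + Cconj v1)%C = 0%C ->
  2 * dotC u0 u1 + 2 * dotC v0 v1 = 0.
Proof.
intros E0 E1.
assert (H1 := f_equal Re E0); assert (H2 := f_equal Im E0).
assert (H3 := f_equal Re E1); assert (H4 := f_equal Im E1).
unfold dotC; destruct u0, u1, v0, v1; simpl in *; unfold Re, Im in *; simpl in *.
replace r with r3 by lra; replace r0 with (- r4) by lra.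
replace r1 with (- r5) by lra; replace r2 with r6 by lra; ring.
Qed.

(** The boundary conditions do not force either flux to vanish at infinity, only their sum; so the
    convexity argument is applied to [|U|^2 + |V|^2], and nonnegativity separates the two at the
    end. *)
Lemma pair_vanishing M a k rp rstar (U V : R -> C) (u v : nat -> R -> C) :
  0 < rp -> Delta M a k rp = 0 -> 0 < dDelta M a k rp ->
  is_tortoise M a k rp rstar ->
  (forall n x, x < 0 -> is_deriveC (u n) x (u (S n) x)) ->
  (forall n x, x < 0 -> is_deriveC (v n) x (v (S n) x)) ->
  (forall n, filterlim (u n) (at_left 0) (locally (u n 0))) ->
  (forall n, filterlim (v n) (at_left 0) (locally (v n 0))) ->
  (forall r, rp < r -> U r = u 0%nat (rstar r)) ->
  (forall r, rp < r -> V r = v 0%nat (rstar r)) ->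
  subharmonic_profile M a k rp U -> subharmonic_profile M a k rp V ->
  (u 0%nat 0 - Cconj (v 0%nat 0))%C = 0%C ->
  (u 1%nat 0 + Cconj (v 1%nat 0))%C = 0%C ->
  forall r, rp < r -> U r = 0%C /\ V r = 0%C.
Proof.
intros Hp D0 D1 Ht du dv cu cv EU EV [FU LU] [FV LV] B0 B1.
assert (HD := fun x => Delta_pos M a k rp x Hp D0 D1).
assert (Hn := fun r => tortoise_neg M a k rp rstar r Hp HD Ht).
assert (dU := fun r => is_deriveC_rstar M a k rp rstar _ _ U r Hn Ht (du 0%nat) EU).
assert (dV := fun r => is_deriveC_rstar M a k rp rstar _ _ V r Hn Ht (dv 0%nat) EV).
assert (Hw : forall r, rp < r -> 0 < r ^ 2 + a ^ 2) by (intros; nra).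
assert (flux : forall W w0 w1, (forall r, rp < r -> W r = w0 (rstar r)) ->
   (forall r, rp < r -> is_deriveC W r
      (RtoC ((r ^ 2 + a ^ 2) / Delta M a k r) * w1 (rstar r))%C) ->
   forall r, rp < r -> radial_flux M a k W r = 2 * dotC (w0 (rstar r)) (w1 (rstar r))).
{ intros W w0 w1 E dW r Hr; unfold radial_flux.
  rewrite (DeriveC_unique _ _ _ (dW r Hr)), E, dotC_scal_r by easy.
  field; split; apply Rgt_not_eq; [now apply HD|now apply Hw]. }
assert (Z : forall r, rp < r -> normsq (U r) + normsq (V r) = 0).
{ apply (convex_vanishing _
    (fun r => radial_flux M a k U r + radial_flux M a k V r)
    (fun r => Derive (radial_flux M a k U) r + Derive (radial_flux M a k V) r)
    (fun r => (r ^ 2 + a ^ 2) / Delta M a k r)).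
  - intros r _; apply Rplus_le_le_0_compat; apply normsq_ge_0.
  - intros r Hr.
    apply (is_derive_eq _ _ _ _ (is_derive_plus _ _ _ _ _
      (is_derive_normsq _ _ _ (dU r Hr)) (is_derive_normsq _ _ _ (dV r Hr)))).
    rewrite (flux U _ _ EU dU r Hr), (flux V _ _ EV dV r Hr), EU, EV by easy.
    rewrite !dotC_scal_r; unfold plus; simpl; ring.
  - intros r Hr; apply Rdiv_lt_0_compat; [now apply Hw|now apply HD].
  - intros r Hr; destruct (FU r Hr) as [l [Hl _]]; destruct (FV r Hr) as [l' [Hl' _]].
    rewrite (is_derive_unique _ _ _ Hl), (is_derive_unique _ _ _ Hl').
    exact (is_derive_plus _ _ _ _ _ Hl Hl').
  - intros r Hr; destruct (FU r Hr) as [l [Hl P]]; destruct (FV r Hr) as [l' [Hl' P']].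
    rewrite (is_derive_unique _ _ _ Hl), (is_derive_unique _ _ _ Hl').
    now apply Rplus_le_le_0_compat.
  - assert (T := tortoise_at_left M a k rp rstar Hp HD Ht).
    rewrite <- (boundary_flux_cancel _ _ _ _ B0 B1).
    apply (filterlim_ext_loc (fun r => 2 * dotC (u 0%nat (rstar r)) (u 1%nat (rstar r))
       + 2 * dotC (v 0%nat (rstar r)) (v 1%nat (rstar r)))).
    { exists rp; intros r Hr.
      now rewrite (flux U _ _ EU dU r Hr), (flux V _ _ EV dV r Hr). }
    apply (filterlim_comp_2 (G := locally (2 * dotC (u 0%nat 0) (u 1%nat 0)))
      (H := locally (2 * dotC (v 0%nat 0) (v 1%nat 0))) _ _ Rplus).
    + apply (filterlim_comp _ _ _ (fun r => dotC (u 0%nat (rstar r)) (u 1%nat (rstar r)))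
        (Rmult 2) _ (locally (dotC (u 0%nat 0) (u 1%nat 0)))).
      * refine (filterlim_dotC (Rbar_locally p_infty) (fun r => u 0%nat (rstar r))
          (fun r => u 1%nat (rstar r)) _ _ _ _);
          exact (filterlim_comp _ _ _ _ _ _ _ _ T (cu _)).
      * apply (filterlim_scal_r 2 (dotC (u 0%nat 0) (u 1%nat 0))).
    + apply (filterlim_comp _ _ _ (fun r => dotC (v 0%nat (rstar r)) (v 1%nat (rstar r)))
        (Rmult 2) _ (locally (dotC (v 0%nat 0) (v 1%nat 0)))).
      * refine (filterlim_dotC (Rbar_locally p_infty) (fun r => v 0%nat (rstar r))
          (fun r => v 1%nat (rstar r)) _ _ _ _);
          exact (filterlim_comp _ _ _ _ _ _ _ _ T (cv _)).
      * apply (filterlim_scal_r 2 (dotC (v 0%nat 0) (v 1%nat 0))).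
    + apply (filterlim_plus (2 * dotC (u 0%nat 0) (u 1%nat 0))
        (2 * dotC (v 0%nat 0) (v 1%nat 0))).
  - replace (locally 0) with (locally (0 + 0)) by (rewrite Rplus_0_l; reflexivity).
    apply (filterlim_comp_2 (G := locally 0) (H := locally 0) _ _ Rplus LU LV).
    apply (filterlim_plus 0 0). }
intros r Hr; assert (H := Z r Hr).
assert (H1 := normsq_ge_0 (U r)); assert (H2 := normsq_ge_0 (V r)).
split; apply normsq_eq_0; lra.
Qed.

Theorem theorem1p2 :
  forall M a k rp : R,
    admissible M a k -> is_r_plus M a k rp -> a < k * rp ^ 2 ->
  exists m0 : nat,
  forall rstar : R -> R, is_tortoise M a k rp rstar ->
  forall m : Z, (Z.of_nat m0 <= Z.abs m)%Z ->
  ~ exists (Rp Sp Rm Sm : R -> C),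
      let alphap := stationary_mode plus2 m (omega_plus a rp) Rp Sp in
      let alpham := stationary_mode minus2 m (omega_plus a rp) Rm Sm in
      ~ (identically_zero rp alphap /\ identically_zero rp alpham) /\
      regular_up_to_infinity rp rstar plus2 alphap /\
      regular_up_to_infinity rp rstar minus2 alpham /\
      solves_teukolsky M a k rp plus2 alphap /\
      solves_teukolsky M a k rp minus2 alpham /\
      regular_at_horizon M a k rp rstar plus2 alphap /\
      regular_at_horizon M a k rp rstar minus2 alpham /\
      conformal_bc rp rstar alphap alpham.
Proof.
intros M a k rp Hadm Hrp HHR.
destruct (admissible_horizon M a k rp Hadm Hrp) as [Hp D1].
destruct Hadm as [HM [Hk [Ha [Hak _]]]]; destruct Hrp as [D0 _].
assert (HD := fun x => Delta_pos M a k rp x Hp D0 D1).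
destruct (radial_potential_lower_bound M a k rp HM Hp D0 D1) as [Cst HC].
destruct (horizon_decay_plus M a k rp Ha Hk Hp D0 D1) as [A [B Hdec]].
assert (Hmu := mu_pos a k rp Ha Hk Hak Hp).
(* The Hawking-Reall bound enters here: it leaves a positive fraction of [mu m^2] to absorb the
   lower-order terms. *)
assert (Heta : 0 <= (a / (k * rp ^ 2)) ^ 2 < 1).
{ assert (Hkp : 0 < k * rp ^ 2) by (apply Rmult_lt_0_compat; [easy|apply pow_lt; easy]).
  assert (0 <= a / (k * rp ^ 2)) by
    (apply Rmult_le_pos; [easy|apply Rlt_le, Rinv_0_lt_compat, Hkp]).
  assert (a / (k * rp ^ 2) < 1) by (apply -> Rcomplements.Rdiv_lt_1; easy).
  split; [apply pow2_ge_0|]; nra. }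
destruct (large_m_threshold _ _ A B Cst Hmu Heta) as [m0 Hm0].
exists m0; intros rstar Ht m Hm [Rp [Sp [Rm [Sm H]]]]; cbv zeta in H.
destruct H as [Hnz [_ [_ [Sop [Som [Hop [Hom [Ap [Am [EAp [EAm Hbc]]]]]]]]]]].
assert (Hm' : INR m0 <= Rabs (IZR m)).
{ rewrite <- abs_IZR, INR_IZR_INZ; now apply IZR_le. }
destruct (Hm0 _ Hm') as [T1 [T2 T3]].
rewrite pow2_abs in T1, T2, T3.
apply Hnz.
assert (Z : forall r th, exterior rp r th ->
   (Rp r * Sp th)%C = 0%C /\ (Rm r * Sm th)%C = 0%C).
{ intros r th [Hr Hth].
  destruct (extension_profile M a k rp rstar plus2 m _ Rp Sp Ap Hp HD Ht EAp)
    as [Fp [Gp [HFp [_ [EFp [Up _]]]]]].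
  destruct (extension_profile M a k rp rstar minus2 m _ Rm Sm Am Hp HD Ht EAm)
    as [Fm [Gm [HFm [_ [EFm [Um _]]]]]].
  destruct (smooth_on_radial Fp 0 (tan (th / 2)) 0 HFp) as [u [Eu [du [cu wu]]]].
  destruct (smooth_on_radial Fm 0 (tan (th / 2)) 0 HFm) as [v [Ev [dv [cv wv]]]].
  destruct (Hbc 0 th 0 Hth) as [B0 [dp [dm [Wp [Wm B1]]]]].
  assert (Hn := fun r => tortoise_neg M a k rp rstar r Hp HD Ht).
  apply (pair_vanishing M a k rp rstar (fun r => Rp r * Sp th)%C (fun r => Rm r * Sm th)%C
           u v Hp D0 D1 Ht du dv cu cv).
  - intros x Hx; rewrite Eu by (apply Rlt_le, Hn, Hx); now apply Up.
  - intros x Hx; rewrite Ev by (apply Rlt_le, Hn, Hx); now apply Um.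
  - apply (mode_subharmonic M a k rp rstar plus2 m Rp Sp Ap Cst th); try assumption.
    intros lam th0 HR Hode Hlam Hth0 NS; apply (Hdec (IZR m) lam Rp HR Hode); [|lra].
    intros q; now apply (mode_bounded_plus M a k rp rstar m Rp Sp th0 q).
  - apply (mode_subharmonic M a k rp rstar minus2 m Rm Sm Am Cst th); try assumption.
    intros lam th0 HR Hode Hlam Hth0 NS; apply (horizon_decay_minus M a k rp Rm D0 HD).
    now apply (mode_bounded_minus M a k rp rstar m Rm Sm th0).
  - rewrite Eu, Ev, <- EFp, <- EFm by lra; exact B0.
  (* The derivatives [dp] and [dm] in the boundary condition are identified with those of the smooth
     extensions by uniqueness of one-sided derivatives. *)
  - rewrite (is_derive_within_left_unique _ _ _ _ (fun x Hx =>
      eq_trans (Eu x Hx) (eq_sym (EFp x th Hx Hth))) wu Wp).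
    rewrite (is_derive_within_left_unique _ _ _ _ (fun x Hx =>
      f_equal Cconj (eq_trans (Ev x Hx) (eq_sym (EFm x th Hx Hth))))
      (is_derive_within_conj _ _ wv) Wm).
    exact B1.
  - exact Hr. }
split; intros t r th ph Hext; destruct (Z r th Hext) as [Z1 Z2];
  rewrite stationary_mode_modef; unfold modef; [rewrite Z1|rewrite Z2]; ring.
Qed.
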